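(* Let $V$ be a vector superspace over a field $\mathbb F$ of characteristic $0$, with an even endomorphism $\partial$. The vector superspaces $P^{\mathrm{cl}}(n)$, $n\ge0$, together with the actions of the symmetric groups $S_n$ and the composition maps defined in the context, form a (linear, unital, symmetric) superoperad, which is graded by $P^{\mathrm{cl}}(n)=\bigoplus_{r\ge0}\mathrm{gr}^rP^{\mathrm{cl}}(n)$, where $\mathrm{gr}^rP^{\mathrm{cl}}(n)$ is the subspace of all $f\in P^{\mathrm{cl}}(n)$ such that $f^\Gamma=0$ for every graph $\Gamma$ whose number of edges is not $r$.
   Context: **Graphs.** An $n$-graph has vertices $1,\dots,n$ and a (finite) collection of oriented edges $E(\Gamma)$ (multiple edges allowed). $\mathcal G(n)$ is the set of $n$-graphs without tadpoles (edges $i\to i$); $\mathcal G_0(n)\subset\mathcal G(n)$ the acyclic ones (no unoriented cycles, in particular no multiple edges). $\mathcal G(0)=\mathcal G_0(0)$ consists of the empty graph. An oriented cycle of $\Gamma$ is a set of edges $C=\{i_1\to i_2,i_2\to i_3,\dots,i_s\to i_1\}\subset E(\Gamma)$. For $\sigma\in S_n$, $\sigma(\Gamma)$ is $\Gamma$ with the vertex $i$ relabeled $\sigma(i)$. **The spaces.** $\langle\Phi\rangle$ denotes the image of $\Phi$. $P^{\mathrm{cl}}(n)$ is the superspace of maps $f:\mathcal G(n)\times V^{\otimes n}\to V[\lambda_1,\dots,\lambda_n]/\langle\partial+\lambda_1+\dots+\lambda_n\rangle$, $(\Gamma,v)\mapsto f^\Gamma_{\lambda_1,\dots,\lambda_n}(v)$,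 linear in $v$, satisfying: - cycle relations: $f^\Gamma=0$ unless $\Gamma\in\mathcal G_0(n)$; and $\sum_{e\in C}f^{\Gamma\setminus e}=0$ for every oriented cycle $C\subset E(\Gamma)$; - sesquilinearity: for every connected component of $\Gamma$, with vertex set $I$: $\frac{\partial}{\partial\lambda_i}f^\Gamma_{\lambda_1,\dots,\lambda_n}(v)$ is the same for all $i\in I$; and $f^\Gamma_{\lambda_1,\dots,\lambda_n}\big(\sum_{i\in I}\partial_iv\big)=-\big(\sum_{i\in I}\lambda_i\big)f^\Gamma_{\lambda_1,\dots,\lambda_n}(v)$, where $\partial_i$ is $\partial$ acting on the $i$-th factor of $V^{\otimes n}$. **Action.** $(f^\sigma)^\Gamma_{\lambda_1,\dots,\lambda_n}(v_1\otimes\dots\otimes v_n)=\epsilon_v(\sigma)f^{\sigma(\Gamma)}_{\lambda_{\sigma^{-1}(1)},\dots,\lambda_{\sigma^{-1}(n)}}(v_{\sigma^{-1}(1)}\otimes\dots\otimes v_{\sigma^{-1}(n)})$, $\epsilon_v(\sigma)=\prod_{i<j,\sigma(i)>\sigma(j)}(-1)^{p(v_i)p(v_j)}$. **Cocomposition of graphs.** For $m_1,\dots,m_n\ge0$, $M_i=m_1+\dots+m_i$, $M_0=0$, and $\Gamma\in\mathcal G(M_n)$: $\Delta_i(\Gamma)\in\mathcal G(m_i)$ ($1\le i\le n$) is the full subgraph on vertices $M_{i-1}+1,\dots,M_i$ (relabeled $1,\dots,m_i$), and $\Delta_0(\Gamma)\in\mathcal G(n)$ is obtained by collapsing, for each $i$,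 these vertices and the edges among them into a single vertex $i$ (an isolated vertex if $m_i=0$). Each edge of $\Gamma$ corresponds to exactly one edge of $\Delta_0(\Gamma),\Delta_1(\Gamma),\dots,\Delta_n(\Gamma)$. **External connection.** For $k\in\{M_{i-1}+1,\dots,M_i\}$ let $\mathcal E(k)\subset\{1,\dots,n\}$ be the set of $j$ for which there is an unoriented path in $\Delta_0(\Gamma)$ without repeated edges joining $j$ to $i$ whose edge at $i$ comes from an edge of $\Gamma$ having $k$ as head or tail. For variables $x_1,\dots,x_n$ put $X(k)=\sum_{j\in\mathcal E(k)}x_j$. **Composition.** For $f\in P^{\mathrm{cl}}(n)$, $g_i\in P^{\mathrm{cl}}(m_i)$, $\Lambda_i=\sum_{k=M_{i-1}+1}^{M_i}\lambda_k$: $(f(g_1\otimes\dots\otimes g_n))^\Gamma=0$ if $\Delta_0(\Gamma)$ is not acyclic; otherwise $$(f(g_1\otimes\dots\otimes g_n))^\Gamma_{\lambda_1,\dots,\lambda_{M_n}}(v_1\otimes\dots\otimes v_{M_n})=\pm f^{\Delta_0(\Gamma)}_{\Lambda_1,\dots,\Lambda_n}\Big(\bigotimes_{i=1}^n(g_i)^{\Delta_i(\Gamma)}_{\lambda_{M_{i-1}+1}+X(M_{i-1}+1),\dots,\lambda_{M_i}+X(M_i)}(v_{M_{i-1}+1}\otimes\dots\otimes v_{M_i})\Big),$$ where, after expanding the tensor product as a polynomial in $x_1,\dots,x_n$, each $x_j$ is replaced by $\Lambda_j+\partial$ with $\partial$ acting on the $j$-th tensor factor, and $\pm=(-1)^{\sum_{i<j}p(g_j)(p(v_{M_{i-1}+1})+\dots+p(v_{M_i}))}$.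 The unit is the identity in $P^{\mathrm{cl}}(1)\cong\mathrm{End}_{\mathbb F[\partial]}(V)$. **Superoperad.** Associativity $f((g_1\otimes\dots\otimes g_n)(h_1\otimes\dots\otimes h_{M_n}))=(f(g_1\otimes\dots\otimes g_n))(h_1\otimes\dots\otimes h_{M_n})$ (Koszul signs), unit axioms $f(1\otimes\dots\otimes1)=1(f)=f$, and equivariance $f^\sigma(g_1^{\tau_1}\otimes\dots\otimes g_n^{\tau_n})=\epsilon_g(\sigma)\big(f(g_{\sigma^{-1}(1)}\otimes\dots\otimes g_{\sigma^{-1}(n)})\big)^{\sigma(\tau_1,\dots,\tau_n)}$, where $\sigma(\tau_1,\dots,\tau_n)\in S_{M_n}$ maps $M_{i-1}+j$ ($1\le j\le m_i$) to $m_{\sigma^{-1}(1)}+\dots+m_{\sigma^{-1}(\sigma(i)-1)}+\tau_i(j)$. Graded: the $S_n$-actions preserve $\mathrm{gr}^r$, and compositions add degrees. *)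

(* Defs.v *)
From HB Require Import structures.
From mathcomp Require Import all_boot all_order all_algebra all_fingroup.
From mathcomp Require Import ring_quotient generic_quotient.
From mathcomp Require Import boolp functions.
From mathcomp Require Import finmap monalg.

Set Implicit Arguments.
Unset Strict Implicit.
Unset Printing Implicit Defensive.

Import GRing.Theory.
Local Open Scope ring_scope.

(* [par false] is the even part and [par true] the odd part. *)
Record is_superspace (F : fieldType) (V : lmodType F) (par : bool -> V -> Prop)
    : Prop := {
  superspace0 : forall b, par b 0;
  superspaceD : forall b (a : F) u v, par b u -> par b v -> par b (a *: u + v);
  superspace_decomp :
    forall v, exists v0 v1, [/\ par false v0, par true v1 & v = v0 + v1];
  superspace_direct : forall v, par false v -> par true v -> v = 0 }.

Definition parity_sum (I : finType) (p : I -> bool) : bool :=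
  odd (\sum_(i : I) p i).

(* Parity of sum_(i < j, sigma i > sigma j) p i * p j. *)
Definition koszul_perm n (s : 'S_n) (p : 'I_n -> bool) : bool :=
  odd (\sum_(i < n) \sum_(j < n | (i < j) && (s j < s i)) p i * p j)%N.

(* Parity of sum_(i < j) p j * (q_(i,1) + ... + q_(i,m_i)): moving the j-th
   object past the arguments of all the previous blocks. *)
Definition koszul_blocks n (m : 'I_n -> nat) (p : 'I_n -> bool)
    (q : 'I_(\sum_(i < n) m i) -> bool) : bool :=
  odd (\sum_(j < n) \sum_(i < n | i < j) \sum_(a < m i)
         p j * q (tagnat.Rank i a))%N.

(* [tagnat.Rank i a] is the element M_(i-1) + a of the i-th block; it identifies
   the pairs (i, a) with 'I_(\sum_i m i). *)

Lemma dim_assoc n (m : 'I_n -> nat) (l : 'I_(\sum_(i < n) m i) -> nat) :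
  (\sum_(i < n) \sum_(j < m i) l (tagnat.Rank i j)
   = \sum_(k < \sum_(i < n) m i) l k)%N.
Proof.
rewrite sig_big_dep /= [RHS](reindex _ tagnat.rank_bij_on) /=.
by apply: eq_bigr => -[i j].
Qed.

Lemma dim_unitr n : (\sum_(i < n) 1 = n)%N.
Proof. by rewrite sum1_card card_ord. Qed.

Lemma dim_unitl n : (\sum_(i < 1) n = n)%N.
Proof. by rewrite big_ord1. Qed.

Lemma dim_perm n (m : 'I_n -> nat) (s : 'S_n) :
  (\sum_(i < n) m (s^-1%g i) = \sum_(i < n) m i)%N.
Proof. by rewrite [RHS](reindex_perm (s^-1)%g). Qed.

Section BlockPerm.
Variables (n : nat) (m : 'I_n -> nat) (s : 'S_n) (t : forall i, 'S_(m i)).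

Lemma block_perm_dim i : m i = m (s^-1%g (s i)).
Proof. by rewrite permK. Qed.

(* The j-th element of the i-th block goes to the (t i j)-th element of the
   (s i)-th block, for the block sizes m_(s^-1 1), ..., m_(s^-1 n). *)
Definition block_perm_fun (k : 'I_(\sum_(i < n) m i)) : 'I_(\sum_(i < n) m i) :=
  cast_ord (dim_perm m s)
    (tagnat.Rank (s (tagnat.sig1 k))
       (cast_ord (block_perm_dim (tagnat.sig1 k))
          (t (tagnat.sig1 k) (tagnat.sig2 k)))).

Lemma block_perm_inj : injective block_perm_fun.
Proof.
move=> k l /cast_ord_inj /(congr1 val) /eqP /=.
rewrite tagnat.eq_Rank /= => /andP[/eqP/perm_inj].
rewrite -[k]tagnat.sigK -[l]tagnat.sigK.
rewrite /tagnat.sig1 /tagnat.sig2 !tagnat.rankK.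
case: (tagnat.sig k) (tagnat.sig l) => [i a] [j b] /= eij.
by case: _ / eij in b * => /eqP/val_inj/perm_inj ->.
Qed.

Definition block_perm : 'S_(\sum_(i < n) m i) := perm block_perm_inj.

End BlockPerm.

Section Superoperad.
Variables (F : fieldType) (P : nat -> lmodType F).
Variable par : forall n, bool -> P n -> Prop.

(* The product [(t * s)%g] of permutations in MathComp is [s \o t], so that
   [soact_comp] reads (f^s)^t = f^(s t) in functional notation. *)
Record superoperad := Superoperad {
  socomp : forall n (m : 'I_n -> nat),
    P n -> (forall i, P (m i)) -> P (\sum_(i < n) m i)%N;
  soact : forall n, 'S_n -> P n -> P n;
  sounit : P 1;

  so_superspace : forall n, is_superspace (@par n);

  socomp_linl : forall n m (a : F) (f f' : P n) (g : forall i, P (m i)),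
    socomp (a *: f + f') g = a *: socomp f g + socomp f' g;
  socomp_linr : forall n m (f : P n) (g : forall i, P (m i)) i (a : F)
      (x y : P (m i)),
    socomp f (dfwith g (a *: x + y))
    = a *: socomp f (dfwith g x) + socomp f (dfwith g y);
  socomp_par : forall n m (f : P n) (g : forall i, P (m i)) p q,
    par p f -> (forall i, par (q i) (g i)) ->
    par (p (+) parity_sum q) (socomp f g);

  soact_lin : forall n (s : 'S_n) (a : F) (f f' : P n),
    soact s (a *: f + f') = a *: soact s f + soact s f';
  soact_par : forall n (s : 'S_n) p (f : P n), par p f -> par p (soact s f);
  soact_1 : forall n (f : P n), soact 1%g f = f;
  soact_comp : forall n (s t : 'S_n) (f : P n),
    soact t (soact s f) = soact (t * s)%g f;

  so_assoc : forall n (m : 'I_n -> nat) (l : 'I_(\sum_(i < n) m i) -> nat)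
      (f : P n) (g : forall i, P (m i)) (h : forall k, P (l k)) p q,
    (forall i, par (p i) (g i)) -> (forall k, par (q k) (h k)) ->
    (-1) ^+ koszul_blocks p q *:
      ecast N (P N) (dim_assoc l)
        (socomp f (fun i => socomp (g i) (fun j => h (tagnat.Rank i j))))
    = socomp (socomp f g) h;

  sounit_even : par false sounit;
  so_unitr : forall n (f : P n),
    ecast N (P N) (dim_unitr n) (socomp f (fun=> sounit)) = f;
  so_unitl : forall n (f : P n),
    ecast N (P N) (dim_unitl n) (socomp sounit (fun=> f)) = f;

  so_equivariant : forall n (m : 'I_n -> nat) (s : 'S_n)
      (t : forall i, 'S_(m i)) (f : P n) (g : forall i, P (m i)) p,
    (forall i, par (p i) (g i)) ->
    socomp (soact s f) (fun i => soact (t i) (g i))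
    = (-1) ^+ koszul_perm s p *:
        soact (block_perm s t)
          (ecast N (P N) (dim_perm m s)
             (socomp f (fun i => g (s^-1%g i)))) }.

Record is_graded (O : superoperad) (gr : forall n, nat -> P n -> Prop)
    : Prop := {
  gr0 : forall n r, gr n r 0;
  grD : forall n r (a : F) f f', gr n r f -> gr n r f' -> gr n r (a *: f + f');
  gr_decomp : forall n (f : P n), exists N (c : nat -> P n),
    (forall r, gr n r (c r)) /\ f = \sum_(r < N) c r;
  gr_direct : forall n N (c : nat -> P n),
    (forall r, gr n r (c r)) -> \sum_(r < N) c r = 0 ->
    forall r, (r < N)%N -> c r = 0;
  (* each [gr n r] is a sub-superspace *)
  gr_super : forall n r f0 f1, par false f0 -> par true f1 ->
    gr n r (f0 + f1) -> gr n r f0 /\ gr n r f1;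
  gr_act : forall n r (s : 'S_n) f, gr n r f -> gr n r (soact O s f);
  gr_comp : forall n (m : 'I_n -> nat) r (q : 'I_n -> nat) (f : P n)
      (g : forall i, P (m i)),
    gr n r f -> (forall i, gr (m i) (q i) (g i)) ->
    gr _ (r + \sum_(i < n) q i)%N (socomp O f g) }.

End Superoperad.

(* A graph is the multiplicity function of its oriented edges; a pair (i, j)
   stands for the edge i -> j. There are no tadpoles. *)
Definition loopless n (E : {ffun 'I_n * 'I_n -> nat}) : bool :=
  [forall i, E (i, i) == 0%N].

Definition graph n := {E : {ffun 'I_n * 'I_n -> nat} | loopless E}.

Definition mult n (G : graph n) (e : 'I_n * 'I_n) : nat := val G e.

Lemma mkgraph_proof n (E : 'I_n -> 'I_n -> nat) :
  loopless [ffun e => if e.1 == e.2 then 0%N else E e.1 e.2].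
Proof. by apply/forallP => i; rewrite ffunE eqxx. Qed.

(* Any tadpoles present in [E] are discarded. *)
Definition mkgraph n (E : 'I_n -> 'I_n -> nat) : graph n :=
  Sub _ (mkgraph_proof E).

Definition nb_edges n (G : graph n) : nat := (\sum_e mult G e)%N.

Definition del_edge n (G : graph n) (e : 'I_n * 'I_n) : graph n :=
  mkgraph (fun i j => mult G (i, j) - (e == (i, j)))%N.

Definition relabel n (s : 'S_n) (G : graph n) : graph n :=
  mkgraph (fun i j => mult G (s^-1%g i, s^-1%g j)).

(* A step is an edge with a direction of travel: [(e, true)] travels along [e],
   and [(e, false)] against it. *)
Definition step n : Type := ('I_n * 'I_n) * bool.
Definition step_src n (t : step n) := if t.2 then t.1.1 else t.1.2.
Definition step_tgt n (t : step n) := if t.2 then t.1.2 else t.1.1.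

Fixpoint walk n (i : 'I_n) (w : seq (step n)) (j : 'I_n) : bool :=
  if w is t :: w' then (step_src t == i) && walk (step_tgt t) w' j else i == j.

(* Unoriented paths without repeated edges; parallel edges are distinct, so [e]
   may be used [mult G e] times. *)
Definition trail n (G : graph n) (i : 'I_n) (w : seq (step n)) (j : 'I_n) :=
  walk i w j && [forall e, count_mem e (unzip1 w) <= mult G e]%N.

Definition acyclic n (G : graph n) : Prop :=
  forall i w, trail G i w i -> w = [::].

Definition oriented_cycle n (G : graph n) (C : seq ('I_n * 'I_n)) : Prop :=
  C <> [::] /\ exists i, trail G i [seq (e, true) | e <- C] i.

Definition adjacent n (G : graph n) : rel 'I_n :=
  fun i j => (0 < mult G (i, j))%N || (0 < mult G (j, i))%N.

Definition component n (G : graph n) (i : 'I_n) : {set 'I_n} :=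
  [set j | connect (adjacent G) i j].

Section Cocomposition.
Variables (n : nat) (m : 'I_n -> nat) (G : graph (\sum_(i < n) m i)).

Definition inner_graph (i : 'I_n) : graph (m i) :=
  mkgraph (fun a b => mult G (tagnat.Rank i a, tagnat.Rank i b)).

Definition outer_graph : graph n :=
  mkgraph (fun i j => \sum_(a < m i) \sum_(b < m j)
                        mult G (tagnat.Rank i a, tagnat.Rank j b))%N.

(* j belongs to E(k). The trail is run from the block of k to j, so that its
   edge at the block of k is the first one. *)
Definition ext_connected (k : 'I_(\sum_(i < n) m i)) (j : 'I_n) : Prop :=
  exists (t : step n) (w : seq (step n)),
    trail outer_graph (tagnat.sig1 k) (t :: w) j /\
    exists a b, [/\ (0 < mult G (a, b))%N,
                    (tagnat.sig1 a, tagnat.sig1 b) = t.1 & k = a \/ k = b].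

End Cocomposition.

(* F[x_i : i in I] *)
Notation spoly F I := {malg F[{cmonom I}]}.

(* Unfolding [mkmalgU] in failed conversion tests is prohibitively expensive,
   hence the locks on [svar] and [vmonom]. *)
Fact monom_key : unit. Proof. by []. Qed.

Definition svar (F : fieldType) (I : choiceType) : I -> spoly F I :=
  locked_with monom_key (fun i => << ucm i >>).

Lemma svarE (F : fieldType) (I : choiceType) (i : I) :
  svar F i = << ucm i >>.
Proof. by rewrite /svar unlock. Qed.


Section VPoly.
Variables (F : fieldType) (V : lmodType F).

(* V[x_i : i in I] *)
Definition vpoly (I : choiceType) := {malg V[{cmonom I}]}.

HB.instance Definition _ I := GRing.Zmodule.on (vpoly I).

Definition vmonom (I : choiceType) : {cmonom I} -> V -> vpoly I :=
  locked_with monom_key (fun b v => << v *g b >>).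

Lemma vmonomE (I : choiceType) (b : {cmonom I}) v : vmonom b v = << v *g b >>.
Proof. by rewrite /vmonom unlock. Qed.

Section Extension.
Variables (I : choiceType) (M : zmodType).

(* The extension to polynomials of a map given on the monomials v x^b. *)
Definition vext (T : {cmonom I} -> V -> M) (p : vpoly I) : M :=
  \sum_(b <- msupp p) T b p@_b.

End Extension.

Definition vscale I (c : F) : vpoly I -> vpoly I :=
  vext (fun b v => vmonom b (c *: v)).

Lemma vcoeffU I (b k : {cmonom I}) (v : V) :
  (vmonom b v)@_k = v *+ (b == k).
Proof. by rewrite vmonomE mcoeffU. Qed.

Lemma vpolyE I (p : vpoly I) : p = \sum_(b <- msupp p) vmonom b p@_b.
Proof. by rewrite [LHS]monalgE; apply: eq_bigr => b _; rewrite vmonomE. Qed.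

Lemma vmonom_is_zmod_morphism I (b : {cmonom I}) :
  zmod_morphism (vmonom b).
Proof. by move=> u v; rewrite !vmonomE raddfB. Qed.

HB.instance Definition _ I (b : {cmonom I}) :=
  GRing.isZmodMorphism.Build V (vpoly I) (vmonom b) (vmonom_is_zmod_morphism b).

Lemma vscaleE I c (p : vpoly I) b : (vscale c p)@_b = c *: p@_b.
Proof.
rewrite [p@_b](congr1 (mcoeff b) (vpolyE p)) /vscale /vext.
rewrite [LHS]raddf_sum [X in _ *: X]raddf_sum scaler_sumr /=.
by apply: eq_bigr => a _; rewrite !vcoeffU scalerMnr.
Qed.

Lemma vscaleA I c d (p : vpoly I) : vscale c (vscale d p) = vscale (c * d) p.
Proof. by apply/malgP => b; rewrite !vscaleE scalerA. Qed.

Lemma vscale1 I (p : vpoly I) : vscale 1 p = p.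
Proof. by apply/malgP => b; rewrite !vscaleE scale1r. Qed.

Lemma vscaleDr I : right_distributive (@vscale I) +%R.
Proof. by move=> c p q; apply/malgP => b; rewrite !(mcoeffD, vscaleE) scalerDr. Qed.

Lemma vscaleDl I (p : vpoly I) : {morph (@vscale I)^~ p : c d / c + d}.
Proof. by move=> c d; apply/malgP => b; rewrite !(mcoeffD, vscaleE) scalerDl. Qed.

HB.instance Definition _ I := GRing.Zmodule_isLmodule.Build F (vpoly I)
  (@vscaleA I) (@vscale1 I) (@vscaleDr I) (@vscaleDl I).

Lemma mcoeff_vscale I c (p : vpoly I) b : (c *: p)@_b = c *: p@_b.
Proof. exact: vscaleE. Qed.

Lemma vmonom_linear I (k : {cmonom I}) :
  linear (fun v : V => vmonom k v).
Proof.
move=> c u v; apply/malgP => b; rewrite [LHS]vcoeffU [RHS]mcoeffD.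
by rewrite mcoeff_vscale !(vcoeffU k b) mulrnDl scalerMnr.
Qed.

Lemma vextEw I (M : zmodType) (T : {cmonom I} -> V -> M) (p : vpoly I)
    (d : {fset {cmonom I}}) :
  (forall b, T b 0 = 0) -> (msupp p `<=` d)%fset ->
  vext T p = \sum_(b <- d) T b p@_b.
Proof.
move=> T0 le_d; rewrite /vext (big_fset_incl _ le_d) //= => b _.
by move=> /mcoeff_outdom ->.
Qed.

Lemma vextU I (M : zmodType) (T : {cmonom I} -> V -> M) b v :
  (forall b, T b 0 = 0) -> vext T (vmonom b v) = T b v.
Proof.
move=> T0; have le_b : (msupp (vmonom b v) `<=` [fset b])%fset.
  by rewrite vmonomE msuppU_le.
by rewrite (vextEw T0 le_b) big_seq_fset1 vcoeffU eqxx.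
Qed.

Lemma vpoly_ind I (P : vpoly I -> Prop) :
  P 0 -> (forall p q, P p -> P q -> P (p + q)) ->
  (forall b v, P (vmonom b v)) -> forall p, P p.
Proof. by move=> P0 PD PM p; rewrite [p]vpolyE; apply: big_ind. Qed.

Lemma vext_linear I (M : lmodType F) (T : {cmonom I} -> V -> M) :
  (forall b, linear (T b)) -> linear (vext T).
Proof.
move=> linT c p q.
have T0 b : T b 0 = 0.
  have /esym/eqP := linT b 1 0 0.
  by rewrite !scale1r addr0 -subr_eq0 addrK => /eqP.
pose d := (msupp p `|` msupp q `|` msupp (c *: p + q))%fset.
rewrite !(@vextEw _ _ T _ d) //; last first.
- by apply/fsubsetP => b hb; rewrite !inE hb ?orbT.
- by apply/fsubsetP => b hb; rewrite !inE hb ?orbT.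
- by apply/fsubsetP => b hb; rewrite !inE hb ?orbT.
rewrite scaler_sumr -big_split /=; apply: eq_bigr => b _.
by rewrite mcoeffD mcoeff_vscale linT.
Qed.


Section Operators.
Variable I : choiceType.

Definition vconst (v : V) : vpoly I := vmonom mone v.

Definition vmap (d : V -> V) : vpoly I -> vpoly I :=
  vext (fun b v => vmonom b (d v)).

Definition vmulX (i : I) : vpoly I -> vpoly I :=
  vext (fun b v => vmonom (mmul (ucm i) b) v).

Definition vderiv (i : I) : vpoly I -> vpoly I :=
  vext (fun b v => vmonom (divcm b (ucm i)) (v *+ b i)).

Definition vtens (q : spoly F I) (v : V) : vpoly I :=
  \sum_(a <- msupp q) vmonom a (q@_a *: v).

End Operators.

(* Substitution of th i for the variable x_i. *)
Definition vsubst (I : finType) (J : choiceType) (th : I -> spoly F J) :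
    vpoly I -> vpoly J :=
  vext (fun b v => vtens (\prod_(i : I) th i ^+ b i) v).

Lemma vmulX_linear (I : choiceType) (i : I) : linear (vmulX i).
Proof.
by apply: vext_linear => b; apply: vmonom_linear.
Qed.

HB.instance Definition _ (I : choiceType) (i : I) :=
  GRing.isLinear.Build F (vpoly I) (vpoly I) *:%R (vmulX i) (vmulX_linear i).

Lemma vderiv_linear (I : choiceType) (i : I) : linear (vderiv i).
Proof.
apply: vext_linear => b c u v /=; rewrite mulrnDl scalerMnr.
exact: vmonom_linear.
Qed.

HB.instance Definition _ (I : choiceType) (i : I) :=
  GRing.isLinear.Build F (vpoly I) (vpoly I) *:%R (vderiv i) (vderiv_linear i).

Lemma vmap_linear (I : choiceType) (d : {linear V -> V}) :
  linear (@vmap I d).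
Proof.
by apply: vext_linear => b c u v /=; rewrite linearP; apply: vmonom_linear.
Qed.

HB.instance Definition _ (I : choiceType) (d : {linear V -> V}) :=
  GRing.isLinear.Build F (vpoly I) (vpoly I) *:%R (@vmap I d) (vmap_linear d).

Section Commutation.
Variable I : choiceType.
Implicit Types (i j : I) (b : {cmonom I}) (v : V) (p : vpoly I).

Lemma vmulXU i b v : vmulX i (vmonom b v) = vmonom (mmul (ucm i) b) v.
Proof. by apply: vextU => c; rewrite raddf0. Qed.

Lemma vmapU (d : {linear V -> V}) b v :
  vmap d (vmonom b v) = vmonom b (d v).
Proof. by apply: vextU => c; rewrite linear0 raddf0. Qed.

Lemma vderivU i b v :
  vderiv i (vmonom b v) = vmonom (divcm b (ucm i)) (v *+ b i).
Proof. by apply: vextU => c; rewrite mul0rn raddf0. Qed.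

Lemma vmulXC i j p : vmulX i (vmulX j p) = vmulX j (vmulX i p).
Proof.
elim/vpoly_ind: p => [|p q hp hq|b v]; first by rewrite !raddf0.
  by rewrite !raddfD /= hp hq.
by rewrite !vmulXU Monoid.mulmCA.
Qed.

Lemma vmulX_map (d : {linear V -> V}) i p :
  vmulX i (vmap d p) = vmap d (vmulX i p).
Proof.
elim/vpoly_ind: p => [|p q hp hq|b v]; first by rewrite !raddf0.
  by rewrite !raddfD /= hp hq.
by rewrite !(vmulXU, vmapU).
Qed.

Lemma vderiv_map (d : {linear V -> V}) i p :
  vderiv i (vmap d p) = vmap d (vderiv i p).
Proof.
elim/vpoly_ind: p => [|p q hp hq|b v]; first by rewrite !raddf0.
  by rewrite !raddfD /= hp hq.
by rewrite !(vderivU, vmapU) linearMn.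
Qed.

Lemma vderiv_mulX i j p :
  vderiv i (vmulX j p) = vmulX j (vderiv i p) + p *+ (i == j).
Proof.
elim/vpoly_ind: p => [|p q hp hq|b v]; first by rewrite !raddf0 add0r mul0rn.
  by rewrite !raddfD /= hp hq mulrnDl addrACA.
rewrite !(vmulXU, vderivU) cmM cmU eq_sym.
have [->|neq_ij] /= := eqVneq i j; last first.
  rewrite addr0; congr vmonom; apply/eqP/cmP => k.
  rewrite divcmE !cmM divcmE !cmU.
  by have [<-|] := eqVneq j k; rewrite ?(negPf neq_ij) ?subn0 ?add0n.
have -> : divcm (mmul (ucm j) b) (ucm j) = b.
  by apply/eqP/cmP => k; rewrite divcmE cmM addKn.
rewrite mulr1n add1n mulrSr raddfD /=; congr (_ + _).
have [->|b_gt0] := posnP (b j); first by rewrite !mulr0n !raddf0.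
congr vmonom; apply/eqP/cmP => k; rewrite cmM divcmE !cmU.
by case: eqVneq => [<-|_]; rewrite ?subn0 // subnKC.
Qed.

End Commutation.

End VPoly.

Section Coker.
Variables (F : fieldType) (M : lmodType F) (Phi : {linear M -> M}).

Definition img (p : M) : bool := `[< exists q, p = Phi q >].

Lemma img_zmod_closed : zmod_closed img.
Proof.
split=> [|p q /asboolP[p' ->] /asboolP[q' ->]]; apply/asboolP.
  by exists 0; rewrite linear0.
by exists (p' - q'); rewrite linearB.
Qed.

HB.instance Definition _ := GRing.isZmodClosed.Build M img img_zmod_closed.

Definition coker := Quotient.quot (GRing.ZmodClosed.clone M img _).

HB.instance Definition _ := GRing.Zmodule.on coker.

Definition cl (p : M) : coker := (\pi_coker p)%qT.

Definition crepr (w : coker) : M := repr w.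

Lemma creprK w : cl (crepr w) = w.
Proof. exact: reprK. Qed.

Lemma clP p q : reflect (exists r, p - q = Phi r) (cl p == cl q).
Proof. by rewrite -Quotient.idealrBE; apply: (iffP (asboolP _)). Qed.

Lemma cl_is_zmod_morphism : zmod_morphism cl.
Proof. by move=> p q; rewrite /cl raddfB. Qed.

HB.instance Definition _ :=
  GRing.isZmodMorphism.Build M coker cl cl_is_zmod_morphism.

Definition cscale (c : F) (w : coker) : coker := cl (c *: crepr w).

Lemma cscaleE c p : cscale c (cl p) = cl (c *: p).
Proof.
apply/eqP/clP; have /eqP/clP[r hr] := creprK (cl p).
by exists (c *: r); rewrite -scalerBr hr linearZ.
Qed.

Lemma cscaleA c d w : cscale c (cscale d w) = cscale (c * d) w.
Proof. by rewrite -[w]creprK !cscaleE scalerA. Qed.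

Lemma cscale1 w : cscale 1 w = w.
Proof. by rewrite -[w]creprK cscaleE scale1r. Qed.

Lemma cscaleDr : right_distributive cscale +%R.
Proof.
move=> c w x; rewrite -[w]creprK -[x]creprK -raddfD !cscaleE -raddfD /=.
by rewrite scalerDr.
Qed.

Lemma cscaleDl w : {morph cscale^~ w : c d / c + d}.
Proof. by move=> c d; rewrite -[w]creprK !cscaleE -raddfD scalerDl. Qed.

HB.instance Definition _ :=
  GRing.Zmodule_isLmodule.Build F coker cscaleA cscale1 cscaleDr cscaleDl.

Lemma cl_is_scalable : scalable cl.
Proof. by move=> c p; rewrite -cscaleE. Qed.

HB.instance Definition _ :=
  GRing.isScalable.Build F M coker *:%R cl cl_is_scalable.

End Coker.

Section Classical.
Variables (F : fieldType) (V : lmodType F) (d : {linear V -> V}).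

(* The operator d + lambda_1 + ... + lambda_n. *)
Definition dlam n (p : vpoly V 'I_n) : vpoly V 'I_n :=
  vmap d p + \sum_(i < n) vmulX i p.

Lemma dlam_linear n : linear (@dlam n).
Proof.
move=> c p q; rewrite /dlam linearP scalerDr addrACA; congr (_ + _).
by rewrite scaler_sumr -big_split; apply: eq_bigr => i _; rewrite linearP.
Qed.

HB.instance Definition _ n :=
  GRing.isLinear.Build F (vpoly V 'I_n) (vpoly V 'I_n) *:%R (@dlam n)
    (@dlam_linear n).

Lemma dlam_mulX n (i : 'I_n) p : dlam (vmulX i p) = vmulX i (dlam p).
Proof.
rewrite /dlam raddfD /= vmulX_map; congr (_ + _).
by rewrite [RHS]raddf_sum; apply: eq_bigr => j _; apply: vmulXC.
Qed.

Lemma dlam_deriv n (i : 'I_n) p : vderiv i (dlam p) = dlam (vderiv i p) + p.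
Proof.
rewrite /dlam raddfD /= vderiv_map -addrA; congr (_ + _).
rewrite [LHS]raddf_sum /=.
under eq_bigr do rewrite vderiv_mulX; rewrite big_split /=; congr (_ + _).
rewrite (bigD1 i) //= eqxx mulr1n big1 ?addr0 // => j.
by rewrite eq_sym => /negPf ->.
Qed.

(* V[lambda_1, ..., lambda_n] / <d + lambda_1 + ... + lambda_n> *)
Definition Vlam n : lmodType F := coker (@dlam n).

Definition lclass n (p : vpoly V 'I_n) : Vlam n := cl (@dlam n) p.

HB.instance Definition _ n :=
  GRing.Linear.copy (@lclass n) (cl (@dlam n)).

Definition qmulX n (i : 'I_n) (w : Vlam n) : Vlam n :=
  lclass (vmulX i (crepr w)).

(* The partial derivatives do not descend to the quotient, but their
   differences do. *)
Definition qderivB n (i j : 'I_n) (w : Vlam n) : Vlam n :=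
  lclass (vderiv i (crepr w) - vderiv j (crepr w)).

(* Independent of the representative when th maps lambda_1 + ... + lambda_n to
   lambda_1 + ... + lambda_N. *)
Definition qsubst n N (th : 'I_n -> spoly F 'I_N) (w : Vlam n) : Vlam N :=
  lclass (vsubst th (crepr w)).

Lemma lclassP n (p q : vpoly V 'I_n) :
  reflect (exists r, p - q = dlam r) (lclass p == lclass q).
Proof. exact: clP. Qed.

Lemma lclassK n (p : vpoly V 'I_n) : exists r, crepr (lclass p) = p + dlam r.
Proof.
have /eqP/lclassP[r hr] := creprK (lclass p).
by exists r; rewrite -hr addrC subrK.
Qed.

Lemma qmulXE n (i : 'I_n) p : qmulX i (lclass p) = lclass (vmulX i p).
Proof.
have [r hr] := lclassK p; apply/eqP/lclassP; exists (vmulX i r).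
by rewrite hr raddfD /= addrC addKr dlam_mulX.
Qed.

Lemma qderivBE n (i j : 'I_n) p :
  qderivB i j (lclass p) = lclass (vderiv i p - vderiv j p).
Proof.
have [r hr] := lclassK p; apply/eqP/lclassP; exists (vderiv i r - vderiv j r).
rewrite hr (raddfD (vderiv i)) (raddfD (vderiv j)) /= !dlam_deriv.
have aux (W : zmodType) (a b x y z : W) :
    a + (x + z) - (b + (y + z)) - (a - b) = x - y.
  rewrite [- (b + _)]opprD addrACA [LHS]addrAC subrr add0r.
  by rewrite opprD addrACA subrr addr0.
by rewrite aux -(raddfB (@dlam n)).
Qed.

Lemma lclass_crepr n (w : Vlam n) : lclass (crepr w) = w.
Proof. exact: creprK. Qed.

Lemma qmulX_linear n (i : 'I_n) : linear (qmulX i).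
Proof.
move=> c w x; rewrite -(lclass_crepr w) -(lclass_crepr x) -linearP.
by rewrite !qmulXE !linearP.
Qed.

HB.instance Definition _ n (i : 'I_n) :=
  GRing.isLinear.Build F (Vlam n) (Vlam n) *:%R (qmulX i) (qmulX_linear i).

Lemma qderivB_linear n (i j : 'I_n) : linear (qderivB i j).
Proof.
move=> c w x; rewrite -(lclass_crepr w) -(lclass_crepr x) -linearP.
rewrite !qderivBE -linearP; congr (lclass _).
by rewrite (linearP (vderiv i)) (linearP (vderiv j)) scalerBr opprD addrACA.
Qed.

HB.instance Definition _ n (i j : 'I_n) :=
  GRing.isLinear.Build F (Vlam n) (Vlam n) *:%R (qderivB i j)
    (qderivB_linear i j).

Definition upd n (v : 'I_n -> V) (i : 'I_n) (x : V) : 'I_n -> V :=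
  fun j => if j == i then x else v j.

Record is_pcl n (f : graph n -> ('I_n -> V) -> Vlam n) : Prop := {
  (* a linear map on the n-th tensor power of V is a multilinear map on V^n *)
  pcl_linear : forall G v i (a : F) x y,
    f G (upd v i (a *: x + y))
    = a *: f G (upd v i x) + f G (upd v i y);
  pcl_acyclic : forall G v, ~ acyclic G -> f G v = 0;
  pcl_cycle : forall G C v, oriented_cycle G C ->
    \sum_(e <- C) f (del_edge G e) v = 0;
  pcl_deriv : forall G v i j, j \in component G i -> qderivB i j (f G v) = 0;
  pcl_sesqui : forall G v i,
    \sum_(j in component G i) f G (upd v j (d (v j)))
    = - \sum_(j in component G i) qmulX j (f G v) }.

Definition is_pclb n : pred (graph n -> ('I_n -> V) -> Vlam n) :=
  fun f => `[< is_pcl f >].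

Lemma is_pcl_submod_closed n : submod_closed (@is_pclb n).
Proof.
split.
  have E0 G v : (0 : graph n -> ('I_n -> V) -> Vlam n) G v = 0 by [].
  apply/asboolP; split=> [G v i a x y|G v _|G C v _|G v i j _|G v i].
  - by rewrite !E0 scaler0 addr0.
  - by rewrite E0.
  - by rewrite big1.
  - by rewrite E0 linear0.
  - by rewrite !big1 ?oppr0 // => j _; rewrite E0 linear0.
move=> c f g /asboolP hf /asboolP hg; apply/asboolP.
have E G v : (c *: f + g) G v = c *: f G v + g G v by [].
split=> [G v i a x y|G v nG|G C v hC|G v i j hj|G v i].
- rewrite !E (pcl_linear hf) (pcl_linear hg) !scalerDr !scalerA [c * a]mulrC.
  by rewrite addrACA.
- by rewrite E (pcl_acyclic hf) // (pcl_acyclic hg) // scaler0 addr0.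
- under eq_bigr do rewrite E.
  rewrite big_split -scaler_sumr /= (pcl_cycle hf) // (pcl_cycle hg) //.
  by rewrite scaler0 addr0.
- by rewrite E (linearP (qderivB i j)) /= (pcl_deriv hf) // (pcl_deriv hg) // scaler0 addr0.
under eq_bigr do rewrite E.
under [in RHS]eq_bigr do rewrite E linearP /=.
rewrite !big_split -!scaler_sumr /= (pcl_sesqui hf) (pcl_sesqui hg).
by rewrite scalerN opprD.
Qed.

HB.instance Definition _ n :=
  GRing.isSubmodClosed.Build F _ (@is_pclb n) (is_pcl_submod_closed n).

Record pcl n := Pcl_of { pcl_val : graph n -> ('I_n -> V) -> Vlam n;
                         pcl_valP : is_pclb pcl_val }.

HB.instance Definition _ n := [isSub for @pcl_val n].
HB.instance Definition _ n := [Choice of pcl n by <:].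
HB.instance Definition _ n := [SubChoice_isSubLmodule of pcl n by <:].

Definition Pcl n : lmodType F := pcl n.

Variable par : bool -> V -> Prop.

Definition Vlam_par n b (w : Vlam n) : Prop :=
  exists p, lclass p = w /\ forall k, par b p@_k.

Definition Pcl_par n b (f : Pcl n) : Prop :=
  forall G v q, (forall i, par (q i) (v i)) ->
    Vlam_par (b (+) parity_sum q) (pcl_val f G v).

Definition Pcl_gr n (r : nat) (f : Pcl n) : Prop :=
  forall G v, nb_edges G <> r -> pcl_val f G v = 0.

Section Composition.
Variables (n : nat) (m : 'I_n -> nat).
Local Notation N := (\sum_(i < n) m i)%N.

Definition Lambda (j : 'I_n) : spoly F 'I_N :=
  \sum_(a < m j) svar F (tagnat.Rank j a).

(* The polynomials in lambda_1, ..., lambda_N, x_1, ..., x_n have their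
   variables indexed by 'I_N + 'I_n. This one is lambda_k + X(k), for
   k = M_(i-1) + a. *)
Definition shifted_lambda (G : graph N) (i : 'I_n) (a : 'I_(m i)) :
    spoly F ('I_N + 'I_n)%type :=
  svar F (inl (tagnat.Rank i a)) +
  \sum_(j < n | `[< ext_connected G (tagnat.Rank i a) j >]) svar F (inr j).

(* lambda_k acts on Vlam N-valued functions of v_1, ..., v_n by multiplication,
   and x_j as Lambda_j + d, with d acting on the j-th argument. *)
Definition var_op (x : 'I_N + 'I_n) (phi : ('I_n -> V) -> Vlam N) :
    ('I_n -> V) -> Vlam N :=
  match x with
  | inl k => fun u => qmulX k (phi u)
  | inr j => fun u => \sum_(a < m j) qmulX (tagnat.Rank j a) (phi u)
                      + phi (upd u j (d (u j)))
  end.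

Definition monom_op (e : {cmonom ('I_N + 'I_n)%type})
    (phi : ('I_n -> V) -> Vlam N) : ('I_n -> V) -> Vlam N :=
  foldr (fun x => iter (e x) (var_op x)) phi (enum {: 'I_N + 'I_n}).

(* The value of phi on the tensor product of the polynomials h_1, ..., h_n:
   the product is expanded into monomials, which act through [monom_op]. *)
Definition tensor_eval (phi : ('I_n -> V) -> Vlam N)
    (h : 'I_n -> vpoly V ('I_N + 'I_n)%type) : Vlam N :=
  let S := (\bigcup_(i <- enum 'I_n) msupp (h i))%fset in
  \sum_(c : {ffun 'I_n -> S})
    monom_op (\big[mmul/mone]_(i < n) val (c i)) phi
      (fun i => (h i)@_(val (c i))).

(* The right-hand side of the composition formula, without its sign. [g i] is
   a representative of the value of the i-th inner operation. *)
Definition comp_value (f : Pcl n) (G : graph N)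
    (g : forall i, vpoly V 'I_(m i)) : Vlam N :=
  tensor_eval (fun u => qsubst Lambda (pcl_val f (outer_graph G) u))
    (fun i => vsubst (shifted_lambda G (i := i)) (g i)).

End Composition.

(* The formula holds for all representatives [w i] of the values of the g_i;
   homogeneous g_i and v_k suffice by multilinearity. *)
Definition has_Pcl_comp (O : superoperad Pcl_par) : Prop :=
  forall n (m : 'I_n -> nat) (f : Pcl n) (g : forall i, Pcl (m i)) p,
    (forall i, Pcl_par (p i) (g i)) ->
  forall (G : graph (\sum_(i < n) m i)) v q,
    (forall k, par (q k) (v k)) ->
    (~ acyclic (outer_graph G) -> pcl_val (socomp O f g) G v = 0) /\
    (acyclic (outer_graph G) ->
     forall w : (forall i, vpoly V 'I_(m i)),
       (forall i, lclass (w i) = pcl_val (g i) (inner_graph G i)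
                                   (fun a => v (tagnat.Rank i a))) ->
       pcl_val (socomp O f g) G v
       = (-1) ^+ koszul_blocks p q *: comp_value f G w).

Definition has_Pcl_action (O : superoperad Pcl_par) : Prop :=
  forall n (s : 'S_n) (f : Pcl n) (G : graph n) v q,
    (forall i, par (q i) (v i)) ->
    pcl_val (soact O s f) G v
    = (-1) ^+ koszul_perm s q *:
        qsubst (fun i => svar F (s^-1%g i))
          (pcl_val f (relabel s G) (fun i => v (s^-1%g i))).

Definition has_Pcl_unit (O : superoperad Pcl_par) : Prop :=
  forall (G : graph 1) v,
    pcl_val (sounit O) G v = lclass (vconst 'I_1 (v ord0)).

End Classical.

(* Main.v *)
(** Let X_j = Lambda_j + d_j be the operator standing for x_j. Composition
    evaluates f^(Delta_0 Gamma) at polynomials in which each lambda_k acts as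
    T_k = lambda_k + sum_(j in E(k)) X_j. Of the sets E(k) a single property
    matters: for every edge of Gamma between vertices k, l of distinct blocks
    i, j, and every vertex a,
      [i in E(a)] + [a = k] = [j in E(a)] + [a = l].
    This determines [. in E(a)] up to functions chi that are constant on the
    components of Delta_0(Gamma), and sesquilinearity of f says precisely that
    sum_j chi_j X_j vanishes for such chi. Independence of the representatives,
    the relations defining P^cl, associativity and equivariance all follow by
    induction on the polynomial arguments, one factor lambda_k at a time.

    In the cycle relations, deleting different edges of a cycle leads to
    different sets E(k). By Taylor's formula, in characteristic 0, the value of
    g_i only depends on the sums of the variables over the components of
    Delta_i(Gamma), and the sum of the T_k over such a component acts in the
    same way whichever edge is deleted.

    Signs are inserted afterwards, by projecting the g_i and the v_k to their
    homogeneous components. *)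

Require Import Defs.
From HB Require Import structures.
From mathcomp Require Import all_boot all_order all_algebra all_fingroup.
From mathcomp Require Import boolp functions.
From mathcomp Require Import finmap monalg.

Set Implicit Arguments.
Unset Strict Implicit.
Unset Printing Implicit Defensive.

Import GRing.Theory.
Local Open Scope ring_scope.

(** * Polynomials with coefficients in a vector space *)

(** The expansion into monomials is awkward to compute with, since its index set depends on the
    supports of all arguments. It serves mainly to derive one rule: a factor lambda_a in a slot may
    be removed if phi is replaced by T_a phi. Every later identity is therefore proved for a class
    of functions phi stable under the T_a, not just for the function given by f; [good] is that
    class.

    A composition involves two choices, of representatives and of a solution psi of the coboundary
    condition. [comp_opE] makes both free, so that each argument can pick the ones adapted to it.
    For the cycle relations one pair must serve all deleted edges: representatives can be shared
    because deleting an edge between blocks keeps every inner graph, and psi is taken from a single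
    deletion. The relation for f can then be applied under one common evaluation.

    The two sides of associativity, of equivariance and of the unit laws number their arguments
    differently. Decompositions into blocks are therefore arbitrary data subject to compatibility
    conditions, and casts appear only when the signs are put in. *)

Section PolynomialInduction.
Variables (F : fieldType) (V : lmodType F).

Lemma cmonom_ind (I : choiceType) (P : {cmonom I} -> Prop) :
  P mone -> (forall x b, P b -> P (mmul (ucm x) b)) -> forall b, P b.
Proof.
move=> P1 PX b; have [k] := ubnP (mdeg b); elim: k b => // k IH b.
have [hb|/fset0Pn[x hx]] := eqVneq (finsupp b) fset0.
  by have -> : b = mone by apply: mdeg_eq0I; rewrite mdegE hb big_seq_fset0.
have eb : b = mmul (ucm x) (divcm b (ucm x)).
  apply/eqP/cmP => y; rewrite cmM divcmE cmU.
  have [<-|_] := eqVneq x y; last by rewrite subn0.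
  by rewrite subnKC // lt0n cmE_neq0.
by rewrite ltnS eb mdegM mdegU add1n => /IH; apply: PX.
Qed.

Lemma vpoly_mulX_ind (I : choiceType) (P : vpoly V I -> Prop) :
  P 0 -> (forall p q, P p -> P q -> P (p + q)) ->
  (forall v, P (vconst I v)) -> (forall x p, P p -> P (vmulX x p)) ->
  forall p, P p.
Proof.
move=> P0 PD PC PX; apply: vpoly_ind => // b v.
elim/cmonom_ind: b => [|x b Pb]; first exact: PC.
by rewrite -vmulXU; apply: PX.
Qed.

Lemma vtensE (I : choiceType) (q : spoly F I) (v : V) (d : {fset {cmonom I}}) :
  (msupp q `<=` d)%fset -> vtens q v = \sum_(a <- d) vmonom a (q@_a *: v).
Proof.
move=> le_d; rewrite /vtens (big_fset_incl _ le_d) //= => a _.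
by move=> /mcoeff_outdom ->; rewrite scale0r raddf0.
Qed.

Lemma vtensD (I : choiceType) (p q : spoly F I) (v : V) :
  vtens (p + q) v = vtens p v + vtens q v.
Proof.
pose d := (msupp p `|` msupp q `|` msupp (p + q))%fset.
rewrite !(@vtensE _ _ _ d); first 1 last.
- by apply/fsubsetP => b hb; rewrite !inE hb ?orbT.
- by apply/fsubsetP => b hb; rewrite !inE hb ?orbT.
- by apply/fsubsetP => b hb; rewrite !inE hb ?orbT.
rewrite -big_split /=; apply: eq_bigr => a _.
by rewrite mcoeffD scalerDl raddfD.
Qed.

Lemma vtens0 (I : choiceType) (v : V) : vtens (0 : spoly F I) v = 0.
Proof. by rewrite /vtens msupp0 big_seq_fset0. Qed.

Lemma vtens_sum (I : choiceType) (T : Type) (s : seq T) (q : T -> spoly F I) (v : V) :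
  vtens (\sum_(x <- s) q x) v = \sum_(x <- s) vtens (q x) v.
Proof.
by elim: s => [|x s IH]; rewrite ?big_nil ?vtens0 // !big_cons vtensD IH.
Qed.

Lemma vtensU (I : choiceType) (a : {cmonom I}) (c : F) (v : V) :
  vtens << c *g a >> v = vmonom a (c *: v).
Proof.
rewrite (@vtensE _ _ _ [fset a]%fset); last exact: msuppU_le.
by rewrite big_seq_fset1 mcoeffUU.
Qed.

Lemma vtens_svarM (I : choiceType) (x : I) (q : spoly F I) (v : V) :
  vtens (svar F x * q) v = vmulX x (vtens q v).
Proof.
rewrite {1}(monalgE q) mulr_sumr vtens_sum [in RHS]/vtens raddf_sum /=.
apply: eq_bigr => a _; rewrite svarE malgM_def fgmulUU mul1r vtensU.
by rewrite vmulXU.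
Qed.

Lemma vtens1 (I : choiceType) (v : V) : vtens (1 : spoly F I) v = vconst I v.
Proof.
have -> : (1 : spoly F I) = << 1 *g mone >> by [].
by rewrite vtensU scale1r.
Qed.

Lemma vtens_linear (I : choiceType) (q : spoly F I) :
  linear (fun v : V => vtens q v).
Proof.
move=> c u v; rewrite /vtens scaler_sumr -big_split /=.
apply: eq_bigr => a _; rewrite scalerDr scalerA mulrC -scalerA.
exact: vmonom_linear.
Qed.

End PolynomialInduction.

Section LinearSubstitution.
Variables (F : fieldType) (V : lmodType F).
Variables (I : finType) (J : choiceType).

Lemma vsubstU (th : I -> spoly F J) b (v : V) :
  vsubst th (vmonom b v) = vtens (\prod_(i : I) th i ^+ b i) v.
Proof. by apply: vextU => c; rewrite /vtens big1 // => a _; rewrite scaler0 raddf0. Qed.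

Lemma vsubst_linear (th : I -> spoly F J) :
  linear (vsubst th : vpoly V I -> vpoly V J).
Proof. by apply: vext_linear => b; apply: vtens_linear. Qed.

HB.instance Definition _ (th : I -> spoly F J) :=
  GRing.isLinear.Build F (vpoly V I) (vpoly V J) *:%R (vsubst th)
    (vsubst_linear th).

Lemma vsubst_const (th : I -> spoly F J) (v : V) :
  vsubst th (vconst I v) = vconst J v.
Proof.
by rewrite vsubstU big1 ?vtens1 // => i _; rewrite cm1 expr0.
Qed.

Lemma vmap_const (K : choiceType) (d : {linear V -> V}) v :
  vmap d (vconst K v) = vconst K (d v).
Proof. exact: vmapU. Qed.

Lemma vsubst_map (d : {linear V -> V}) (th : I -> spoly F J) p :
  vmap d (vsubst th p) = vsubst th (vmap d p).
Proof.
elim/vpoly_ind: p => [|p q hp hq|b v]; first by rewrite !raddf0.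
  by rewrite !raddfD /= hp hq.
rewrite vmapU !vsubstU /vtens raddf_sum; apply: eq_bigr => a _.
by rewrite /= vmapU linearZ.
Qed.

Section Sums.
Variables (th : I -> spoly F J) (s : I -> seq J).
Hypothesis thE : forall i, th i = \sum_(y <- s i) svar F y.

(** Every substitution below sends a variable to a sum of variables, listed by [s i]. Multiplication
    by x_i then becomes a sum of multiplications by variables, and products of general polynomials
    never have to act on V[x]. *)
Lemma vsubst_mulX i (p : vpoly V I) :
  vsubst th (vmulX i p) = \sum_(y <- s i) vmulX y (vsubst th p).
Proof.
elim/vpoly_ind: p => [|p q hp hq|b v].
- by rewrite !raddf0 big1 // => y _; rewrite raddf0.
- rewrite !raddfD /= hp hq -big_split /=; apply: eq_bigr => y _.
  by rewrite raddfD.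
rewrite vmulXU !vsubstU; under [in LHS]eq_bigr do rewrite cmM cmU exprD.
rewrite big_split /= (bigD1 i) //= eqxx expr1 [X in _ * X * _]big1 ?mulr1; last first.
  by move=> j /negPf nij; rewrite eq_sym nij expr0.
rewrite {1}thE mulr_suml vtens_sum; apply: eq_bigr => y _.
by rewrite vtens_svarM.
Qed.

(** Used to identify composites of substitutions without expanding powers of sums. *)
Lemma vsubst_unique (A : vpoly V I -> vpoly V J) :
  A 0 = 0 -> (forall p q, A (p + q) = A p + A q) ->
  (forall v, A (vconst I v) = vconst J v) ->
  (forall i p, A (vmulX i p) = \sum_(y <- s i) vmulX y (A p)) ->
  A =1 vsubst th.
Proof.
move=> A0 AD AC AX; elim/vpoly_mulX_ind => [|p q hp hq|v|i p hp].
- by rewrite A0 raddf0.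
- by rewrite AD raddfD /= hp hq.
- by rewrite AC vsubst_const.
- by rewrite AX vsubst_mulX hp.
Qed.

Lemma vderiv_const (K : choiceType) (y : K) (v : V) :
  vderiv y (vconst K v) = 0.
Proof. by rewrite vderivU cm1 mulr0n raddf0. Qed.

(** Chain rule: the derivative of [th i] with respect to y is the number of occurrences of y in
    [s i]. *)
Lemma vderiv_subst y (p : vpoly V I) :
  vderiv y (vsubst th p)
  = \sum_(i : I) vsubst th (vderiv i p) *+ count_mem y (s i).
Proof.
elim/vpoly_mulX_ind: p => [|p q hp hq|v|i p hp].
- by rewrite !raddf0 big1 // => i _; rewrite !raddf0 mul0rn.
- rewrite !raddfD /= hp hq -big_split /=; apply: eq_bigr => i _.
  by rewrite !raddfD mulrnDl.
- rewrite vsubst_const vderiv_const big1 // => i _.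
  by rewrite vderiv_const raddf0 mul0rn.
rewrite vsubst_mulX raddf_sum /=.
under [LHS]eq_bigr do rewrite vderiv_mulX hp.
rewrite big_split /=.
have -> : \sum_(z <- s i) vsubst th p *+ (y == z) = vsubst th p *+ count_mem y (s i).
  rewrite sumrMnr; congr (_ *+ _); elim: (s i) => [|z t IH].
    by rewrite big_nil.
  by rewrite big_cons IH /= eq_sym.
under [RHS]eq_bigr => j _.
  rewrite vderiv_mulX raddfD /= mulrnDl vsubst_mulX raddfMn -mulrnA mulnC mulrnA.
  over.
rewrite big_split /=; congr (_ + _); last first.
  rewrite (bigD1 i) //= eqxx mulr1n big1 ?addr0 // => j /negPf->.
  by rewrite mulr0n.
under eq_bigr do rewrite raddf_sum /=.
rewrite exchange_big; apply: eq_bigr => j _ /=.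
by under eq_bigr do rewrite raddfMn; rewrite sumrMnl.
Qed.

End Sums.
End LinearSubstitution.

(** * Multilinear maps on tensor products of polynomials *)

Section Multilinear.
Variables (F : fieldType) (V M : lmodType F) (n : nat).
Implicit Types (phi psi : ('I_n -> V) -> M) (v : 'I_n -> V).

Definition multilinear phi : Prop :=
  forall v i (a : F) x y,
    phi (upd v i (a *: x + y)) = a *: phi (upd v i x) + phi (upd v i y).

Section Upd.
Variable W : lmodType F.
Implicit Type w : 'I_n -> W.

Lemma upd_same w i x : upd w i x i = x.
Proof. by rewrite /upd eqxx. Qed.

Lemma upd_id w i : upd w i (w i) = w.
Proof. by apply/funext => j; rewrite /upd; case: eqP => [->|]. Qed.

Lemma upd_upd w i x y : upd (upd w i x) i y = upd w i y.
Proof. by apply/funext => j; rewrite /upd; case: eqP. Qed.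

Lemma updC w i j x y : i != j -> upd (upd w i x) j y = upd (upd w j y) i x.
Proof.
move=> nij; apply/funext => k; rewrite /upd; case: eqP => // ->.
by rewrite eq_sym (negPf nij).
Qed.

End Upd.

Lemma multilinear0 phi v i : multilinear phi -> v i = 0 -> phi v = 0.
Proof.
move=> hphi vi0; have E : upd v i 0 = v by rewrite -vi0 upd_id.
have := hphi v i 1 0 0; rewrite scaler0 addr0 scale1r E => /esym/eqP.
by rewrite -subr_eq0 addrK => /eqP.
Qed.

Lemma multilinearP phi psi (c : F) :
  multilinear phi -> multilinear psi -> multilinear (c *: phi + psi).
Proof.
move=> hphi hpsi v i a x y.
have E u : (c *: phi + psi) u = c *: phi u + psi u by [].
by rewrite !E hphi hpsi !scalerDr !scalerA [c * a]mulrC addrACA.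
Qed.

Lemma multilinear_zero : multilinear (0 : ('I_n -> V) -> M).
Proof.
move=> v i a x y.
have E u : (0 : ('I_n -> V) -> M) u = 0 by [].
by rewrite !E scaler0 addr0.
Qed.

Lemma multilinear_sum (I : Type) (s : seq I) (phi : I -> ('I_n -> V) -> M) :
  (forall x, multilinear (phi x)) -> multilinear (\sum_(x <- s) phi x).
Proof.
move=> hphi; elim: s => [|x s IH].
  by rewrite big_nil; apply: multilinear_zero.
by rewrite big_cons -[phi x]scale1r; apply: multilinearP.
Qed.

Section Eval.
Variables (J : finType) (T : J -> (('I_n -> V) -> M) -> ('I_n -> V) -> M).

Record commuting_operators : Prop := {
  op_linear : forall x (c : F) phi psi,
    T x (c *: phi + psi) = c *: T x phi + T x psi;
  op_comm : forall x y phi, T x (T y phi) = T y (T x phi);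
  op_multilinear : forall x phi, multilinear phi -> multilinear (T x phi) }.

Hypothesis hT : commuting_operators.

(** [mop] and [teval] are [monom_op] and [tensor_eval] for arbitrary commuting operators; for the
    operators of the composition formula they are convertible to the originals. *)
Definition mop (e : {cmonom J}) phi : ('I_n -> V) -> M :=
  foldr (fun x => iter (e x) (T x)) phi (enum J).

Lemma iter_op_linear x k (c : F) phi psi :
  iter k (T x) (c *: phi + psi) = c *: iter k (T x) phi + iter k (T x) psi.
Proof. by elim: k => //= k ->; rewrite (op_linear hT). Qed.

Lemma mop_linear e (c : F) phi psi :
  mop e (c *: phi + psi) = c *: mop e phi + mop e psi.
Proof. by rewrite /mop; elim: (enum J) => //= x s ->; rewrite iter_op_linear. Qed.

Lemma mop_multilinear e phi : multilinear phi -> multilinear (mop e phi).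
Proof.
move=> hphi; rewrite /mop; elim: (enum J) => //= x s IH.
by elim: (e x) => //= k; apply: (op_multilinear hT).
Qed.

Lemma iter_op_comm x y k phi : T x (iter k (T y) phi) = iter k (T y) (T x phi).
Proof. by elim: k => //= k <-; rewrite (op_comm hT). Qed.

Lemma op_mop x e phi : T x (mop e phi) = mop e (T x phi).
Proof.
by rewrite /mop; elim: (enum J) => //= y s <-; rewrite iter_op_comm.
Qed.

Lemma mop1 phi : mop mone phi = phi.
Proof. by rewrite /mop; elim: (enum J) => //= x s ->; rewrite cm1. Qed.

Lemma mop_mulX x e phi : mop (mmul (ucm x) e) phi = mop e (T x phi).
Proof.
rewrite -op_mop /mop.
have : x \in enum J by rewrite mem_enum.
elim: (enum J) (enum_uniq J) => //= y s IH /andP[ys us].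
rewrite inE cmM cmU; have [->|_] /= := eqVneq; last first.
  by move=> xs; rewrite IH // iter_op_comm.
move=> _; congr (T y _); congr (iter _ _ _).
elim: s ys {IH us} => //= z s IH; rewrite inE negb_or => /andP[nyz ys].
by rewrite IH // cmM cmU (negPf nyz).
Qed.

(** The exponent set is a parameter, so that the values at tuples with different supports can be
    added over a common index set. *)
Definition teval_on (S : {fset {cmonom J}}) phi (h : 'I_n -> vpoly V J) : M :=
  \sum_(c : {ffun 'I_n -> S})
    mop (\big[mmul/mone]_(i < n) val (c i)) phi
      (fun i => (h i)@_(val (c i))).

Definition teval phi (h : 'I_n -> vpoly V J) : M :=
  teval_on (\bigcup_(i <- enum 'I_n) msupp (h i))%fset phi h.

(** A choice of exponents leaving S at an index i contributes the value of a multilinear function at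
    a tuple whose i-th entry, a coefficient outside the support, is zero. *)
Lemma teval_on_sub (S S' : {fset {cmonom J}}) phi h :
  multilinear phi -> (S `<=` S')%fset ->
  (forall i, (msupp (h i) `<=` S)%fset) ->
  teval_on S phi h = teval_on S' phi h.
Proof.
move=> hphi leS hS; rewrite /teval_on.
pose f (c : {ffun 'I_n -> S}) : {ffun 'I_n -> S'} := [ffun i => fincl leS (c i)].
have vf c i : val (f c i) = val (c i) by rewrite ffunE.
have f_inj : injective f.
  by move=> c c' /ffunP e; apply/ffunP => i; apply: val_inj; rewrite -!vf e.
rewrite [RHS](bigID (fun c => c \in [set f c | c in {: {ffun 'I_n -> S}}])) /=.
rewrite [X in _ + X]big1 ?addr0; last first.
  move=> c /imsetP hc.
  have [i hi] : exists i, val (c i) \notin S.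
    apply: contrapT => /forallNP hi; apply: hc.
    have hi' i : val (c i) \in S by apply/negPn/negP/hi.
    exists [ffun i => FSetSub (hi' i)] => //.
    by apply/ffunP => i; apply: val_inj; rewrite vf ffunE.
  apply: (@multilinear0 _ _ i); first exact: mop_multilinear.
  by apply: mcoeff_outdom; apply: contra hi => /(fsubsetP (hS i)).
rewrite big_imset /=; last by move=> c c' _ _; apply: f_inj.
rewrite [LHS]big_mkcond [RHS]big_mkcond; apply: eq_bigr => c _ /=.
congr (mop _ _ _); first by apply: eq_bigr => i _; rewrite vf.
by apply/funext => i; rewrite vf.
Qed.

Lemma tevalE (S : {fset {cmonom J}}) phi h :
  multilinear phi -> (forall i, (msupp (h i) `<=` S)%fset) ->
  teval phi h = teval_on S phi h.
Proof.
move=> hphi hS; apply: teval_on_sub => // [|i].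
  by apply/bigfcupsP => i _ _; apply: hS.
by apply: bigfcup_sup => //; rewrite mem_enum.
Qed.

Lemma teval_slot_linear phi h i (c : F) (p q : vpoly V J) :
  multilinear phi ->
  teval phi (upd h i (c *: p + q))
  = c *: teval phi (upd h i p) + teval phi (upd h i q).
Proof.
move=> hphi.
pose S := (\bigcup_(j <- enum 'I_n) msupp (h j) `|` msupp p `|` msupp q
           `|` msupp (c *: p + q))%fset.
have hS x j : (msupp x `<=` S)%fset -> (msupp (upd h i x j) `<=` S)%fset.
  rewrite /upd; case: eqP => // _ _; rewrite /S -!fsetUA.
  apply: fsubset_trans (fsubsetUl _ _).
  by apply: bigfcup_sup => //; rewrite mem_enum.
have hp : (msupp p `<=` S)%fset.
  by apply/fsubsetP => b hb; rewrite !inE hb ?orbT.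
have hq : (msupp q `<=` S)%fset.
  by apply/fsubsetP => b hb; rewrite !inE hb ?orbT.
have hpq : (msupp (c *: p + q) `<=` S)%fset.
  by apply/fsubsetP => b hb; rewrite in_fsetU hb orbT.
rewrite !(@tevalE S) //; try by move=> j; apply: hS.
rewrite /teval_on scaler_sumr -big_split /=; apply: eq_bigr => k _.
pose u := fun j => (h j)@_(val (k j)).
have E x : (fun j => (upd h i x j)@_(val (k j))) = upd u i x@_(val (k i)).
  by apply/funext => j; rewrite /upd; case: eqP => [->|].
by rewrite !E mcoeffD mcoeff_vscale mop_multilinear.
Qed.

Lemma teval_monom phi (b : 'I_n -> {cmonom J}) v :
  multilinear phi ->
  teval phi (fun i => vmonom (b i) (v i))
  = mop (\big[mmul/mone]_(i < n) b i) phi v.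
Proof.
move=> hphi; pose S := (\bigcup_(i <- enum 'I_n) [fset b i])%fset.
have hS i : b i \in S.
  by apply/bigfcupP; exists i; rewrite ?mem_enum ?inE.
rewrite (@tevalE S) // => [|i]; last first.
  rewrite vmonomE; apply: fsubset_trans (msuppU_le) _.
  by apply/fsubsetP => c; rewrite inE => /eqP ->.
pose c0 : {ffun 'I_n -> S} := [ffun i => FSetSub (hS i)].
rewrite /teval_on (bigD1 c0) //= [X in _ + X]big1 ?addr0.
  congr (mop _ _ _); first by apply: eq_bigr => i _; rewrite ffunE.
  by apply/funext => i; rewrite vcoeffU ffunE /= eqxx.
move=> c nc; have [i hi] : exists i, c i != c0 i.
  apply: contrapT => /forallNP hi; case/eqP: nc; apply/ffunP => i.
  by apply/eqP/negPn/negP/hi.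
apply: (@multilinear0 _ _ i); first exact: mop_multilinear.
rewrite vcoeffU; case: eqP => // e; case/eqP: hi; apply: val_inj.
by rewrite ffunE.
Qed.

Lemma teval_linear h (c : F) phi psi :
  teval (c *: phi + psi) h = c *: teval phi h + teval psi h.
Proof.
rewrite /teval /teval_on scaler_sumr -big_split; apply: eq_bigr => k _ /=.
by rewrite mop_linear.
Qed.

Lemma monomials_ind (Q : ('I_n -> vpoly V J) -> Prop) :
  (forall h i, Q (upd h i 0)) ->
  (forall h i p q, Q (upd h i p) -> Q (upd h i q) -> Q (upd h i (p + q))) ->
  (forall b v, Q (fun i => vmonom (b i) (v i))) ->
  forall h, Q h.
Proof.
move=> Q0 QD QM.
(* The list s holds the slots not yet known to contain a single monomial. *)
suff H (s : seq 'I_n) h :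
    (forall i, i \notin s -> exists b (u : V), h i = vmonom b u) -> Q h.
  by move=> h; apply: (H (enum 'I_n)) => i; rewrite mem_enum.
elim: s h => [|j s IH] h hh.
  have /choice[b /choice[v hv]] i : exists b (u : V), h i = vmonom b u by apply: hh.
  by rewrite (funext hv).
rewrite -(upd_id h j); elim/vpoly_ind: (h j) => [|p q|b v]; first exact: Q0.
  exact: QD.
apply: IH => i; rewrite /upd; case: eqP => [_ _|nij ns]; first by exists b, v.
by apply: hh; rewrite inE negb_or ns andbT; apply/eqP.
Qed.

Lemma teval_slotD phi h i (p q : vpoly V J) :
  multilinear phi ->
  teval phi (upd h i (p + q)) = teval phi (upd h i p) + teval phi (upd h i q).
Proof. by move=> hphi; rewrite -[p]scale1r teval_slot_linear // !scale1r. Qed.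

Lemma teval_slot0 phi h i : multilinear phi -> teval phi (upd h i 0) = 0.
Proof.
move=> hphi; have := teval_slotD h i 0 0 hphi.
by rewrite addr0 => /esym/eqP; rewrite -subr_eq0 addrK => /eqP.
Qed.

(** The basic exchange between a factor in a slot and an operator on phi. On tuples of monomials
    both sides are [mop] of the same total exponent, because all exponents are multiplied together
    before they act; multilinearity does the rest. *)
Lemma teval_slot_mulX phi h i x (p : vpoly V J) :
  multilinear phi ->
  teval phi (upd h i (vmulX x p)) = teval (T x phi) (upd h i p).
Proof.
move=> hphi; have hTphi := op_multilinear hT x hphi.
suff H g : teval phi (upd g i (vmulX x (g i))) = teval (T x phi) g.
  by rewrite -H upd_same upd_upd.
elim/monomials_ind: g => [g j|g j p' q'|b v].
- have [->|nij] := eqVneq j i; first by rewrite upd_same raddf0 upd_upd !teval_slot0.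
  by rewrite updC // !teval_slot0.
- have [->|nij] := eqVneq j i.
    rewrite !upd_same !upd_upd raddfD /= !teval_slotD //.
    by move=> -> ->.
  have E r : upd g j r i = g i by rewrite /upd eq_sym (negPf nij).
  by rewrite !E !(updC _ _ _ nij) !teval_slotD // => -> ->.
rewrite vmulXU teval_monom // -mop_mulX.
pose b' j := if j == i then mmul (ucm x) (b i) else b j.
have -> : upd (fun i => vmonom (b i) (v i)) i (vmonom (mmul (ucm x) (b i)) (v i))
    = fun j => vmonom (b' j) (v j).
  by apply/funext => j; rewrite /upd /b'; case: eqP => // ->.
rewrite teval_monom //; congr (mop _ _ _).
rewrite (bigD1 i) // [in RHS](bigD1 i) //= /b' eqxx -mulmA; congr (mmul _ _).
congr (mmul _ _); apply: eq_bigr => j /negPf -> //.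
Qed.

Lemma teval_const phi v : multilinear phi -> teval phi (fun i => vconst J (v i)) = phi v.
Proof. by move=> hphi; rewrite teval_monom // big1 // mop1. Qed.

(* The set of functions considered in [hC] is typically that of functions
   mapping homogeneous arguments into [K]. *)
Lemma teval_closed (K : M -> Prop) (C : (('I_n -> V) -> M) -> Prop)
    (R : 'I_n -> V -> Prop) phi h :
  K 0 -> (forall x y, K x -> K y -> K (x + y)) ->
  (forall x phi, C phi -> C (T x phi)) ->
  (forall phi v, C phi -> (forall i, R i (v i)) -> K (phi v)) ->
  C phi -> (forall i b, R i (h i)@_b) -> K (teval phi h).
Proof.
move=> K0 KD CT CK hphi hR; rewrite /teval /teval_on.
apply: big_ind => // c _; apply: CK => [|i]; last exact: hR.
rewrite /mop; elim: (enum J) => //= x s IH; elim: (_ x) => //= k.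
exact: CT.
Qed.

End Eval.
End Multilinear.

(** * The operators of the composition formula *)

Section DFWith.
Variables (I : eqType) (W : I -> Type).
Implicit Type w : forall i, W i.

Lemma dfwith_id w i : dfwith w (w i) = w.
Proof. by apply: functional_extensionality_dep => j; case: dfwithP. Qed.

Lemma dfwith_dfwith w i (x y : W i) : dfwith (dfwith w x) y = dfwith w y.
Proof.
apply: functional_extensionality_dep => j.
have [e|nij] := eqVneq i j; last by rewrite !dfwith_out.
by case: _ / e; rewrite !dfwith_in.
Qed.

Lemma dfwithC w i j (x : W i) (y : W j) : i != j ->
  dfwith (dfwith w x) y = dfwith (dfwith w y) x.
Proof.
move=> nij; apply: functional_extensionality_dep => k.
have [e|nik] := eqVneq i k.
  by case: _ / e; rewrite dfwith_in dfwith_out 1?eq_sym // dfwith_in.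
rewrite [RHS]dfwith_out //; have [e|njk] := eqVneq j k.
  by case: _ / e; rewrite !dfwith_in.
by rewrite !dfwith_out.
Qed.

Lemma dfwith_comp (U : I -> Type) (A : forall i, W i -> U i) w i (x : W i) :
  (fun j => A j (dfwith w x j)) = dfwith (fun j => A j (w j)) (A i x).
Proof.
apply: functional_extensionality_dep => j.
by case: dfwithP => [|k nik]; rewrite ?dfwith_in ?dfwith_out.
Qed.

End DFWith.

Section MultiInduction.
Variables (F : fieldType) (V : lmodType F) (n : nat) (m : 'I_n -> nat).
Implicit Type w : forall i, vpoly V 'I_(m i).

(** Meant for predicates Q that quantify over the function phi: the factor removed from a slot is
    absorbed by an operator, so the hypothesis is needed at another phi. *)
Lemma vpolys_ind (Q : (forall i, vpoly V 'I_(m i)) -> Prop) :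
  (forall w i, Q (dfwith w (0 : vpoly V 'I_(m i)))) ->
  (forall w i (p q : vpoly V 'I_(m i)),
     Q (dfwith w p) -> Q (dfwith w q) -> Q (dfwith w (p + q))) ->
  (forall w i (p : vpoly V 'I_(m i)) a,
     Q (dfwith w p) -> Q (dfwith w (vmulX a p))) ->
  (forall v : 'I_n -> V, Q (fun i => vconst 'I_(m i) (v i))) ->
  forall w, Q w.
Proof.
move=> Q0 QD QX QC.
suff H (s : seq 'I_n) w :
    (forall i, i \notin s -> exists u : V, w i = vconst 'I_(m i) u) -> Q w.
  by move=> w; apply: (H (enum 'I_n)) => i; rewrite mem_enum.
elim: s w => [|j s IH] w hw.
  have /choice[v hv] i : exists u : V, w i = vconst 'I_(m i) u by apply: hw.
  by rewrite (functional_extensionality_dep hv).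
rewrite -(dfwith_id w j); elim/vpoly_mulX_ind: (w j) => [|p q|v|i p].
- exact: Q0.
- exact: QD.
- apply: IH => i; case: dfwithP => [_|k nik ns]; first by exists v.
  by apply: hw; rewrite inE negb_or ns andbT eq_sym.
- exact: QX.
Qed.

End MultiInduction.

(* Besides [tagnat.Rank], this covers regrouped and permuted decompositions into
   blocks, which would otherwise involve casts between index types. *)
Record blocks n (m : 'I_n -> nat) N (r : forall i, 'I_(m i) -> 'I_N)
    (blk : 'I_N -> 'I_n) : Prop := {
  blocksK : forall i a, blk (r i a) = i;
  blocks_inj : forall i, injective (r i);
  blocks_surj : forall k, exists a, r (blk k) a = k }.

Section BlocksTheory.
Variables (n : nat) (m : 'I_n -> nat) (N : nat).
Variables (r : forall i, 'I_(m i) -> 'I_N) (blk : 'I_N -> 'I_n).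
Arguments r : clear implicits.
Hypothesis hb : blocks r blk.

Lemma block_eq i j a b : r i a = r j b -> i = j.
Proof. by move=> /(congr1 blk); rewrite !(blocksK hb). Qed.

Lemma blocks_ind (P : 'I_N -> Prop) : (forall i a, P (r i a)) -> forall k, P k.
Proof. by move=> H k; have [a <-] := blocks_surj hb k. Qed.

Lemma sum_blocks (R : Type) (idx : R) (op : Monoid.com_law idx) (E : 'I_N -> R) :
  \big[op/idx]_k E k = \big[op/idx]_i \big[op/idx]_(a < m i) E (r i a).
Proof.
rewrite [LHS](partition_big blk xpredT) //=; apply: eq_bigr => i _.
rewrite [LHS](eq_bigl (fun k => k \in [set r i a | a : 'I_(m i)])).
  by rewrite big_imset //= => a b _ _; apply: (blocks_inj hb).
move=> k; apply/eqP/imsetP => [hk|[a _ ->]]; last by rewrite (blocksK hb).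
by have [a ha] := blocks_surj hb k; move: a ha; rewrite hk => a <-; exists a.
Qed.

Lemma sum_block_delta (R : pzRingType) i k :
  \sum_(a < m i) (r i a == k)%:R = (blk k == i)%:R :> R.
Proof.
elim/blocks_ind: k => j b; rewrite (blocksK hb).
have [e|nij] := eqVneq j i; last first.
  rewrite big1 // => a _; case: eqP => // /block_eq e.
  by rewrite e eqxx in nij.
case: _ / e in b *; rewrite (bigD1 b) //= eqxx big1 ?addr0 // => a nab.
by case: eqP => // /(blocks_inj hb) e; rewrite e eqxx in nab.
Qed.

End BlocksTheory.

Section LinearOperators.
Variables (F : fieldType) (A B : lmodType F) (T : A -> B).
Hypothesis TP : forall (c : F) x y, T (c *: x + y) = c *: T x + T y.

(** Linearity is assumed as an equation on a bare function, so that these lemmas apply at once to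
    maps introduced inside a proof, such as an evaluation viewed in one slot. *)
Lemma oplin0 : T 0 = 0.
Proof.
have := TP 1 0 0; rewrite scaler0 addr0 scale1r => /esym/eqP.
by rewrite -subr_eq0 addrK => /eqP.
Qed.

Lemma oplinD x y : T (x + y) = T x + T y.
Proof. by rewrite -[x]scale1r TP !scale1r. Qed.

Lemma oplinZ c x : T (c *: x) = c *: T x.
Proof. by rewrite -[c *: x]addr0 TP oplin0 addr0. Qed.

Lemma oplinB x y : T (x - y) = T x - T y.
Proof. by rewrite oplinD -scaleN1r oplinZ scaleN1r. Qed.

Lemma oplin_sum (I : Type) (s : seq I) (E : I -> A) :
  T (\sum_(x <- s) E x) = \sum_(x <- s) T (E x).
Proof.
elim: s => [|x s IH]; first by rewrite !big_nil oplin0.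
by rewrite !big_cons oplinD IH.
Qed.

End LinearOperators.

Section Operators.
Variables (F : fieldType) (V M : lmodType F) (d : {linear V -> V}).
Variables (n : nat) (m : 'I_n -> nat) (N : nat).
Variables (r : forall i, 'I_(m i) -> 'I_N).
Arguments r : clear implicits.
Variable L : 'I_N -> {linear M -> M}.
Hypothesis LC : forall k l x, L k (L l x) = L l (L k x).
Local Notation Phi := (('I_n -> V) -> M).
Implicit Types (phi : Phi) (u : 'I_n -> V).

Definition opL k phi : Phi := fun u => L k (phi u).

Definition opD j phi : Phi := fun u => phi (upd u j (d (u j))).

(* x_j acts as [opX j], and lambda_k + X(k) as [opT psi k]. *)
Definition opX j phi : Phi :=
  fun u => \sum_(a < m j) L (r j a) (phi u) + phi (upd u j (d (u j))).

Definition opT (psi : 'I_N -> 'I_n -> bool) k phi : Phi :=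
  fun u => L k (phi u) + \sum_j (psi k j)%:R *: opX j phi u.

Definition vop (x : 'I_N + 'I_n) phi : Phi :=
  match x with inl k => opL k phi | inr j => opX j phi end.

Lemma opL_linear k (c : F) phi phi' :
  opL k (c *: phi + phi') = c *: opL k phi + opL k phi'.
Proof. by apply/funext => u; rewrite /opL /= linearP. Qed.

Lemma opD_linear j (c : F) phi phi' :
  opD j (c *: phi + phi') = c *: opD j phi + opD j phi'.
Proof. by []. Qed.

Lemma opXE j phi : opX j phi = \sum_(a < m j) opL (r j a) phi + opD j phi.
Proof. by apply/funext => u; rewrite /opX [RHS]/= fct_sumE. Qed.

Lemma opTE psi k phi : opT psi k phi = opL k phi + \sum_j (psi k j)%:R *: opX j phi.
Proof. by apply/funext => u; rewrite /opT [RHS]/= fct_sumE. Qed.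

Lemma opX_linear j (c : F) phi phi' :
  opX j (c *: phi + phi') = c *: opX j phi + opX j phi'.
Proof.
rewrite !opXE opD_linear; under eq_bigr do rewrite opL_linear.
by rewrite big_split /= scalerDr scaler_sumr addrACA.
Qed.

Lemma opLC k l phi : opL k (opL l phi) = opL l (opL k phi).
Proof. by apply/funext => u; apply: LC. Qed.

Lemma opDC i j phi : opD i (opD j phi) = opD j (opD i phi).
Proof.
apply/funext => u; rewrite /opD; have [->//|nij] := eqVneq i j.
rewrite updC // /upd [j == i]eq_sym (negPf nij).
by [].
Qed.

Lemma opLX k j phi : opL k (opX j phi) = opX j (opL k phi).
Proof.
rewrite !opXE (oplinD (opL_linear k)) (oplin_sum (opL_linear k)); congr (_ + _).
by apply: eq_bigr => a _; apply: opLC.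
Qed.

Lemma opDX i j phi : opD i (opX j phi) = opX j (opD i phi).
Proof.
by rewrite !opXE (oplinD (opD_linear i)) (oplin_sum (opD_linear i)) opDC.
Qed.

Lemma opXC i j phi : opX i (opX j phi) = opX j (opX i phi).
Proof.
rewrite (opXE i) opDX (opXE i phi) (oplinD (opX_linear j)).
rewrite (oplin_sum (opX_linear j)); congr (_ + _).
by apply: eq_bigr => a _; apply: opLX.
Qed.

Lemma opT_linear psi k (c : F) phi phi' :
  opT psi k (c *: phi + phi') = c *: opT psi k phi + opT psi k phi'.
Proof.
rewrite !opTE opL_linear scalerDr addrACA; congr (_ + _).
rewrite scaler_sumr -big_split /=; apply: eq_bigr => j _.
by rewrite opX_linear scalerDr !scalerA mulrC.
Qed.

Lemma opDT i psi k phi : opD i (opT psi k phi) = opT psi k (opD i phi).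
Proof.
rewrite !opTE (oplinD (opD_linear i)) (oplin_sum (opD_linear i)).
by congr (_ + _); apply: eq_bigr => j _; rewrite (oplinZ (opD_linear i)) opDX.
Qed.

Lemma opLT l psi k phi : opL l (opT psi k phi) = opT psi k (opL l phi).
Proof.
rewrite !opTE (oplinD (opL_linear l)) (oplin_sum (opL_linear l)) opLC.
by congr (_ + _); apply: eq_bigr => j _; rewrite (oplinZ (opL_linear l)) opLX.
Qed.

Lemma opXT i psi k phi : opX i (opT psi k phi) = opT psi k (opX i phi).
Proof.
rewrite !opTE (oplinD (opX_linear i)) (oplin_sum (opX_linear i)) opLX.
by congr (_ + _); apply: eq_bigr => j _; rewrite (oplinZ (opX_linear i)) opXC.
Qed.

Lemma opL_multilinear k phi : multilinear phi -> multilinear (opL k phi).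
Proof. by move=> hphi u i a x y; rewrite /opL hphi linearP. Qed.

Lemma opD_multilinear j phi : multilinear phi -> multilinear (opD j phi).
Proof.
move=> hphi u i a x y; rewrite /opD.
have [->|nij] := eqVneq i j; first by rewrite !upd_same !upd_upd linearP hphi.
have E z : upd u i z j = u j by rewrite /upd eq_sym (negPf nij).
by rewrite !E !(updC _ _ _ nij) hphi.
Qed.

Lemma opX_multilinear j phi : multilinear phi -> multilinear (opX j phi).
Proof.
move=> hphi; rewrite opXE -[X in X + _]scale1r; apply: multilinearP.
  by apply: multilinear_sum => a; apply: opL_multilinear.
exact: opD_multilinear.
Qed.

Lemma opT_multilinear psi k phi : multilinear phi -> multilinear (opT psi k phi).
Proof.
move=> hphi; rewrite opTE -[X in X + _]scale1r; apply: multilinearP.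
  exact: opL_multilinear.
apply: multilinear_sum => j; rewrite -[_ *: _]addr0; apply: multilinearP.
  exact: opX_multilinear.
exact: multilinear_zero.
Qed.

Lemma vop_commuting : commuting_operators vop.
Proof.
split=> [[k|j] c phi phi'|[k|i] [l|j] phi|[k|j] phi].
- exact: opL_linear.
- exact: opX_linear.
- exact: opLC.
- exact: opLX.
- by rewrite /= opLX.
- exact: opXC.
- exact: opL_multilinear.
- exact: opX_multilinear.
Qed.

(** [shifted_lambda] with an arbitrary relation psi in place of external connection. This freedom is
    what allows different graphs to be compared. *)
Definition shifted (psi : 'I_N -> 'I_n -> bool) i (a : 'I_(m i)) :
    spoly F ('I_N + 'I_n)%type :=
  svar F (inl (r i a)) + \sum_(j < n | psi (r i a) j) svar F (inr j).

Definition shifted_vars (psi : 'I_N -> 'I_n -> bool) i (a : 'I_(m i)) :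
    seq ('I_N + 'I_n) :=
  inl (r i a) :: [seq inr j | j <- enum 'I_n & psi (r i a) j].

Lemma shiftedE psi i a :
  @shifted psi i a = \sum_(y <- shifted_vars psi a) svar F y.
Proof.
rewrite /shifted_vars big_cons big_map big_filter; congr (_ + _).
by rewrite big_enum_cond.
Qed.

Definition eval_op psi phi (w : forall i, vpoly V 'I_(m i)) : M :=
  teval vop phi (fun i => vsubst (@shifted psi i) (w i)).

Section EvalOp.
Variable psi : 'I_N -> 'I_n -> bool.
Implicit Type w : forall i, vpoly V 'I_(m i).

Lemma eval_op_dfwith w i (p : vpoly V 'I_(m i)) phi :
  eval_op psi phi (dfwith w p)
  = teval vop phi (upd (fun j => vsubst (@shifted psi j) (w j)) i
                       (vsubst (@shifted psi i) p)).
Proof.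
congr (teval _ _ _); apply/funext => j; rewrite /upd.
have [e|nij] := eqVneq j i; last by rewrite dfwith_out // eq_sym.
by case: _ / (esym e); rewrite dfwith_in.
Qed.

Lemma eval_op_linear w (c : F) phi phi' :
  eval_op psi (c *: phi + phi') w = c *: eval_op psi phi w + eval_op psi phi' w.
Proof. exact: teval_linear vop_commuting _ _ _ _. Qed.

Lemma eval_op_slot_linear w i (c : F) (p q : vpoly V 'I_(m i)) phi :
  multilinear phi ->
  eval_op psi phi (dfwith w (c *: p + q))
  = c *: eval_op psi phi (dfwith w p) + eval_op psi phi (dfwith w q).
Proof.
move=> hphi; rewrite !eval_op_dfwith linearP.
exact: teval_slot_linear vop_commuting _ _ _ _ _ _ hphi.
Qed.

Lemma eval_op_const phi u : multilinear phi ->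
  eval_op psi phi (fun i => vconst 'I_(m i) (u i)) = phi u.
Proof.
move=> hphi; rewrite /eval_op.
under [X in teval _ _ X]eq_fun do rewrite vsubst_const.
exact: teval_const vop_commuting _ _ hphi.
Qed.

(** The engine of all later inductions. The form replacing lambda_a is a sum of variables, each of
    which passes to phi by [teval_slot_mulX]; the resulting operators add up to [opT]. *)
Lemma eval_op_mulX w i (a : 'I_(m i)) (p : vpoly V 'I_(m i)) phi :
  multilinear phi ->
  eval_op psi phi (dfwith w (vmulX a p))
  = eval_op psi (opT psi (r i a) phi) (dfwith w p).
Proof.
move=> hphi; rewrite !eval_op_dfwith (vsubst_mulX (shiftedE psi (i := i))).
set g := (fun j => vsubst _ _); set q := vsubst _ p.
pose A x := teval vop phi (upd g i x).
have AP c x y : A (c *: x + y) = c *: A x + A y.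
  exact: teval_slot_linear vop_commuting _ _ _ _ _ _ hphi.
rewrite -/(A _) (oplin_sum AP) /A.
under eq_bigr => y _ do rewrite (teval_slot_mulX vop_commuting _ _ _ _ hphi).
rewrite /shifted_vars big_cons big_map big_filter /= opTE.
have BP c f f' := teval_linear vop_commuting (upd g i q) c f f'.
rewrite (oplinD BP) (oplin_sum BP) big_enum_cond /=; congr (_ + _).
rewrite big_mkcond; apply: eq_bigr => j _; rewrite (oplinZ BP).
by case: (psi _ _); rewrite ?scale1r ?scale0r.
Qed.

Lemma eval_op_slotD w i (p q : vpoly V 'I_(m i)) phi : multilinear phi ->
  eval_op psi phi (dfwith w (p + q))
  = eval_op psi phi (dfwith w p) + eval_op psi phi (dfwith w q).
Proof. by move=> hphi; rewrite -[p]scale1r eval_op_slot_linear // !scale1r. Qed.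

Lemma eval_op_slot0 w i phi : multilinear phi ->
  eval_op psi phi (dfwith w (0 : vpoly V 'I_(m i))) = 0.
Proof.
move=> hphi.
have AP c (x y : vpoly V 'I_(m i)) :
    eval_op psi phi (dfwith w (c *: x + y))
    = c *: eval_op psi phi (dfwith w x) + eval_op psi phi (dfwith w y).
  exact: eval_op_slot_linear.
exact: oplin0 AP.
Qed.

(** Applying d to the coefficients in slot i amounts to applying it to the i-th argument of phi,
    since [opD] commutes with every operator absorbed on the way. *)
Lemma eval_op_map w i (p : vpoly V 'I_(m i)) phi : multilinear phi ->
  eval_op psi phi (dfwith w (vmap d p)) = eval_op psi (opD i phi) (dfwith w p).
Proof.
move=> hphi; suff H w' : forall phi, multilinear phi ->
    eval_op psi phi (dfwith w' (vmap d (w' i))) = eval_op psi (opD i phi) w'.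
  by rewrite -H // dfwith_in dfwith_dfwith.
elim/vpolys_ind: w' {phi hphi} => [w' j|w' j p' q' hp hq|w' j p' a hp|v] phi hphi.
- have hDphi := opD_multilinear i hphi.
  have [e|nji] := eqVneq j i; last by rewrite dfwithC // !eval_op_slot0.
  by case: _ / e in hDphi *; rewrite dfwith_in raddf0 dfwith_dfwith !eval_op_slot0.
- have hDphi := opD_multilinear i hphi; move: (hp phi hphi) (hq phi hphi).
  have [e|nji] := eqVneq j i.
    case: _ / e in hDphi *; rewrite !dfwith_in raddfD !dfwith_dfwith.
    by rewrite !eval_op_slotD // => -> ->.
  rewrite !(dfwith_out _ _ nji) !(dfwithC _ _ _ nji) !eval_op_slotD //.
  by move=> -> ->.
- have hDphi := opD_multilinear i hphi.
  rewrite [RHS]eval_op_mulX // -opDT -hp; last exact: opT_multilinear.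
  have [e|nji] := eqVneq j i.
    case: _ / e in hDphi *; rewrite !dfwith_in !dfwith_dfwith -vmulX_map.
    by rewrite eval_op_mulX.
  by rewrite !(dfwith_out _ _ nji) !(dfwithC _ _ _ nji) eval_op_mulX.
rewrite eval_op_const ?vmap_const; last exact: opD_multilinear.
rewrite /opD -eval_op_const //; congr (eval_op _ _ _).
apply: functional_extensionality_dep => j; rewrite /upd.
have [e|nij] := eqVneq j i; last by rewrite dfwith_out // eq_sym.
by case: _ / (esym e); rewrite dfwith_in.
Qed.

End EvalOp.
End Operators.

(** * Graphs decomposed into blocks *)

Section Graphs.
Variable n : nat.
Implicit Types (G H : graph n) (w : seq (step n)).

Lemma mult_loop G i : mult G (i, i) = 0%N.
Proof. by apply/eqP; have /forallP := valP G; apply. Qed.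

Lemma mult_mkgraph (E : 'I_n -> 'I_n -> nat) i j :
  mult (mkgraph E) (i, j) = if i == j then 0%N else E i j.
Proof. by rewrite /mult /mkgraph /= ffunE. Qed.

Lemma graphP G H : (forall i j, i != j -> mult G (i, j) = mult H (i, j)) -> G = H.
Proof.
move=> h; apply: val_inj; apply/ffunP => -[i j].
by have [->|/h //] := eqVneq i j; rewrite -!/(mult _ _) !mult_loop.
Qed.

Lemma mult_del_edge G e i j :
  mult (del_edge G e) (i, j) = (mult G (i, j) - (e == (i, j)))%N.
Proof.
by rewrite mult_mkgraph; case: eqVneq => // ->; rewrite mult_loop.
Qed.

Lemma mult_relabel (s : 'S_n) G i j :
  mult (relabel s G) (i, j) = mult G (s^-1%g i, s^-1%g j).
Proof.
by rewrite mult_mkgraph; case: eqVneq => // ->; rewrite mult_loop.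
Qed.

Lemma adjacent_sym G : symmetric (adjacent G).
Proof. by move=> i j; rewrite /adjacent orbC. Qed.

Lemma adjacent_neq G i j : adjacent G i j -> i != j.
Proof.
by rewrite /adjacent; apply: contraTneq => ->; rewrite mult_loop.
Qed.

Lemma connect_adjacent_sym G : connect_sym (adjacent G).
Proof. exact/sym_connect_sym/adjacent_sym. Qed.

Lemma component_eq G i j : j \in component G i -> component G j = component G i.
Proof.
rewrite inE => hij; apply/setP => k; rewrite !inE.
by apply/esym/(same_connect (connect_adjacent_sym G)).
Qed.

Lemma component_refl G i : i \in component G i.
Proof. by rewrite inE connect0. Qed.

Definition locally_const (T : Type) G (chi : 'I_n -> T) : Prop :=
  forall i j, adjacent G i j -> chi i = chi j.

Lemma locally_const_component (T : Type) G (chi : 'I_n -> T) i j :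
  locally_const G chi -> j \in component G i -> chi i = chi j.
Proof.
move=> hchi; rewrite inE => /connectP[p hp ->].
elim: p i hp => [|k p IH] i //= /andP[hik hp].
by rewrite (hchi _ _ hik) IH.
Qed.

(** Sesquilinearity is stated for one component at a time; grouping the vertices by component turns
    it into vanishing against all locally constant weights, which is the form stable under the later
    manipulations. *)
Lemma locally_const_sum (F : fieldType) (A : lmodType F) G (chi : 'I_n -> F)
    (W : 'I_n -> A) :
  locally_const G chi -> (forall i, \sum_(j in component G i) W j = 0) ->
  \sum_j chi j *: W j = 0.
Proof.
move=> hchi hW; rewrite (partition_big (component G) xpredT) //=.
apply: big1 => C _; have [j0 hj0|hC] := pickP (fun j => component G j == C); last first.
  by rewrite big_pred0.
rewrite (eq_bigl (fun j => j \in component G j0)); last first.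
  move=> j; apply/eqP/idP => [hj|/component_eq ->]; last exact/eqP.
  by rewrite (eqP hj0) -hj component_refl.
rewrite (eq_bigr (fun j => chi j0 *: W j)); last first.
  by move=> j /(locally_const_component hchi) ->.
by rewrite -scaler_sumr hW scaler0.
Qed.

Lemma walk_cat i w1 w2 j :
  walk i (w1 ++ w2) j <-> exists k, walk i w1 k /\ walk k w2 j.
Proof.
elim: w1 i => [|t w1 IH] i /=.
  by split=> [h|[k [/eqP <-]]] //; exists i.
split=> [/andP[hs /IH[k [h1 h2]]]|[k [/andP[hs h1] h2]]].
  by exists k; rewrite hs.
by rewrite hs; apply/IH; exists k.
Qed.

Lemma trail_cat G i w1 w2 j : trail G i (w1 ++ w2) j ->
  exists k, trail G i w1 k /\ trail G k w2 j.
Proof.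
move=> /andP[/walk_cat[k [h1 h2]] /forallP hc]; exists k.
rewrite /trail h1 h2 /=; split; apply/forallP => e; apply: leq_trans (hc e);
  by rewrite /unzip1 map_cat count_cat ?leq_addr ?leq_addl.
Qed.

Lemma acyclic_trail G i w : acyclic G -> trail G i w i -> w = [::].
Proof. by move=> h; apply: h. Qed.

(** Two edges between i and j, parallel or opposite, form a closed trail of length two. *)
Lemma acyclic_mult G i j : acyclic G -> (mult G (i, j) + mult G (j, i) <= 1)%N.
Proof.
move=> hG; have [->|nij] := eqVneq i j; first by rewrite mult_loop.
have double i' j' : (1 < mult G (i', j'))%N -> False.
  move=> h; suff : trail G i' [:: ((i', j'), true); ((i', j'), false)] i'.
    by move=> /(acyclic_trail hG).
  rewrite /trail /= !eqxx /=; apply/forallP => e.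
  by case: eqVneq => [<-|] //; rewrite addn0.
rewrite leqNgt; apply/negP => h2.
have hij : (mult G (i, j) <= 1)%N by rewrite leqNgt; apply/negP => /double.
have hji : (mult G (j, i) <= 1)%N by rewrite leqNgt; apply/negP => /double.
suff : trail G i [:: ((i, j), true); ((j, i), true)] i.
  by move=> /(acyclic_trail hG).
rewrite /trail /= !eqxx /=; apply/forallP => e; rewrite addn0.
have [<-|_] := eqVneq (i, j) e; last first.
  by case: eqVneq => // <-; case: (mult _ _) (mult _ _) hij hji h2 => [|[|?]] [|[|?]].
case: eqVneq => [[ei _]|_]; first by rewrite ei eqxx in nij.
by rewrite addn0; case: (mult _ _) (mult _ _) hij hji h2 => [|[|?]] [|[|?]].
Qed.

Lemma oriented_cycle_nacyclic G C : oriented_cycle G C -> ~ acyclic G.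
Proof. by move=> [C0 [i hC]] hG; apply: C0; have := hG _ _ hC; case: C {hC}. Qed.

End Graphs.

Section BlockGraphs.
Variables (n : nat) (m : 'I_n -> nat) (N : nat).
Variables (r : forall i, 'I_(m i) -> 'I_N) (blk : 'I_N -> 'I_n).
Arguments r : clear implicits.

Definition inner i (G : graph N) : graph (m i) :=
  mkgraph (fun a b => mult G (r i a, r i b)).

Definition outer (G : graph N) : graph n :=
  mkgraph (fun i j => \sum_(a < m i) \sum_(b < m j)
                        mult G (r i a, r j b))%N.

Definition ext (G : graph N) (k : 'I_N) (j : 'I_n) : bool :=
  `[< exists (t : step n) (w : seq (step n)),
      trail (outer G) (blk k) (t :: w) j /\
      exists a b, [/\ (0 < mult G (a, b))%N,
                      (blk a, blk b) = t.1 & k = a \/ k = b] >].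

(* psi is determined up to locally constant functions by this condition: the
   coboundary of psi a is the oriented sum of the edges at a. *)
Definition coboundary (G : graph N) (psi : 'I_N -> 'I_n -> bool) : Prop :=
  forall k l, adjacent G k l -> blk k != blk l ->
  forall a, (psi a (blk k) + (a == k) = psi a (blk l) + (a == l))%N.

Hypothesis hb : blocks r blk.
Implicit Type G : graph N.

Lemma mult_inner i G a b : mult (inner i G) (a, b) = mult G (r i a, r i b).
Proof. by rewrite mult_mkgraph; case: eqVneq => // ->; rewrite mult_loop. Qed.

Lemma mult_outer G i j : i != j ->
  mult (outer G) (i, j)
  = (\sum_(a < m i) \sum_(b < m j) mult G (r i a, r j b))%N.
Proof. by rewrite mult_mkgraph => /negPf ->. Qed.

Lemma mult_outerE G i j : i != j ->
  mult (outer G) (i, j) = (\sum_(e | (blk e.1 == i) && (blk e.2 == j)) mult G e)%N.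
Proof.
move=> nij; rewrite mult_outer //.
transitivity (\sum_(k | blk k == i) \sum_(l | blk l == j) mult G (k, l))%N.
  rewrite [RHS]big_mkcond (sum_blocks hb) (bigD1 i) //= [X in (_ + X)%N]big1 ?addn0.
    apply: eq_bigr => a _; rewrite (blocksK hb) eqxx.
    rewrite [RHS]big_mkcond (sum_blocks hb) (bigD1 j) //= [X in (_ + X)%N]big1 ?addn0.
      by apply: eq_bigr => b _; rewrite (blocksK hb) eqxx.
    by move=> k nk; rewrite big1 // => b _; rewrite (blocksK hb) (negPf nk).
  by move=> k nk; rewrite big1 // => b _; rewrite (blocksK hb) (negPf nk).
by rewrite pair_big; apply: eq_bigr => -[].
Qed.

Lemma mult_outer_ge G k l : blk k != blk l ->
  (mult G (k, l) <= mult (outer G) (blk k, blk l))%N.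
Proof.
move=> nkl; rewrite mult_outerE // (bigD1 (k, l)) /= ?eqxx //.
exact: leq_addr.
Qed.

Lemma adjacent_inner i G a b :
  adjacent (inner i G) a b = adjacent G (r i a) (r i b).
Proof. by rewrite /adjacent !mult_inner. Qed.

Lemma adjacent_outerP G i j :
  reflect (exists k l, [/\ adjacent G k l, blk k = i, blk l = j & i != j])
          (adjacent (outer G) i j).
Proof.
apply: (iffP idP) => [hij|[k [l [hkl <- <- nij]]]]; last first.
  move: hkl; rewrite /adjacent => /orP[] h; apply/orP; [left|right].
    by apply: leq_trans h _; apply: mult_outer_ge.
  by apply: leq_trans h _; apply: mult_outer_ge; rewrite eq_sym.
have nij := adjacent_neq hij.
have aux i' j' : i' != j' -> (0 < mult (outer G) (i', j'))%N ->
    exists k l, [/\ (0 < mult G (k, l))%N, blk k = i' & blk l = j'].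
  move=> n'; rewrite mult_outerE // lt0n sum_nat_eq0 negb_forall.
  move=> /existsP[[k l]] /=; rewrite negb_imply -lt0n.
  by move=> /andP[/andP[/eqP h1 /eqP h2] h3]; exists k, l.
move: hij; rewrite {1}/adjacent => /orP[/(aux _ _ nij)[k [l [h1 h2 h3]]]|].
  by exists k, l; split=> //; rewrite /adjacent h1.
rewrite eq_sym in nij; move=> /(aux _ _ nij)[k [l [h1 h2 h3]]].
by exists l, k; rewrite eq_sym; split=> //; rewrite /adjacent h1 orbT.
Qed.

(** A second edge of Gamma over the same pair of blocks would give the outer graph a double edge. *)
Lemma outer_unique_edge G k l x y : acyclic (outer G) -> blk k != blk l ->
  (0 < mult G (k, l))%N -> (0 < mult G (x, y))%N ->
  (blk x, blk y) = (blk k, blk l) -> (x, y) = (k, l).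
Proof.
move=> hH nkl hkl hxy [ex ey]; apply/eqP/negPn/negP => ne.
have := acyclic_mult (blk k) (blk l) hH; apply/negP; rewrite -ltnNge.
apply: leq_trans (leq_addr _ _); rewrite mult_outerE //.
rewrite (bigD1 (k, l)) ?eqxx //= (bigD1 (x, y)) /= ?ne ?ex ?ey ?eqxx //.
rewrite addnA; apply: leq_trans (leq_addr _ _).
by rewrite (leq_add hkl hxy).
Qed.

(** The trail from the block of a is prolonged by s or, if it already uses the edge of s, cut just
    before that edge: acyclicity forces the edge to be the last one, traversed backwards. The cut
    trail is not empty, since otherwise the first edge would be the one over (k, l), which is
    attached to k and l, and a is neither. *)
Lemma ext_step G a k l (s : step n) : acyclic (outer G) -> blk k != blk l ->
  (0 < mult G (k, l))%N -> s.1 = (blk k, blk l) -> a != k -> a != l ->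
  ext G a (step_src s) -> ext G a (step_tgt s).
Proof.
move=> hH nkl hkl es nak nal /asboolP[t [w [htw hta]]]; apply/asboolP.
set i := blk a in htw *; set p := step_src s in htw *; set q := step_tgt s.
have hsm : (0 < mult (outer G) s.1)%N.
  by rewrite es; apply: leq_trans hkl _; apply: mult_outer_ge.
have [hin|hnin] := boolP (s.1 \in unzip1 (t :: w)); last first.
  exists t, (w ++ [:: s]); split=> //; move: htw; rewrite -cat_cons => /andP[h1 h2].
  apply/andP; split.
    by apply/walk_cat; exists p; rewrite h1 /= !eqxx.
  apply/forallP => e; rewrite /unzip1 map_cat count_cat.
  have -> : count_mem e (map fst [:: s]) = (s.1 == e) by rewrite /= addn0.
  have [<-|_] := eqVneq s.1 e; last by rewrite addn0; apply: (forallP h2).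
  by rewrite (count_memPn hnin).
have /mapP[s' hs' es'] := hin.
have [w1 [w2 ew]] : exists w1 w2, t :: w = w1 ++ s' :: w2.
  by case/splitPr: hs' => w1 w2; exists w1, w2.
have := htw; rewrite ew => /trail_cat[k1 [hw1 hsw2]].
have hsw2' := hsw2; rewrite -[s' :: w2]cat1s in hsw2'.
have [k2 [hs'k hw2]] := trail_cat hsw2'.
move: hs'k => /andP[] /= /andP[/eqP e1 /eqP e2] _.
have hcase : (step_src s' = p /\ step_tgt s' = q) \/ (step_src s' = q /\ step_tgt s' = p).
  rewrite /p /q /step_src /step_tgt -es'.
  by case: (s.2) (s'.2) => -[]; [left|right|right|left].
case: hcase => [[e3 e4]|[e3 e4]].
  by move: hsw2; rewrite -e1 e3 => /(acyclic_trail hH).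
move: hw2; rewrite -e2 e4 => /(acyclic_trail hH) ew2.
move: hw1; rewrite -e1 e3; case: w1 ew => [|t' w1] /=; last first.
  by move=> [<- _] ?; exists t, w1.
move=> [et _] _; exfalso; move: hta => [x [y [hxy exy axy]]].
have /(outer_unique_edge hH nkl hkl hxy) [ex ey] : (blk x, blk y) = (blk k, blk l).
  by rewrite exy et -es' es.
by case: axy => ea; [rewrite ea ex eqxx in nak|rewrite ea ey eqxx in nal].
Qed.

(** Acyclicity excludes the block of a from E(a). For a = k the edge itself leads to the block of l,
    which balances the delta term, and symmetrically for a = l. For any other a, membership passes
    across the edge in both directions by [ext_step]. *)
Lemma ext_coboundary G : acyclic (outer G) -> coboundary G (ext G).
Proof.
move=> hH.
have ext_self a : ext G a (blk a) = false.
  by apply/negP => /asboolP[t [w [/(acyclic_trail hH)]]].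
suff hor k l : (0 < mult G (k, l))%N -> blk k != blk l ->
    forall a, (ext G a (blk k) + (a == k) = ext G a (blk l) + (a == l))%N.
  move=> k l /orP[] hkl nkl a; first exact: hor.
  by apply/esym/hor; rewrite // eq_sym.
move=> hkl nkl a.
have hm : (0 < mult (outer G) (blk k, blk l))%N.
  by apply: leq_trans hkl _; apply: mult_outer_ge.
have htr b : trail (outer G) (step_src ((blk k, blk l), b)) [:: ((blk k, blk l), b)]
                   (step_tgt ((blk k, blk l), b)).
  rewrite /trail /= !eqxx /=; apply/forallP => e; rewrite addn0.
  by case: eqVneq => // <-.
have nkl' : k != l by apply: contraNneq nkl => ->.
have [->|nak] := eqVneq a k.
  rewrite ext_self (negPf nkl') addn0 add0n; apply/esym/eqP; rewrite eqb1.
  apply/asboolP; exists ((blk k, blk l), true), [::]; split; first exact: htr.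
  by exists k, l; split=> //; left.
have [->|nal] := eqVneq a l.
  rewrite ext_self addn0 add0n; apply/eqP; rewrite eqb1.
  apply/asboolP; exists ((blk k, blk l), false), [::]; split; first exact: htr.
  by exists k, l; split=> //; right.
rewrite !addn0; congr nat_of_bool; apply/idP/idP.
  exact: (@ext_step G a k l ((blk k, blk l), true)).
exact: (@ext_step G a k l ((blk k, blk l), false)).
Qed.

End BlockGraphs.

(** * Evaluation up to the choice of representatives *)

Lemma slotwise_eq (n : nat) (W : 'I_n -> Type) (R : Type)
    (E : (forall i, W i) -> R) (rel : forall i, W i -> W i -> Prop) w w' :
  (forall w i (x y : W i), rel i x y -> E (dfwith w x) = E (dfwith w y)) ->
  (forall i, rel i (w i) (w' i)) -> E w = E w'.
Proof.
move=> hE hw.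
(* The tuple w0 interpolates between w and w'; s contains the slots that may still hold the old
   value. *)
suff H (s : seq 'I_n) w0 : (forall i, w0 i = w i \/ w0 i = w' i) ->
    (forall i, i \notin s -> w0 i = w' i) -> E w0 = E w'.
  by apply: (H (enum 'I_n)) => i; rewrite ?mem_enum //; left.
elim: s w0 => [|j s IH] w0 h1 h2.
  by congr E; apply: functional_extensionality_dep => i; apply: h2.
rewrite -(dfwith_id w0 j); case: (h1 j) => ->; last first.
  apply: IH => i; case: dfwithP => [|k nik]; [by right|exact: h1|by []|].
  by move=> ns; apply: h2; rewrite inE negb_or ns andbT eq_sym.
rewrite (hE _ _ _ _ (hw j)).
apply: IH => i; case: dfwithP => [|k nik]; [by right|exact: h1|by []|].
by move=> ns; apply: h2; rewrite inE negb_or ns andbT eq_sym.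
Qed.

Section Good.
Variables (F : fieldType) (V M : lmodType F) (d : {linear V -> V}).
Variables (n : nat) (m : 'I_n -> nat) (N : nat).
Variables (r : forall i, 'I_(m i) -> 'I_N) (blk : 'I_N -> 'I_n).
Arguments r : clear implicits.
Variable L : 'I_N -> {linear M -> M}.
Hypothesis LC : forall k l x, L k (L l x) = L l (L k x).
Hypothesis hb : blocks r blk.
Local Notation Phi := (('I_n -> V) -> M).
Local Notation opX := (opX d r L).
Local Notation opT := (opT d r L).
Local Notation opL := (@opL F V M n N L).
Local Notation opD := (@opD F V M d n).
Local Notation eval_op := (eval_op d r L).
Implicit Types (phi : Phi) (u : 'I_n -> V) (psi : 'I_N -> 'I_n -> bool).

(* The sesquilinearity of f^H, in a form inherited by the functions
   [opT psi k phi]. *)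
Definition good (H : graph n) phi : Prop :=
  multilinear phi /\
  forall chi : 'I_n -> F, locally_const H chi -> \sum_j chi j *: opX j phi = 0.

Lemma good_op H (T : Phi -> Phi) phi :
  (forall (c : F) x y, T (c *: x + y) = c *: T x + T y) ->
  (forall j x, opX j (T x) = T (opX j x)) ->
  (forall x, multilinear x -> multilinear (T x)) ->
  good H phi -> good H (T phi).
Proof.
move=> TP TC TM [h1 h2]; split=> [|chi hchi]; first exact: TM.
rewrite (eq_bigr (fun j => T (chi j *: opX j phi))); last first.
  by move=> j _; rewrite TC (oplinZ TP).
by rewrite -(oplin_sum TP) h2 // (oplin0 TP).
Qed.

Lemma good_T H psi k phi : good H phi -> good H (opT psi k phi).
Proof.
apply: good_op => [c x y|i x|x]; first exact: opT_linear.
  exact: (opXT _ _ LC).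
exact: opT_multilinear.
Qed.

Lemma good_linear H (c : F) phi phi' :
  good H phi -> good H phi' -> good H (c *: phi + phi').
Proof.
move=> [h1 h2] [h3 h4]; split=> [|chi hchi]; first exact: multilinearP.
rewrite (eq_bigr (fun j => c *: (chi j *: opX j phi) + chi j *: opX j phi')).
  by rewrite big_split -scaler_sumr /= h2 // h4 // scaler0 addr0.
by move=> j _; rewrite opX_linear scalerDr !scalerA mulrC.
Qed.

(** Separates the lambda_k, which do not involve psi, from a combination of the X_j whose
    coefficients carry all the dependence on psi. Comparing two relations psi thus reduces to a
    weight that must be locally constant. *)
Lemma sum_opT psi (kappa : 'I_N -> F) phi :
  \sum_k kappa k *: opT psi k phi
  = \sum_k kappa k *: opL k phi
    + \sum_j (\sum_k kappa k * (psi k j)%:R) *: opX j phi.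
Proof.
under eq_bigr do rewrite opTE scalerDr scaler_sumr.
rewrite big_split exchange_big /=; congr (_ + _); apply: eq_bigr => j _.
by rewrite scaler_suml; apply: eq_bigr => k _; rewrite scalerA.
Qed.

Section Coboundary.
Variables (G : graph N) (psi : 'I_N -> 'I_n -> bool).
Hypothesis hpsi : coboundary blk G psi.

(** Weighted form of the coboundary condition: the condition at a is multiplied by [kappa a] and
    summed, and the delta terms produce the values of kappa at the two ends of the edge. *)
Lemma coboundary_sum (kappa : 'I_N -> F) k l :
  adjacent G k l -> blk k != blk l ->
  \sum_a kappa a * (psi a (blk k))%:R + kappa k
  = \sum_a kappa a * (psi a (blk l))%:R + kappa l.
Proof.
move=> hkl nkl.
have E x : kappa x = \sum_a kappa a * (a == x)%:R.
  rewrite (bigD1 x) //= eqxx mulr1 big1 ?addr0 // => a /negPf ->.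
  by rewrite mulr0.
rewrite [X in _ + X = _]E [X in _ = _ + X]E -!big_split; apply: eq_bigr => a _ /=.
by rewrite -!mulrDr -!natrD (hpsi hkl nkl).
Qed.

Lemma locally_const_outer (chi : 'I_n -> F) :
  (forall k l, adjacent G k l -> blk k != blk l -> chi (blk k) = chi (blk l)) ->
  locally_const (outer r G) chi.
Proof.
by move=> h i j /(adjacent_outerP hb)[k [l [hkl <- <- nij]]]; apply: h.
Qed.

Lemma sum_in_block (A : lmodType F) i (E : 'I_N -> A) :
  \sum_(a < m i) E (r i a) = \sum_k (blk k == i)%:R *: E k.
Proof.
rewrite (sum_blocks hb) (bigD1 i) //= [X in _ + X]big1 ?addr0.
  by apply: eq_bigr => a _; rewrite (blocksK hb) eqxx scale1r.
by move=> j /negPf nj; rewrite big1 // => a _; rewrite (blocksK hb) nj scale0r.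
Qed.

(** The relation d + (sum of the variables) of slot i acts as zero. Here d_i and the lambda_k of the
    block make up X_i, while the shifts contribute X_j with multiplicity [rho j]. The total weight
    delta_ij + [rho j] is locally constant: it is the quantity of [coboundary_sum] for the indicator
    of block i. *)
Lemma good_block i phi : good (outer r G) phi ->
  opD i phi + \sum_(a < m i) opT psi (r i a) phi = 0.
Proof.
move=> [_ hphi]; rewrite (sum_in_block i (fun k => opT psi k phi)) sum_opT.
rewrite addrA -(sum_in_block i (fun k => opL k phi)) [opD _ _ + _]addrC -opXE.
pose rho j := \sum_k (blk k == i)%:R * (psi k j)%:R : F.
rewrite -[RHS](hphi (fun j => (j == i)%:R + rho j)); last first.
  apply: locally_const_outer => k l hkl nkl; rewrite ![_%:R + _]addrC.
  exact: (coboundary_sum (fun k => (blk k == i)%:R)).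
under [RHS]eq_bigr do rewrite scalerDl.
rewrite [RHS]big_split; congr (_ + _); rewrite (bigD1 i) //= eqxx scale1r.
by rewrite big1 ?addr0 // => j /negPf ->; rewrite scale0r.
Qed.

Lemma eval_op_dlam w i (p : vpoly V 'I_(m i)) phi : good (outer r G) phi ->
  eval_op psi phi (dfwith w (dlam d p)) = 0.
Proof.
move=> hphi; have hm := hphi.1.
pose A (x : vpoly V 'I_(m i)) := eval_op psi phi (dfwith w x).
have AP (c : F) x y : A (c *: x + y) = c *: A x + A y.
  exact: eval_op_slot_linear.
rewrite -/(A _) /dlam (oplinD AP) [X in _ + X](oplin_sum AP) /A eval_op_map //.
under eq_bigr do rewrite eval_op_mulX //.
pose B f := eval_op psi f (dfwith w p).
have BP (c : F) f f' : B (c *: f + f') = c *: B f + B f'.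
  exact: eval_op_linear.
rewrite -/(B _) -(oplin_sum BP) -(oplinD BP) good_block //.
exact: oplin0 BP.
Qed.

Lemma eval_op_ext w w' phi : good (outer r G) phi ->
  (forall i, lclass d (w i) = lclass d (w' i)) ->
  eval_op psi phi w = eval_op psi phi w'.
Proof.
move=> hphi.
apply: (@slotwise_eq _ _ _ _ (fun i x y => lclass d x = lclass d y)).
move=> {}w i x y /eqP/lclassP[q hq].
have -> : x = dlam d q + y by rewrite -hq subrK.
by rewrite eval_op_slotD ?eval_op_dlam ?add0r //; case: hphi.
Qed.

End Coboundary.

(** C stands for a class such as [good H]: each removed factor passes to [opT psi k phi], which has
    to remain in C. *)
Lemma eval_op_psi (C : Phi -> Prop) psi psi' phi w :
  (forall phi, C phi -> multilinear phi) ->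
  (forall k phi, C phi -> C (opT psi k phi)) ->
  (forall k phi, C phi -> opT psi k phi = opT psi' k phi) ->
  C phi -> eval_op psi phi w = eval_op psi' phi w.
Proof.
move=> CM CT Ceq.
elim/vpolys_ind: w phi => [w i|w i p q hp hq|w i p a hp|v] phi hphi.
- by rewrite !eval_op_slot0 //; apply: CM.
- by rewrite !eval_op_slotD ?hp ?hq //; apply: CM.
- rewrite !eval_op_mulX; [|exact: LC|exact: CM|exact: LC|exact: CM].
  by rewrite hp -?Ceq //; apply: CT.
by rewrite !eval_op_const //; apply: CM.
Qed.

Lemma eval_op_L psi k phi w : multilinear phi ->
  L k (eval_op psi phi w) = eval_op psi (opL k phi) w.
Proof.
elim/vpolys_ind: w phi => [w i|w i p q hp hq|w i p a hp|v] phi hphi;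
  have hLphi := opL_multilinear L k hphi.
- by rewrite !eval_op_slot0 // raddf0.
- by rewrite !eval_op_slotD // raddfD /= hp // hq.
- by rewrite !eval_op_mulX // hp ?(opLT _ _ LC) //; apply: opT_multilinear.
by rewrite !eval_op_const.
Qed.

(** For fixed k the delta terms cancel in the difference of [psi k] and [psi' k], which is therefore
    a weight covered by goodness. *)
Lemma eval_op_coboundary G psi psi' phi w :
  coboundary blk G psi -> coboundary blk G psi' -> good (outer r G) phi ->
  eval_op psi phi w = eval_op psi' phi w.
Proof.
move=> hpsi hpsi'; apply: eval_op_psi => [f []//|k f|k f hf]; first exact: good_T.
apply/eqP; rewrite -subr_eq0 !opTE opprD addrACA subrr add0r -sumrB.
rewrite -[X in _ == X](hf.2 (fun j => (psi k j)%:R - (psi' k j)%:R)).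
  by apply/eqP; apply: eq_bigr => j _; rewrite scalerBl.
apply: (locally_const_outer) => l l' hll nll.
have aux (x y z : F) : x - y = (x + z) - (y + z).
  by rewrite opprD addrACA subrr addr0.
rewrite (aux _ _ (k == l)%:R) [RHS](aux _ _ (k == l')%:R) -!natrD.
by rewrite (hpsi _ _ hll nll k) (hpsi' _ _ hll nll k).
Qed.

End Good.

Section LinearSubstitutionQuotient.
Variables (F : fieldType) (V : lmodType F) (d : {linear V -> V}).
Variables (n N : nat) (th : 'I_n -> spoly F 'I_N) (s : 'I_n -> seq 'I_N).
Hypothesis thE : forall i, th i = \sum_(y <- s i) svar F y.
Hypothesis s_sum : forall (A : lmodType F) (E : 'I_N -> A),
  \sum_i \sum_(y <- s i) E y = \sum_y E y.

(** By [s_sum] the sum of all variables is mapped to the sum of all variables, so the substitution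
    descends to the quotients by [dlam]. *)
Lemma vsubst_dlam (p : vpoly V 'I_n) :
  vsubst th (dlam d p) = dlam d (vsubst th p).
Proof.
rewrite /dlam raddfD /= vsubst_map; congr (_ + _); rewrite raddf_sum /=.
rewrite -[RHS]s_sum; apply: eq_bigr => i _.
exact: vsubst_mulX.
Qed.

Lemma qsubstE (p : vpoly V 'I_n) :
  qsubst th (lclass d p) = lclass d (vsubst th p).
Proof.
have [q hq] := lclassK d p; apply/eqP/lclassP; exists (vsubst th q).
by rewrite hq raddfD /= addrC addKr vsubst_dlam.
Qed.

Lemma qsubst_linear : linear (qsubst th : Vlam d n -> Vlam d N).
Proof.
move=> c x y; rewrite -(lclass_crepr x) -(lclass_crepr y) -linearP !qsubstE.
by rewrite !linearP.
Qed.

Lemma qsubst_mulX i (x : Vlam d n) :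
  qsubst th (qmulX i x) = \sum_(y <- s i) qmulX y (qsubst th x).
Proof.
rewrite -(lclass_crepr x) qmulXE !qsubstE (vsubst_mulX thE) raddf_sum /=.
by apply: eq_bigr => y _ /=; rewrite qmulXE.
Qed.

Lemma qsubst_derivB i j (y z : 'I_N) (x : Vlam d n) :
  (forall k, count_mem y (s k) = (k == i)) ->
  (forall k, count_mem z (s k) = (k == j)) ->
  qderivB y z (qsubst th x) = qsubst th (qderivB i j x).
Proof.
move=> hy hz; rewrite -(lclass_crepr x) qsubstE !qderivBE qsubstE.
congr (lclass d _); rewrite raddfB /= !(vderiv_subst thE); congr (_ - _).
  rewrite (bigD1 i) //= hy eqxx mulr1n big1 ?addr0 // => k /negPf nk.
  by rewrite hy nk.
rewrite (bigD1 j) //= hz eqxx mulr1n big1 ?addr0 // => k /negPf nk.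
by rewrite hz nk.
Qed.

End LinearSubstitutionQuotient.

(** * Leibniz rule for evaluations *)

Section EvalDerivation.
Variables (F : fieldType) (V M : lmodType F) (d : {linear V -> V}).
Variables (n : nat) (m : 'I_n -> nat) (N : nat).
Variables (r : forall i, 'I_(m i) -> 'I_N).
Arguments r : clear implicits.
Variable L : 'I_N -> {linear M -> M}.
Hypothesis LC : forall k l x, L k (L l x) = L l (L k x).
Variables (D : {linear M -> M}) (c : 'I_N -> F).
Hypothesis DL : forall k x, D (L k x) = L k (D x) + c k *: x.
Variable psi : 'I_N -> 'I_n -> bool.

(** The commutator of D with [opT psi k], which is a scalar: [c k] comes from lambda_k, and each X_j
    occurring in T_k contributes the sum of c over block j. *)
Definition opT_weight k : F :=
  c k + \sum_j (psi k j)%:R * \sum_(b < m j) c (r j b).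

Definition slot_deriv i (p : vpoly V 'I_(m i)) : vpoly V 'I_(m i) :=
  \sum_a opT_weight (r i a) *: vderiv a p.

Lemma slot_deriv_linear i (e : F) (p q : vpoly V 'I_(m i)) :
  slot_deriv (e *: p + q) = e *: slot_deriv p + slot_deriv q.
Proof.
rewrite /slot_deriv scaler_sumr -big_split; apply: eq_bigr => a _ /=.
by rewrite (linearP (vderiv a)) scalerDr !scalerA mulrC.
Qed.

Lemma deriv_opT k phi :
  (fun u => D (opT d r L psi k phi u))
  = 1 *: opT d r L psi k (fun u => D (phi u)) + opT_weight k *: phi.
Proof.
rewrite scale1r; apply/funext => u.
rewrite -[RHS]/(opT d r L psi k (fun u => D (phi u)) u + opT_weight k *: phi u).
rewrite /opT linearD linear_sum /= DL /opT_weight scalerDl addrACA; congr (_ + _).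
rewrite scaler_suml -big_split; apply: eq_bigr => j _ /=.
rewrite linearZ /= -scalerA -scalerDr; congr (_ *: _).
rewrite /opX linearD linear_sum /=; under eq_bigr do rewrite DL.
by rewrite big_split scaler_suml /= addrAC.
Qed.

(** Leibniz rule: D either reaches phi or differentiates one of the polynomial arguments, each
    variable being weighted by the commutator of D with the operator that represents it. *)
Lemma eval_op_deriv phi (w : forall i, vpoly V 'I_(m i)) : multilinear phi ->
  D (eval_op d r L psi phi w)
  = eval_op d r L psi (fun u => D (phi u)) w
    + \sum_i eval_op d r L psi phi (dfwith w (slot_deriv (w i))).
Proof.
have DM (f : ('I_n -> V) -> M) : multilinear f -> multilinear (fun u => D (f u)).
  by move=> hf u i a x y; rewrite hf linearP.
elim/vpolys_ind: w phi => [w i|w i p q hp hq|w i p a hp|v] phi hphi;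
  have hDphi := DM _ hphi.
- rewrite !eval_op_slot0 // raddf0 add0r big1 // => j _.
  have [e|nij] := eqVneq i j; last by rewrite dfwithC // eval_op_slot0.
  case: _ / e; rewrite dfwith_in dfwith_dfwith (oplin0 (@slot_deriv_linear i)).
  by rewrite eval_op_slot0.
- rewrite !eval_op_slotD // raddfD /= hp // hq // addrACA -big_split /=.
  congr (_ + _); apply: eq_bigr => j _.
  have [e|nij] := eqVneq i j.
    case: _ / e; rewrite !dfwith_in !dfwith_dfwith.
    by rewrite (oplinD (@slot_deriv_linear i)) eval_op_slotD.
  by rewrite !(dfwith_out _ _ nij) !(dfwithC _ _ _ nij) eval_op_slotD.
- have hT := opT_multilinear d r L psi (r i a) hphi.
  rewrite eval_op_mulX // hp // deriv_opT eval_op_linear // scale1r -addrA.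
  rewrite [in RHS]eval_op_mulX //; congr (_ + _).
  rewrite (bigD1 i) //= [in RHS](bigD1 i) //= addrA; congr (_ + _); last first.
    apply: eq_bigr => j nji; rewrite eq_sym in nji.
    by rewrite !(dfwith_out _ _ nji) !(dfwithC _ _ _ nji) eval_op_mulX.
  rewrite !dfwith_in !dfwith_dfwith.
  have -> : slot_deriv (vmulX a p)
      = opT_weight (r i a) *: p + vmulX a (slot_deriv p).
    rewrite /slot_deriv raddf_sum /=; under eq_bigr do rewrite vderiv_mulX scalerDr.
    rewrite big_split /= addrC; congr (_ + _).
      rewrite (bigD1 a) //= eqxx mulr1n big1 ?addr0 // => b /negPf ->.
      by rewrite mulr0n scaler0.
    by apply: eq_bigr => b _; rewrite linearZ.
  rewrite eval_op_slot_linear // eval_op_mulX //; congr (_ + _).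
  pose B f := eval_op d r L psi f (dfwith w p).
  have BP (e : F) f f' : B (e *: f + f') = e *: B f + B f'.
    exact: eval_op_linear.
  exact: (oplinZ BP).
rewrite !eval_op_const // big1 ?addr0 // => i _.
rewrite /slot_deriv big1 ?eval_op_slot0 // => a _.
by rewrite vderiv_const scaler0.
Qed.

End EvalDerivation.

(** * Trails and edges of the inner and outer graphs *)

Section BlockTrails.
Variables (n : nat) (m : 'I_n -> nat) (N : nat).
Variables (r : forall i, 'I_(m i) -> 'I_N) (blk : 'I_N -> 'I_n).
Arguments r : clear implicits.
Hypothesis hb : blocks r blk.
Implicit Type G : graph N.

Definition outer_edge (e : 'I_N * 'I_N) : 'I_n * 'I_n := (blk e.1, blk e.2).

Definition outer_walk (w : seq (step N)) : seq (step n) :=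
  [seq (outer_edge t.1, t.2) | t <- w & blk t.1.1 != blk t.1.2].

Definition inner_step i (t : step (m i)) : step N :=
  ((r i t.1.1, r i t.1.2), t.2).

Lemma outer_walkP k w l : walk k w l -> walk (blk k) (outer_walk w) (blk l).
Proof.
elim: w k => [|t w IH] k /=; first by move=> /eqP ->.
move=> /andP[/eqP <- /IH h]; rewrite /outer_walk /=.
case: ifP => [_|/negbFE/eqP e].
  rewrite map_cons /= -/(outer_walk w).
  have -> : step_tgt (outer_edge t.1, t.2) = blk (step_tgt t).
    by rewrite /step_tgt /=; case: ifP.
  by rewrite h andbT /step_src /=; case: ifP.
suff -> : blk (step_src t) = blk (step_tgt t) by [].
by rewrite /step_src /step_tgt; case: ifP.
Qed.

(** Steps inside a block disappear, and the multiplicity bound at an outer edge is the sum of the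
    bounds at the edges above it. *)
Lemma outer_trail G k w l :
  trail G k w l -> trail (outer r G) (blk k) (outer_walk w) (blk l).
Proof.
move=> /andP[hw /forallP hc]; rewrite /trail outer_walkP //=.
apply/forallP => -[i j]; have [<-|nij] := eqVneq i j.
  rewrite mult_loop leqn0; apply/eqP/count_memPn; rewrite /unzip1 /outer_walk -map_comp.
  apply/mapP => -[t]; rewrite mem_filter => /andP[h _] [e1 e2].
  by rewrite -e1 -e2 eqxx in h.
rewrite (mult_outerE hb) //.
have -> : count_mem (i, j) (unzip1 (outer_walk w))
    = (\sum_(e | (blk e.1 == i) && (blk e.2 == j)) count_mem e (unzip1 w))%N.
  elim: w {hw hc} => [|t w IH]; first by rewrite big1.
  rewrite [X in _ = X](eq_bigr (fun e => (t.1 == e) + count_mem e (unzip1 w))%N) //.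
  rewrite big_split -IH /outer_walk /=.
  have -> : (\sum_(e | (blk e.1 == i) && (blk e.2 == j)) (t.1 == e)
      = (outer_edge t.1 == (i, j)))%N.
    rewrite big_mkcond (bigD1 t.1) //= eqxx big1 ?addn0.
      by rewrite /outer_edge xpair_eqE; case: ifP.
    by move=> e; rewrite eq_sym => /negPf ->; case: ifP.
  case: ifP => //= /negbFE/eqP e; rewrite /outer_edge e.
  by case: eqP => // -[ei ej]; rewrite -ei -ej eqxx in nij.
by apply: leq_sum => e _; apply: hc.
Qed.

(** A walk without crossing steps stays in the block where it starts. The starting vertex is
    presented as [r i a] to keep the type of the inner vertices fixed during the induction. *)
Lemma outer_walk_nil k w l : walk k w l -> outer_walk w = [::] ->
  forall i a, r i a = k -> exists w' b, [/\ w = map (@inner_step i) w',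
    walk a w' b & r i b = l].
Proof.
elim: w k => [|t w IH] k /=.
  by move=> /eqP <- _ i a <-; exists [::], a; rewrite /= eqxx.
move=> /andP[/eqP hs hw]; rewrite /outer_walk /=.
case: ifP => // /negbFE/eqP e how i a hka.
have et : blk (step_src t) = blk (step_tgt t).
  by rewrite /step_src /step_tgt; case: ifP.
have [a' ha'] : exists a', r i a' = step_tgt t.
  have [a' ha'] := blocks_surj hb (step_tgt t).
  by move: a' ha'; rewrite -et hs -hka (blocksK hb) => a' <-; exists a'.
have [w' [b [-> hw' hl]]] := IH _ hw how _ _ ha'.
exists ((if t.2 then (a, a') else (a', a), t.2) :: w'), b; split=> //=.
  rewrite /inner_step /=; congr (_ :: _).
  move: hs ha'; rewrite -hka /step_src /step_tgt.
  by case: t {hw IH how e et} => -[x y] [] /= -> ->.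
by rewrite /step_src /step_tgt /=; case: (t.2); rewrite eqxx.
Qed.

Lemma inner_trail G i a w b :
  trail G (r i a) (map (@inner_step i) w) (r i b) -> walk a w b ->
  trail (inner r i G) a w b.
Proof.
move=> /andP[_ /forallP hc] hw; rewrite /trail hw /=; apply/forallP => -[x y].
rewrite mult_inner; apply: leq_trans (hc (r i x, r i y)).
rewrite {hc hw}; elim: w => //= t w IH; apply: leq_add IH.
by case: t => -[x' y'] tt /=; case: eqP => // -[-> ->]; rewrite eqxx.
Qed.

(** A closed trail collapses to a closed trail of the outer graph, which is empty; the trail then
    lies in a single inner graph and is empty as well. *)
Lemma acyclic_blocks G :
  acyclic (outer r G) -> (forall i, acyclic (inner r i G)) -> acyclic G.
Proof.
move=> ho hi k w hw; have how := acyclic_trail ho (outer_trail hw).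
have [a ha] := blocks_surj hb k; move: hw; rewrite -ha => hw.
have [w' [b [ew hw' hba]]] := outer_walk_nil (andP hw).1 how erefl.
move: hw; rewrite ew -{2}hba => /inner_trail/(_ hw').
by rewrite (blocks_inj hb hba) => /(acyclic_trail (hi _)) ->.
Qed.

Lemma outer_del_crossing G k l : blk k != blk l ->
  (0 < mult G (k, l))%N ->
  outer r (del_edge G (k, l)) = del_edge (outer r G) (blk k, blk l).
Proof.
move=> nkl hkl; apply: graphP => i j nij.
rewrite mult_del_edge !(mult_outerE hb) //; case: eqP => [[<- <-]|ne]; last first.
  rewrite subn0; apply: eq_bigr => -[x y] /= /andP[/eqP hx /eqP hy].
  rewrite mult_del_edge; case: eqP => [[ex ey]|_]; last by rewrite subn0.
  by case: ne; rewrite -hx -hy ex ey.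
rewrite (bigD1 (k, l)) ?eqxx //= [in RHS](bigD1 (k, l)) ?eqxx //=.
rewrite mult_del_edge eqxx -addnBAC //; congr (_ + _)%N.
by apply: eq_bigr => -[x y] /andP[_ /negPf ne]; rewrite mult_del_edge eq_sym ne subn0.
Qed.

Lemma outer_del_inner G k l : blk k = blk l ->
  outer r (del_edge G (k, l)) = outer r G.
Proof.
move=> ekl; apply: graphP => i j nij; rewrite !(mult_outerE hb) //.
apply: eq_bigr => -[x y] /= /andP[/eqP hx /eqP hy].
rewrite mult_del_edge; case: eqP => [[ex ey]|_]; last by rewrite subn0.
by rewrite -hx -hy -ex -ey ekl eqxx in nij.
Qed.

Lemma inner_del G i a b :
  inner r i (del_edge G (r i a, r i b)) = del_edge (inner r i G) (a, b).
Proof.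
apply: graphP => x y nxy; rewrite mult_inner !mult_del_edge mult_inner.
congr (_ - _)%N; congr nat_of_bool; apply/eqP/eqP => [[]|[-> ->]] //.
by move=> /(blocks_inj hb) -> /(blocks_inj hb) ->.
Qed.

Lemma inner_del_other G i k l : blk k != i \/ blk l != i ->
  inner r i (del_edge G (k, l)) = inner r i G.
Proof.
move=> h; apply: graphP => x y nxy; rewrite !mult_inner mult_del_edge.
case: eqP => [[ek el]|_]; last by rewrite subn0.
by case: h; rewrite ?ek ?el (blocksK hb) eqxx.
Qed.

(** Edges are counted by the ordered pair of blocks of their ends: diagonal pairs give the inner
    graphs, the others the outer one. *)
Lemma nb_edges_blocks G :
  nb_edges G = (nb_edges (outer r G) + \sum_i nb_edges (inner r i G))%N.
Proof.
rewrite /nb_edges.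
pose E i j := (\sum_(a < m i) \sum_(b < m j) mult G (r i a, r j b))%N.
have -> : (\sum_e mult G e = \sum_i \sum_j E i j)%N.
  rewrite (eq_bigr (fun e => mult G (e.1, e.2))) => [|[]//].
  rewrite -(pair_bigA _ (fun i j => mult G (i, j))) /= (sum_blocks hb).
  apply: eq_bigr => i _; rewrite exchange_big /= (sum_blocks hb).
  by apply: eq_bigr => j _; rewrite exchange_big.
have -> : (\sum_e mult (outer r G) e = \sum_i \sum_(j | j != i) E i j)%N.
  rewrite (eq_bigr (fun e => mult (outer r G) (e.1, e.2))) => [|[]//].
  rewrite -(pair_bigA _ (fun i j => mult (outer r G) (i, j))) /=.
  apply: eq_bigr => i _; rewrite (bigD1 i) //= mult_loop add0n.
  by apply: eq_bigr => j nji; rewrite mult_outer // eq_sym.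
rewrite -big_split; apply: eq_bigr => i _ /=.
rewrite (bigD1 i) //= addnC; congr (_ + _)%N.
rewrite [RHS](eq_bigr (fun e => mult (inner r i G) (e.1, e.2))) => [|[]//].
rewrite -(pair_bigA _ (fun a b => mult (inner r i G) (a, b))) /=.
by apply: eq_bigr => a _; apply: eq_bigr => b _; rewrite mult_inner.
Qed.

End BlockTrails.

(** * Composition without signs *)

Section RawComposition.
Variables (F : fieldType) (V : lmodType F) (d : {linear V -> V}).

Lemma qmulXC N (k l : 'I_N) (x : Vlam d N) :
  qmulX k (qmulX l x) = qmulX l (qmulX k x).
Proof. by rewrite -(lclass_crepr x) !qmulXE vmulXC. Qed.

Definition qmul N (k : 'I_N) : {linear Vlam d N -> Vlam d N} := @qmulX F V d N k.

Lemma qmulC N (k l : 'I_N) x : qmul k (qmul l x) = qmul l (qmul k x).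
Proof. exact: qmulXC. Qed.

Variables (n : nat) (m : 'I_n -> nat) (N : nat).
Variables (r : forall i, 'I_(m i) -> 'I_N) (blk : 'I_N -> 'I_n).
Arguments r : clear implicits.

Definition block_var (j : 'I_n) : spoly F 'I_N :=
  \sum_(a < m j) svar F (r j a).

Definition pull (f : ('I_n -> V) -> Vlam d n) : ('I_n -> V) -> Vlam d N :=
  fun u => qsubst block_var (f u).

Definition rawop k := graph k -> ('I_k -> V) -> Vlam d k.

(** The formula without its sign, for the particular choices [crepr] of representatives and [ext] of
    the sets E(k). *)
Definition comp_op (f : rawop n) (g : forall i, rawop (m i)) : rawop N :=
  fun G v =>
    if `[< acyclic (outer r G) >] then
      eval_op d r (@qmul N) (ext r blk G) (pull (f (outer r G)))
        (fun i => crepr (g i (inner r i G) (fun a => v (r i a))))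
    else 0.

Hypothesis hb : blocks r blk.
Implicit Type G : graph N.

Definition block_seq j : seq 'I_N := [seq r j a | a <- enum 'I_(m j)].

Lemma block_varE j : block_var j = \sum_(y <- block_seq j) svar F y.
Proof. by rewrite /block_seq big_map big_enum. Qed.

Lemma block_seq_sum (A : lmodType F) (E : 'I_N -> A) :
  \sum_i \sum_(y <- block_seq i) E y = \sum_y E y.
Proof.
rewrite (sum_blocks hb); apply: eq_bigr => i _.
by rewrite /block_seq big_map big_enum.
Qed.

Lemma block_seq_count k i : count_mem k (block_seq i) = (i == blk k) :> nat.
Proof.
elim/(blocks_ind hb): k => j b; rewrite (blocksK hb) count_map.
have [e|nij] := eqVneq i j; last first.
  apply/eqP; rewrite -leqn0 leqNgt -has_count; apply/hasPn => a _ /=.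
  by apply: contra nij => /eqP/(block_eq hb) ->.
case: _ / (esym e) in b *.
rewrite (eq_count (a2 := pred1 b)); last first.
  by move=> a /=; apply/eqP/eqP => [/(blocks_inj hb)|->].
by rewrite count_uniq_mem ?enum_uniq // mem_enum.
Qed.

Lemma qsubst_block_linear : linear (qsubst block_var : Vlam d n -> Vlam d N).
Proof. exact: (qsubst_linear block_varE block_seq_sum). Qed.

Lemma qsubst_block_mulX i (x : Vlam d n) :
  qsubst block_var (qmulX i x) = \sum_(a < m i) qmulX (r i a) (qsubst block_var x).
Proof.
by rewrite (qsubst_mulX block_varE block_seq_sum) /block_seq big_map big_enum.
Qed.

Lemma qsubst_block_derivB k l (x : Vlam d n) :
  qderivB k l (qsubst block_var x)
  = qsubst block_var (qderivB (blk k) (blk l) x).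
Proof.
by apply: (qsubst_derivB block_varE block_seq_sum) => i;
  rewrite block_seq_count.
Qed.

Lemma pull_multilinear f : multilinear f -> multilinear (pull f).
Proof. by move=> hf u i a x y; rewrite /pull hf qsubst_block_linear. Qed.

(** Lambda_j is the image of lambda_j, so X_j acts on a pulled back function as lambda_j + d_j acts
    before the substitution. This is how sesquilinearity of f becomes goodness in [pull_good]. *)
Lemma pull_opX j f :
  opX d r (@qmul N) j (pull f) = pull (fun u => qmulX j (f u) + f (upd u j (d (u j)))).
Proof.
apply/funext => u; rewrite /opX /pull (oplinD qsubst_block_linear).
by rewrite qsubst_block_mulX.
Qed.

Lemma pcl_multilinear k (f : rawop k) (H : graph k) : is_pcl f -> multilinear (f H).
Proof. by move=> hf u i a x y; apply: (pcl_linear hf). Qed.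

Lemma pull_good (H : graph n) (f : rawop n) :
  is_pcl f -> good d r (@qmul N) H (pull (f H)).
Proof.
move=> hf; split=> [|chi hchi]; first exact/pull_multilinear/pcl_multilinear.
apply/funext => u; rewrite fct_sumE.
under eq_bigr do rewrite pull_opX.
pose W j := qmulX j (f H u) + f H (upd u j (d (u j))).
transitivity (qsubst block_var (\sum_j chi j *: W j)).
  rewrite (oplin_sum qsubst_block_linear); apply: eq_bigr => j _.
  by rewrite (oplinZ qsubst_block_linear).
rewrite (locally_const_sum hchi) ?(oplin0 qsubst_block_linear) // => i.
by rewrite big_split /= (pcl_sesqui hf) subrr.
Qed.

(** The choices built into [comp_op] are released here; from now on psi and w are selected to suit
    several graphs or several compositions at once. *)
Lemma comp_opE (f : rawop n) (g : forall i, rawop (m i)) G v psi w :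
  is_pcl f -> acyclic (outer r G) -> coboundary blk G psi ->
  (forall i, lclass d (w i) = g i (inner r i G) (fun a => v (r i a))) ->
  comp_op f g G v = eval_op d r (@qmul N) psi (pull (f (outer r G))) w.
Proof.
move=> hf hG hpsi hw; rewrite /comp_op asboolT //.
have hgood := pull_good (outer r G) hf.
rewrite (eval_op_coboundary (@qmulC N) hb _ (ext_coboundary hb hG) hpsi hgood).
apply: (eval_op_ext (@qmulC N) hb hpsi hgood) => i.
by rewrite lclass_crepr hw.
Qed.

Lemma comp_op_nacyclic f g G v : ~ acyclic (outer r G) -> comp_op f g G v = 0.
Proof. by move=> hG; rewrite /comp_op asboolF. Qed.

Lemma comp_op_upd (f : rawop n) (g : forall i, rawop (m i)) G v psi w
    i (a : 'I_(m i)) x p :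
  is_pcl f -> acyclic (outer r G) -> coboundary blk G psi ->
  (forall j, lclass d (w j) = g j (inner r j G) (fun b => v (r j b))) ->
  lclass d p = g i (inner r i G) (upd (fun b => v (r i b)) a x) ->
  comp_op f g G (upd v (r i a) x)
  = eval_op d r (@qmul N) psi (pull (f (outer r G))) (dfwith w p).
Proof.
move=> hf hG hpsi hw hp; apply: comp_opE => // j.
case: dfwithP => [|k nik].
  rewrite hp; congr (g i _ _); apply/funext => b.
  by rewrite /upd (inj_eq (@blocks_inj _ _ _ _ _ hb i)).
rewrite hw; congr (g k _ _); apply/funext => b.
rewrite /upd; case: eqP => // /(block_eq hb) e.
by rewrite e eqxx in nik.
Qed.

Variables (f : rawop n) (g : forall i, rawop (m i)).
Arguments g : clear implicits.
Hypotheses (hf : is_pcl f) (hg : forall i, is_pcl (g i)).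

Lemma comp_op_linear G v k (a : F) x y :
  comp_op f g G (upd v k (a *: x + y))
  = a *: comp_op f g G (upd v k x) + comp_op f g G (upd v k y).
Proof.
have [hG|hG] := pselect (acyclic (outer r G)); last first.
  by rewrite !comp_op_nacyclic // scaler0 addr0.
elim/(blocks_ind hb): k => i b.
pose W j := g j (inner r j G) (fun b => v (r j b)).
pose q z := crepr (g i (inner r i G) (upd (fun b => v (r i b)) b z)).
have hW j : lclass d (crepr (W j)) = W j by rewrite lclass_crepr.
have hext := ext_coboundary hb hG.
rewrite (comp_op_upd hf hG hext hW (p := a *: q x + q y)); last first.
  by rewrite linearP /= !lclass_crepr (pcl_linear (hg i)).
rewrite !(comp_op_upd hf hG hext hW (lclass_crepr _)).
exact: (eval_op_slot_linear _ _ (@qmulC N) _ _ _ _ _ (pull_good _ hf).1).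
Qed.

Lemma comp_op_slot_class0 G psi w i (p : vpoly V 'I_(m i)) phi :
  coboundary blk G psi -> good d r (@qmul N) (outer r G) phi ->
  lclass d p = 0 -> eval_op d r (@qmul N) psi phi (dfwith w p) = 0.
Proof.
move=> hpsi hphi hp.
rewrite (eval_op_ext (@qmulC N) hb hpsi (w' := dfwith w (0 : vpoly V 'I_(m i))) hphi).
  exact: (eval_op_slot0 _ _ (@qmulC N) _ _ _ hphi.1).
move=> j; have [e|nij] := eqVneq i j; last by rewrite !dfwith_out.
by case: _ / e; rewrite !dfwith_in hp linear0.
Qed.

Lemma comp_op_acyclic G v : ~ acyclic G -> comp_op f g G v = 0.
Proof.
move=> hG; have [ho|] := pselect (acyclic (outer r G)); last exact: comp_op_nacyclic.
have [i hi] : exists i, ~ acyclic (inner r i G).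
  apply: contrapT => /forallNP h; apply: hG.
  by apply: (acyclic_blocks hb ho) => i; apply: contrapT.
have hext := ext_coboundary hb ho.
pose w j := crepr (g j (inner r j G) (fun b => v (r j b))).
rewrite (comp_opE hf ho hext (w := w)); last by move=> j; rewrite lclass_crepr.
rewrite -(dfwith_id w i); apply: (comp_op_slot_class0 _ hext (pull_good _ hf)).
by rewrite lclass_crepr (pcl_acyclic (hg i)).
Qed.

Lemma vderiv_dlamB k (a b : 'I_k) (x : Vlam d k) (c : 'I_k) :
  qderivB a b (qmulX c x)
  = qmulX c (qderivB a b x) + ((c == a)%:R - (c == b)%:R) *: x.
Proof.
rewrite -(lclass_crepr x) qmulXE !qderivBE qmulXE -linearZ -linearD /=.
congr (lclass d _); rewrite !vderiv_mulX linearB /= scalerBl.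
rewrite ![_ == c]eq_sym !scaler_nat opprD addrACA.
by [].
Qed.

(** Apply the Leibniz rule to D = d/d lambda_k - d/d lambda_l. It kills phi, because the blocks of k
    and l are equal or adjacent in the outer graph. In the slots, the variable at a vertex a has
    weight (delta_ak + [blk k in E(a)]) - (delta_al + [blk l in E(a)]). For a crossing edge this is
    the coboundary condition, hence zero. For an edge inside a block only delta_ak - delta_al is
    left, and the relation for the operation in that block applies. *)
Lemma comp_op_deriv_adjacent G v k l :
  adjacent G k l -> qderivB k l (comp_op f g G v) = 0.
Proof.
move=> hkl; have [hG|hG] := pselect (acyclic (outer r G)); last first.
  by rewrite comp_op_nacyclic //; exact: linear0.
have hext := ext_coboundary hb hG.
pose w j := crepr (g j (inner r j G) (fun b => v (r j b))).
have hgood := pull_good (outer r G) hf.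
rewrite (comp_opE hf hG hext (w := w)); last by move=> j; rewrite lclass_crepr.
pose c x : F := (x == k)%:R - (x == l)%:R.
pose D : {linear Vlam d N -> Vlam d N} := @qderivB F V d N k l.
have DL x (y : Vlam d N) : D (qmul x y) = qmul x (D y) + c x *: y.
  exact: vderiv_dlamB.
rewrite -/(D _) (eval_op_deriv _ _ (@qmulC N) DL _ _ hgood.1).
have hout : blk l \in component (outer r G) (blk k).
  have [->|nkl] := eqVneq (blk k) (blk l); first exact: component_refl.
  rewrite inE; apply: connect1; apply/(adjacent_outerP hb).
  by exists k, l.
have -> : (fun u => D (pull (f (outer r G)) u)) = 0.
  apply/funext => u; rewrite /D /pull [LHS]qsubst_block_derivB.
  by rewrite (pcl_deriv hf) // (oplin0 qsubst_block_linear).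
have -> w' : eval_op d r (@qmul N) (ext r blk G) 0 w' = 0.
  pose B x := eval_op d r (@qmul N) (ext r blk G) x w'.
  have BP (e : F) x y : B (e *: x + y) = e *: B x + B y.
    exact: (eval_op_linear _ _ (@qmulC N)).
  exact: (oplin0 BP).
rewrite add0r big1 // => i _.
apply: (comp_op_slot_class0 _ hext hgood).
have c_block j : \sum_(b < m j) c (r j b) = (j == blk k)%:R - (j == blk l)%:R.
  by rewrite sumrB !(sum_block_delta hb) ![blk _ == j]eq_sym.
have weight x : opT_weight r c (ext r blk G) x
    = c x + (ext r blk G x (blk k))%:R - (ext r blk G x (blk l))%:R.
  rewrite /opT_weight -[RHS]addrA; congr (_ + _).
  under eq_bigr do rewrite c_block mulrBr.
  rewrite sumrB; congr (_ - _).
    rewrite (bigD1 (blk k)) //= eqxx mulr1 big1 ?addr0 // => j /negPf ->.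
    by rewrite mulr0.
  rewrite (bigD1 (blk l)) //= eqxx mulr1 big1 ?addr0 // => j /negPf ->.
  by rewrite mulr0.
have [ekl|nkl] := eqVneq (blk k) (blk l); last first.
  rewrite /slot_deriv big1 ?linear0 // => a _; rewrite weight.
  have /(congr1 (fun x : nat => x%:R : F)) := hext _ _ hkl nkl (r i a).
  have aux (p q x y : F) : p + x = q + y -> x - y + p - q = 0.
    by move=> e; rewrite -addrA addrACA -opprD [y + q]addrC -e [x + p]addrC subrr.
  by rewrite !natrD => /aux ->; rewrite scale0r.
have weight' x : opT_weight r c (ext r blk G) x = c x.
  by rewrite weight ekl addrK.
rewrite /slot_deriv; under eq_bigr do rewrite weight' /c.
have [a ha] := blocks_surj hb k; have [b hb'] := blocks_surj hb l.
have [ei|ni] := eqVneq i (blk k); last first.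
  rewrite big1 ?linear0 // => x _.
  have -> : (r i x == k) = false.
    by apply/negP => /eqP e; rewrite -e (blocksK hb) eqxx in ni.
  have -> : (r i x == l) = false.
    by apply/negP => /eqP e; rewrite ekl -e (blocksK hb) eqxx in ni.
  by rewrite subrr scale0r.
have {}hb' : exists b', r (blk k) b' = l by move: b hb'; rewrite -ekl => b <-; exists b.
have [{}b {}hb'] := hb'; case: _ / (esym ei).
have E (x y : 'I_(m (blk k))) : (r (blk k) x == r (blk k) y) = (x == y).
  by rewrite (inj_eq (@blocks_inj _ _ _ _ _ hb (blk k))).
have Ek x : (r (blk k) x == k) = (x == a) by rewrite -E ha.
have El x : (r (blk k) x == l) = (x == b) by rewrite -E hb'.
under eq_bigr do rewrite Ek El scalerBl.
rewrite sumrB (bigD1 a) //= eqxx scale1r [X in _ + X - _]big1 ?addr0; last first.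
  by move=> x /negPf ->; rewrite scale0r.
rewrite (bigD1 b) //= eqxx scale1r [X in _ - (_ + X)]big1 ?addr0; last first.
  by move=> x /negPf ->; rewrite scale0r.
rewrite -qderivBE lclass_crepr (pcl_deriv (hg _)) // inE.
by apply: connect1; rewrite adjacent_inner ha hb'.
Qed.

Lemma qderivBD N' (a b c : 'I_N') (x : Vlam d N') :
  qderivB a c x = qderivB a b x + qderivB b c x.
Proof.
by rewrite -(lclass_crepr x) !qderivBE -linearD /= addrA subrK.
Qed.

Lemma comp_op_deriv G v k l :
  l \in component G k -> qderivB k l (comp_op f g G v) = 0.
Proof.
rewrite inE => /connectP[p hp ->]; elim: p k hp => [|x p IH] k /=.
  by move=> _; rewrite -(lclass_crepr (comp_op _ _ _ _)) qderivBE subrr linear0.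
move=> /andP[hkx hp]; rewrite (qderivBD _ x) comp_op_deriv_adjacent //.
by rewrite IH // addr0.
Qed.

(** The indicator chi of the component is constant along all edges of Gamma. Along inner edges, this
    lets sesquilinearity of each g_i replace d_a by minus lambda_a in slot i, that is, by minus T_a
    on phi. Along crossing edges, it makes the coefficients of the X_j in the sum of chi(a) T_a
    locally constant, so that only the lambda_a survive. *)
Lemma comp_op_sesqui G v k :
  \sum_(l in component G k) comp_op f g G (upd v l (d (v l)))
  = - \sum_(l in component G k) qmulX l (comp_op f g G v).
Proof.
have [hG|hG] := pselect (acyclic (outer r G)); last first.
  rewrite [X in X = _]big1 ?[X in - X]big1 ?oppr0 // => l _.
    by rewrite comp_op_nacyclic //; exact: linear0.
  by rewrite comp_op_nacyclic.
have hext := ext_coboundary hb hG; have hgood := pull_good (outer r G) hf.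
pose g' i := g i (inner r i G) (fun a => v (r i a)).
pose w i := crepr (g' i).
have hw j : lclass d (w j) = g' j by rewrite lclass_crepr.
pose phi := pull (f (outer r G)); rewrite -/phi in hgood.
pose ev x w' := eval_op d r (@qmul N) (ext r blk G) x w'.
have -> : comp_op f g G v = ev phi w by rewrite (comp_opE hf hG hext hw).
pose chi l : F := (l \in component G k)%:R.
have sum_chi (E : 'I_N -> Vlam d N) : \sum_(l in component G k) E l = \sum_l chi l *: E l.
  rewrite big_mkcond; apply: eq_bigr => l _; rewrite /chi.
  by case: ifP => _; rewrite ?scale1r ?scale0r.
rewrite !sum_chi.
have chi_adj x y : adjacent G x y -> chi x = chi y.
  move=> hxy; rewrite /chi; congr (_%:R); congr nat_of_bool.
  rewrite !inE; apply/idP/idP => h; first exact: connect_trans h (connect1 hxy).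
  by apply: connect_trans h (connect1 _); rewrite adjacent_sym.
have AP i (c : F) (x y : vpoly V 'I_(m i)) :
    ev phi (dfwith w (c *: x + y)) = c *: ev phi (dfwith w x) + ev phi (dfwith w y).
  exact: (eval_op_slot_linear _ _ (@qmulC N) _ _ _ _ _ hgood.1).
have BP (c : F) x y : ev (c *: x + y) w = c *: ev x w + ev y w.
  exact: (eval_op_linear _ _ (@qmulC N)).
have opLE k' : ev (opL (@qmul N) k' phi) w = qmulX k' (ev phi w).
  by rewrite /ev -(eval_op_L _ _ (@qmulC N) _ _ _ hgood.1).
have block i :
   \sum_a chi (r i a) *: comp_op f g G (upd v (r i a) (d (v (r i a))))
   = - \sum_a chi (r i a) *: ev (opT d r (@qmul N) (ext r blk G) (r i a) phi) w.
  pose q a := crepr (g i (inner r i G) (upd (fun b => v (r i b)) a (d (v (r i a))))).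
  have hq a : lclass d (q a) = g i (inner r i G) (upd (fun b => v (r i b)) a (d (v (r i a)))).
    by rewrite lclass_crepr.
  under eq_bigr do rewrite (comp_op_upd hf hG hext hw (hq _)) -/(ev _ _).
  under [in RHS]eq_bigr => a _.
    rewrite -[w in ev _ w](dfwith_id w i) /ev.
    rewrite -(eval_op_mulX _ _ (@qmulC N)); last exact: hgood.1.
    over.
  apply/eqP; rewrite -addr_eq0 -big_split /=; apply/eqP.
  pose A (x : vpoly V 'I_(m i)) := ev phi (dfwith w x).
  have A_lin (c : F) x y : A (c *: x + y) = c *: A x + A y by apply: AP.
  rewrite (eq_bigr (fun a => A (chi (r i a) *: (q a + vmulX a (w i))))); last first.
    by move=> a _; rewrite (oplinZ A_lin) (oplinD A_lin) scalerDr.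
  rewrite -(oplin_sum A_lin); apply: (comp_op_slot_class0 _ hext hgood).
  rewrite linear_sum /=.
  under eq_bigr do rewrite linearZ linearD /= hq -qmulXE hw.
  apply: (locally_const_sum (G := inner r i G)) => [a b|a].
    by rewrite adjacent_inner; apply: chi_adj.
  by rewrite big_split /= (pcl_sesqui (hg i)) addNr.
rewrite (sum_blocks hb) (eq_bigr _ (fun i _ => block i)) sumrN; congr (- _).
rewrite -(sum_blocks hb _ (fun k' => chi k' *: ev (opT d r (@qmul N) (ext r blk G) k' phi) w)).
pose B x := ev x w.
have B_lin (c : F) x y : B (c *: x + y) = c *: B x + B y by apply: BP.
rewrite (eq_bigr (fun k' => B (chi k' *: opT d r (@qmul N) (ext r blk G) k' phi))); last first.
  by move=> k' _; rewrite (oplinZ B_lin).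
rewrite -(oplin_sum B_lin) sum_opT hgood.2 ?addr0; last first.
  apply: (locally_const_outer hb) => x y hxy nxy.
  have := coboundary_sum hext chi hxy nxy.
  by rewrite (chi_adj _ _ hxy) => /addIr.
rewrite (oplin_sum B_lin); apply: eq_bigr => k' _.
by rewrite (oplinZ B_lin) /B opLE.
Qed.

End RawComposition.

(** * Merging variables, and the cycle relations *)

Section PullbackSubstitution.
Variables (F : fieldType) (V : lmodType F) (d : {linear V -> V}).

(** A map h of index sets acts contravariantly on polynomials. Collapsing blocks, permuting and
    merging variables are all of this kind, and composites of substitutions become composites of
    maps. *)
Definition pb_var n N (h : 'I_N -> 'I_n) (c : 'I_n) : spoly F 'I_N :=
  \sum_(y | h y == c) svar F y.

Definition pb_seq n N (h : 'I_N -> 'I_n) (c : 'I_n) : seq 'I_N :=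
  [seq y <- enum 'I_N | h y == c].

Lemma pb_varE n N (h : 'I_N -> 'I_n) c :
  pb_var h c = \sum_(y <- pb_seq h c) svar F y.
Proof. by rewrite /pb_seq big_filter big_enum_cond. Qed.

Lemma pb_seq_big n N (h : 'I_N -> 'I_n) (A : nmodType) (E : 'I_N -> A) c :
  \sum_(y <- pb_seq h c) E y = \sum_(y | h y == c) E y.
Proof. by rewrite /pb_seq big_filter big_enum_cond. Qed.

Lemma pb_seq_sum n N (h : 'I_N -> 'I_n) (A : lmodType F) (E : 'I_N -> A) :
  \sum_i \sum_(y <- pb_seq h i) E y = \sum_y E y.
Proof.
rewrite [RHS](partition_big h xpredT) //=.
by apply: eq_bigr => i _; rewrite pb_seq_big.
Qed.

Definition pb n N (h : 'I_N -> 'I_n) : Vlam d n -> Vlam d N := qsubst (pb_var h).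

Lemma pbE n N (h : 'I_N -> 'I_n) p :
  pb h (lclass d p) = lclass d (vsubst (pb_var h) p).
Proof. exact: (qsubstE d (pb_varE h) (pb_seq_sum h)). Qed.

Lemma pb_linear n N (h : 'I_N -> 'I_n) : linear (pb h).
Proof. exact: (qsubst_linear (pb_varE h) (pb_seq_sum h)). Qed.

HB.instance Definition _ n N (h : 'I_N -> 'I_n) :=
  GRing.isLinear.Build F (Vlam d n) (Vlam d N) *:%R (pb h) (pb_linear h).

Lemma vsubst_pb_mulX n N (h : 'I_N -> 'I_n) i (p : vpoly V 'I_n) :
  vsubst (pb_var h) (vmulX i p)
  = \sum_(y | h y == i) vmulX y (vsubst (pb_var h) p).
Proof. by rewrite (vsubst_mulX (pb_varE h)) pb_seq_big. Qed.

Lemma pb_mulX n N (h : 'I_N -> 'I_n) i (x : Vlam d n) :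
  pb h (qmulX i x) = \sum_(y | h y == i) qmulX y (pb h x).
Proof. by rewrite /pb (qsubst_mulX (pb_varE h) (pb_seq_sum h)) pb_seq_big. Qed.

Lemma vsubst_pb_comp n N K (h : 'I_N -> 'I_n) (h' : 'I_K -> 'I_N)
    (p : vpoly V 'I_n) :
  vsubst (pb_var h') (vsubst (pb_var h) p) = vsubst (pb_var (h \o h')) p.
Proof.
pose A q := vsubst (pb_var h') (vsubst (pb_var h) q) : vpoly V 'I_K.
apply: (vsubst_unique (pb_varE (h \o h')) (A := A)); rewrite /A.
- by rewrite !raddf0.
- by move=> q q'; rewrite !raddfD.
- by move=> v; rewrite !vsubst_const.
move=> i q; rewrite vsubst_pb_mulX raddf_sum /= pb_seq_big.
under eq_bigr do rewrite vsubst_pb_mulX.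
rewrite [RHS](partition_big h' (fun y => h y == i)) //=.
apply: eq_bigr => y /eqP <-; apply: eq_bigl => z.
by apply/eqP/andP => [->|[_ /eqP]] //; rewrite !eqxx.
Qed.

Lemma pb_comp n N K (h : 'I_N -> 'I_n) (h' : 'I_K -> 'I_N) x :
  pb h' (pb h x) = pb (h \o h') x.
Proof. by rewrite -(lclass_crepr x) !pbE vsubst_pb_comp. Qed.

Lemma vsubst_pb_id n (p : vpoly V 'I_n) : vsubst (pb_var id) p = p.
Proof.
apply/esym; apply: (vsubst_unique (pb_varE id) (A := id)) => //= i q.
by rewrite pb_seq_big big_pred1_eq.
Qed.

Lemma pb_id n (x : Vlam d n) : pb id x = x.
Proof. by rewrite -(lclass_crepr x) pbE vsubst_pb_id. Qed.

End PullbackSubstitution.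

(** * Merging two variables by Taylor's formula *)

Section Taylor.
Variables (F : fieldType) (V : lmodType F) (d : {linear V -> V}).
Hypothesis char0 : [pchar F] =i pred0.
Variables (k : nat) (a b : 'I_k).
Hypothesis nab : a != b.
Implicit Type p : vpoly V 'I_k.

(** Substitution along this map sends lambda_a to lambda_a + lambda_b and lambda_b to 0, since b is
    no longer attained. *)
Definition merge_map (y : 'I_k) : 'I_k := if y == b then a else y.

Definition dderiv p : vpoly V 'I_k := vderiv a p - vderiv b p.

(* Taylor expansion of p(mu_a + mu_b, mu_b - mu_b). *)
Definition taylor S p : vpoly V 'I_k :=
  \sum_(s < S) (s`!%:R)^-1 *: iter s (vmulX b) (iter s dderiv p).

Lemma dderiv_linear : linear dderiv.
Proof.
move=> c x y; rewrite /dderiv (linearP (vderiv a)) (linearP (vderiv b)) /=.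
by rewrite scalerBr opprD addrACA.
Qed.

HB.instance Definition _ :=
  GRing.isLinear.Build F (vpoly V 'I_k) (vpoly V 'I_k) *:%R dderiv dderiv_linear.

Lemma dderiv_mulX i p :
  dderiv (vmulX i p) = vmulX i (dderiv p) + ((a == i)%:R - (b == i)%:R) *: p.
Proof.
rewrite /dderiv !vderiv_mulX raddfB /= scalerBl !scaler_nat.
by rewrite opprD addrACA.
Qed.

Lemma iter_dderiv_mulX i s p :
  iter s.+1 dderiv (vmulX i p)
  = vmulX i (iter s.+1 dderiv p)
    + (s.+1%:R * ((a == i)%:R - (b == i)%:R)) *: iter s dderiv p.
Proof.
elim: s => [|s IH]; first by rewrite /= dderiv_mulX mul1r.
rewrite [LHS]iterS IH raddfD /= dderiv_mulX linearZ /= -addrA -scalerDl.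
by congr (_ + _ *: _); rewrite [in RHS]mulrS mulrDl mul1r.
Qed.

Lemma iter_mulX_linear s : linear (iter s (vmulX b) : vpoly V 'I_k -> vpoly V 'I_k).
Proof. by elim: s => // s IH c x y; rewrite /= IH linearP. Qed.

Lemma iter_mulXC i s p :
  iter s (vmulX b) (vmulX i p) = vmulX i (iter s (vmulX b) p).
Proof. by elim: s => //= s ->; rewrite vmulXC. Qed.

Lemma taylorS S p :
  taylor S.+1 p
  = p + \sum_(s < S) (s.+1`!%:R)^-1 *: iter s.+1 (vmulX b) (iter s.+1 dderiv p).
Proof. by rewrite /taylor big_ord_recl fact0 invr1 scale1r. Qed.

(** Commuting the (s+1)-st power of [dderiv] past lambda_i produces the factor s+1, which turns
    1/(s+1)! into 1/s!; the cancellation needs characteristic 0. The power of [dderiv] drops by one,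
    hence the truncation at S in the second term. *)
Lemma taylor_mulX S i p :
  taylor S.+1 (vmulX i p)
  = vmulX i (taylor S.+1 p)
    + ((a == i)%:R - (b == i)%:R) *: vmulX b (taylor S p).
Proof.
rewrite !taylorS (oplinD (vmulX_linear i)) -addrA; congr (_ + _).
rewrite /taylor !(oplin_sum (vmulX_linear _)) scaler_sumr.
rewrite -big_split; apply: eq_bigr => s _.
rewrite iter_dderiv_mulX (oplinD (iter_mulX_linear _)) (oplinZ (iter_mulX_linear _)).
rewrite iter_mulXC scalerDr !(oplinZ (vmulX_linear _)); congr (_ + _).
rewrite !scalerA; congr (_ *: _).
rewrite factS natrM invfM mulrACA mulVf ?mul1r 1?mulrC //.
by rewrite (pcharf0P F).1.
Qed.

(** The series stabilizes on every polynomial, and the bound grows by one with each factor; an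
    unspecified bound avoids any computation of degrees. *)
Lemma taylorE p :
  exists S0, forall S, (S0 <= S)%N -> taylor S p = vsubst (pb_var F merge_map) p.
Proof.
have T_lin S : linear (taylor S).
  move=> c x y; rewrite /taylor scaler_sumr -big_split; apply: eq_bigr => s _ /=.
  have -> : iter s dderiv (c *: x + y) = c *: iter s dderiv x + iter s dderiv y.
    by elim: (s : nat) => //= s' ->; rewrite linearP.
  by rewrite iter_mulX_linear scalerDr !scalerA mulrC.
elim/vpoly_mulX_ind: p => [|p q [S0 h0] [S1 h1]|v|i p [S0 h0]].
- by exists 0%N => S _; rewrite (oplin0 (T_lin S)) raddf0.
- exists (maxn S0 S1) => S; rewrite geq_max => /andP[hS0 hS1].
  by rewrite (oplinD (T_lin S)) raddfD /= h0 ?h1.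
- exists 1%N => -[//|S] _; rewrite vsubst_const taylorS big1 ?addr0 // => s _.
  have -> : iter s.+1 dderiv (vconst 'I_k v) = 0.
    elim: (s : nat) => [|s' IH]; last by rewrite iterS IH (oplin0 dderiv_linear).
    by rewrite /= /dderiv !vderiv_const subrr.
  by rewrite (oplin0 (iter_mulX_linear _)) scaler0.
exists S0.+1 => -[//|S]; rewrite ltnS => hS.
rewrite taylor_mulX !h0 //; last exact: leq_trans hS _.
rewrite vsubst_pb_mulX /merge_map.
have [->|nib] := eqVneq i b.
  rewrite (negPf nab) sub0r -[true%:R]/(1 : F) scaleN1r subrr big_pred0 // => y.
  by case: (eqVneq y b) => [_|/negPf -> //]; rewrite (negPf nab).
have [->|nia] := eqVneq a i.
  rewrite -[true%:R]/(1 : F) -[false%:R]/(0 : F) subr0 scale1r.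
  rewrite (bigD1 i) /=; last by rewrite (negPf nib) eqxx.
  rewrite (bigD1 b) /=; last by rewrite !eqxx eq_sym.
  rewrite big1 ?addr0 // => y /andP[/andP[]]; case: (eqVneq y b) => // _ /eqP ->.
  by rewrite eqxx.
rewrite subrr scale0r addr0 (bigD1 i) /=; last by rewrite (negPf nib) eqxx.
rewrite big1 ?addr0 // => y /andP[]; case: (eqVneq y b) => [_|_ /eqP ->].
  by rewrite (negPf nia).
by rewrite eqxx.
Qed.

Lemma dlam_dderiv p : dderiv (dlam d p) = dlam d (dderiv p).
Proof.
rewrite /dderiv !dlam_deriv (oplinB (@dlam_linear F V d k)) opprD addrACA subrr addr0.
by [].
Qed.

(** If [dderiv p] is [dlam d q], then every term of positive order of the Taylor expansion lies in
    the image of [dlam], because [dlam] commutes with [dderiv] and with multiplication by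
    lambda_b. *)
Lemma pb_merge (x : Vlam d k) : qderivB a b x = 0 -> pb merge_map x = x.
Proof.
rewrite -(lclass_crepr x) qderivBE pbE; set p := crepr x.
rewrite -(linear0 (@lclass F V d k)) => /eqP/lclassP[q]; rewrite subr0 => hq.
have [S0 hS] := taylorE p; rewrite -(hS S0.+1) // taylorS.
apply/eqP/lclassP; rewrite [p + _]addrC addrK.
exists (\sum_(i < S0) (i.+1`!%:R)^-1 *: iter i.+1 (vmulX b) (iter i dderiv q)).
rewrite (oplin_sum (@dlam_linear F V d k)); apply: eq_bigr => s _.
rewrite (oplinZ (@dlam_linear F V d k)); congr (_ *: _).
rewrite !iterS dlam_mulX; congr (vmulX b _); rewrite -iterS iterSr.
have -> t y : dlam d (iter t (vmulX b) y) = iter t (vmulX b) (dlam d y).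
  by elim: t => //= t IH; rewrite dlam_mulX IH.
congr (iter _ _ _); rewrite [dderiv p]hq.
by elim: (s : nat) => //= t ->; rewrite dlam_dderiv.
Qed.

End Taylor.

Section Roots.
Variables (F : fieldType) (V : lmodType F) (d : {linear V -> V}).
Hypothesis char0 : [pchar F] =i pred0.
Variables (k : nat) (H : graph k).

(* Substituting along [root_map] sends every variable other than the root of its
   component to 0, and the root to the sum of the component. *)
Definition root_map : 'I_k -> 'I_k := fingraph.root (adjacent H).

Lemma pb_root (x : Vlam d k) :
  (forall i j, j \in component H i -> qderivB i j x = 0) -> pb root_map x = x.
Proof.
(* The vertices are merged with their roots one at a time; B lists those already moved. *)
move=> hx; pose hB (B : seq 'I_k) y := if y \in B then root_map y else y.
have -> : root_map = hB (enum 'I_k).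
  by apply/funext => y; rewrite /hB mem_enum.
elim: (enum 'I_k) => [|z B IH]; first exact: pb_id.
have [hz|nz] := eqVneq (root_map z) z.
  have -> : hB (z :: B) = hB B; last by [].
  by apply/funext => y; rewrite /hB inE; case: eqVneq => [->|//]; rewrite hz if_same.
have hsym := connect_adjacent_sym H.
have root2 y : root_map (root_map y) = root_map y by apply: fingraph.root_root.
(* Merging z after the vertices of B affects z alone: no other vertex is sent to z, since z is not a
   root. *)
have -> : hB (z :: B) = merge_map (root_map z) z \o hB B.
  apply/funext => y; rewrite /hB /merge_map /= inE.
  have [->|nyz] /= := eqVneq y z.
    by case: (z \in B); rewrite ?eqxx // (negPf nz).
  case: ifP => [_|_]; last by rewrite (negPf nyz).
  by case: eqP => // e; rewrite -e root2 e eqxx in nz.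
rewrite -pb_comp pb_merge // hx // inE hsym.
exact: connect_root.
Qed.

End Roots.

(** * The cycle relations for a composition *)

Section CycleRelation.
Variables (F : fieldType) (V : lmodType F) (d : {linear V -> V}).
Hypothesis char0 : [pchar F] =i pred0.
Variables (n : nat) (m : 'I_n -> nat) (N : nat).
Variables (r : forall i, 'I_(m i) -> 'I_N) (blk : 'I_N -> 'I_n).
Arguments r : clear implicits.
Hypothesis hb : blocks r blk.
Implicit Type G : graph N.
Local Notation opT := (opT d r (@qmul F V d N)).
Local Notation eval_op := (eval_op d r (@qmul F V d N)).
Local Notation good := (good d r (@qmul F V d N)).

Lemma sum_scaleB_eq (A : lmodType F) (I : finType) (u u' : I -> F) (X : I -> A) :
  \sum_j (u j - u' j) *: X j = 0 -> \sum_j u j *: X j = \sum_j u' j *: X j.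
Proof. by under eq_bigr do rewrite scalerBl; rewrite sumrB => /subr0_eq. Qed.

Lemma adjacent_del_edge k (G : graph k) e x y :
  adjacent (del_edge G e) x y -> adjacent G x y.
Proof.
rewrite /adjacent !mult_del_edge => /orP[] h; apply/orP; [left|right];
  exact: leq_trans h (leq_subr _ _).
Qed.

Lemma coboundary_del_edge G e psi :
  coboundary blk G psi -> coboundary blk (del_edge G e) psi.
Proof. by move=> h k l /adjacent_del_edge; apply: h. Qed.

(** After substitution along h, every factor that is absorbed is a sum of T_a over a fibre of h, so
    it suffices that psi and psi' give the same sums over fibres. *)
Lemma eval_op_pb_eq (h : forall i, 'I_(m i) -> 'I_(m i)) (H : graph n)
    psi psi' phi (w : forall i, vpoly V 'I_(m i)) :
  (forall phi i c, good H phi ->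
     \sum_(a | h i a == c) opT psi (r i a) phi
     = \sum_(a | h i a == c) opT psi' (r i a) phi) ->
  good H phi ->
  eval_op psi phi (fun i => vsubst (pb_var F (h i)) (w i))
  = eval_op psi' phi (fun i => vsubst (pb_var F (h i)) (w i)).
Proof.
move=> hsum; elim/vpolys_ind: w phi => [w i|w i p q hp hq|w i p c hp|v] phi hphi.
- rewrite (dfwith_comp (fun i => vsubst (pb_var F (h i)))) raddf0.
  by rewrite !(eval_op_slot0 _ _ (@qmulC _ _ _ _) _ _ _ hphi.1).
- move: (hp _ hphi) (hq _ hphi); rewrite !(dfwith_comp (fun i => vsubst (pb_var F (h i)))).
  by rewrite raddfD /= !(eval_op_slotD _ _ (@qmulC _ _ _ _) _ _ _ _ hphi.1) => -> ->.
- move: (hp); rewrite !(dfwith_comp (fun i => vsubst (pb_var F (h i)))) vsubst_pb_mulX => hp'.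
  set w' := (fun j => vsubst (pb_var F (h j)) (w j)) in hp' *; set p' := vsubst _ p in hp' *.
  have E psi0 : eval_op psi0 phi (dfwith w' (\sum_(y | h i y == c) vmulX y p'))
      = eval_op psi0 (\sum_(y | h i y == c) opT psi0 (r i y) phi) (dfwith w' p').
    pose A (x : vpoly V 'I_(m i)) := eval_op psi0 phi (dfwith w' x).
    have AP (e : F) x y : A (e *: x + y) = e *: A x + A y.
      exact: (eval_op_slot_linear _ _ (@qmulC _ _ _ _) _ _ _ _ _ hphi.1).
    pose B x := eval_op psi0 x (dfwith w' p').
    have BP (e : F) x y : B (e *: x + y) = e *: B x + B y.
      exact: (eval_op_linear _ _ (@qmulC _ _ _ _)).
    rewrite -/(A _) -/(B _) -[X in A X]big_filter -[X in B X]big_filter.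
    rewrite (oplin_sum AP) (oplin_sum BP).
    apply: eq_bigr => y _.
    exact: (eval_op_mulX _ _ (@qmulC _ _ _ _) _ _ _ _ hphi.1).
  rewrite (E psi) (E psi') -(hsum phi i c hphi); apply: hp'.
  rewrite -big_filter; elim: [seq y <- _ | _] => [|y s IH].
    rewrite big_nil; split=> [|chi _]; first exact: multilinear_zero.
    by rewrite big1 // => j _; rewrite (oplin0 (opX_linear _ _ _ j)) scaler0.
  rewrite big_cons -[opT _ _ _]scale1r; apply: good_linear => //.
  exact: (good_T (@qmulC _ _ _ _)).
rewrite (functional_extensionality_dep (fun i => vsubst_const (pb_var F (h i)) (v i))).
by rewrite !(eval_op_const _ _ (@qmulC _ _ _ _) _ _ hphi.1).
Qed.

(* Along a cycle the differences of a vertex function sum to zero, so the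
   coboundary condition at the removed edge follows from that at the others. *)
Lemma coboundary_cycle G psi (kappa : 'I_N -> F) C e :
  oriented_cycle G C -> e \in C -> coboundary blk (del_edge G e) psi ->
  (forall x y, adjacent G x y -> blk x = blk y -> kappa x = kappa y) ->
  forall k l, adjacent G k l -> blk k != blk l ->
  \sum_a kappa a * (psi a (blk k))%:R + kappa k
  = \sum_a kappa a * (psi a (blk l))%:R + kappa l.
Proof.
move=> [_ [i0 hC]] heC hpsi hk; pose U x := \sum_a kappa a * (psi a (blk x))%:R + kappa x.
have hU x y : adjacent (del_edge G e) x y -> U x = U y.
  move=> hxy; have [exy|nxy] := eqVneq (blk x) (blk y).
    by rewrite /U exy (hk x y) //; apply: adjacent_del_edge hxy.
  exact: (coboundary_sum hpsi kappa hxy nxy).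
have hmult x y : (0 < mult G (x, y))%N -> e != (x, y) -> U x = U y.
  move=> hxy ne; apply: hU; rewrite /adjacent mult_del_edge (negPf ne) subn0.
  by rewrite hxy.
have tele (s : seq ('I_N * 'I_N)) i j : walk i [seq (t, true) | t <- s] j ->
    \sum_(t <- s) (U t.2 - U t.1) = U j - U i.
  elim: s i => [|t s IH] i /=; first by move=> /eqP ->; rewrite big_nil subrr.
  move=> /andP[/eqP hs /IH]; rewrite big_cons /step_src /step_tgt /= in hs * => ->.
  by rewrite -hs addrC addrA subrK.
have hUe : U e.1 = U e.2.
  have := tele _ _ _ (andP hC).1; rewrite subrr.
  have hin t : t \in C -> (0 < mult G t)%N.
    move=> ht; have /forallP/(_ t) := (andP hC).2; apply: leq_trans.
    by rewrite /unzip1 -map_comp map_id -has_count; apply/hasP; exists t => /=.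
  (* Only the occurrences of e in the telescoping sum survive, which leaves their number times the
     difference at e. The cycle may use parallel copies of e, so this number can exceed 1; it is
     nonzero in F by characteristic 0. *)
  rewrite big_seq (eq_bigr (fun t => (t == e)%:R * (U e.2 - U e.1))); last first.
    move=> [x y] /hin hxy; case: (eqVneq (x, y) e) => [<-|ne]; first by rewrite mul1r.
    by rewrite mul0r (hmult x y) ?subrr // eq_sym.
  have cnt (s : seq ('I_N * 'I_N)) :
      \sum_(t <- s) (t == e)%:R = (count_mem e s)%:R :> F.
    by elim: s => [|t s IH]; rewrite ?big_nil // big_cons IH /= natrD.
  rewrite -big_seq -mulr_suml cnt => /eqP.
  rewrite mulf_eq0 (pcharf0P F).1 // => /orP[|]; last by rewrite subr_eq0 => /eqP ->.
  by rewrite -leqn0 leqNgt -has_count; move/hasPn/(_ _ heC); rewrite /= eqxx.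
have hall x y : (0 < mult G (x, y))%N -> U x = U y.
  by move=> hxy; have [e1|ne] := eqVneq e (x, y); [move: hUe; rewrite e1|apply: hmult].
by move=> k l /orP[] /hall // h _; rewrite -/(U k) h.
Qed.

Variables (f : rawop d n) (g : forall i, rawop d (m i)).
Arguments g : clear implicits.
Hypotheses (hf : is_pcl f) (hg : forall i, is_pcl (g i)).

(** The right-hand side depends on e only through the outer graph: psi belongs to the fixed e0, and
    the representatives to G, whose inner graphs survive the deletion of e. They may be replaced by
    their substitutions along the root maps, after which only the sums of the T_a over inner
    components matter. For such sums the weight is constant along inner edges, so [coboundary_cycle]
    handles psi and [coboundary_sum] handles [ext]. *)
Lemma comp_op_del_crossing G C v e0 e psi :
  oriented_cycle G C -> e0 \in C -> e \in C ->
  coboundary blk (del_edge G e0) psi ->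
  blk e.1 != blk e.2 ->
  comp_op r blk f g (del_edge G e) v
  = eval_op psi (pull r (f (outer r (del_edge G e))))
      (fun i => vsubst (pb_var F (root_map (inner r i G)))
                 (crepr (g i (inner r i G) (fun a => v (r i a))))).
Proof.
move=> hC he0 he hpsi0 ne.
have [hG|hG] := pselect (acyclic (outer r (del_edge G e))); last first.
  rewrite comp_op_nacyclic //.
  have -> : pull r (f (outer r (del_edge G e))) = 0.
    apply/funext => u; rewrite /pull (pcl_acyclic hf) //.
    exact: (oplin0 (qsubst_block_linear hb)).
  set w := fun _ => _.
  pose B x := eval_op psi x w.
  have BP (c : F) x y : B (c *: x + y) = c *: B x + B y.
    exact: (eval_op_linear _ _ (@qmulC _ _ _ _)).
  exact/esym/(oplin0 BP).
have hext := ext_coboundary hb hG.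
rewrite (comp_opE hb hf hG hext (w := (fun i => vsubst (pb_var F (root_map (inner r i G)))
                 (crepr (g i (inner r i G) (fun a => v (r i a))))))); last first.
  move=> i; rewrite -pbE lclass_crepr.
  have -> : inner r i (del_edge G e) = inner r i G.
    case: (e) ne => x y /= nxy; apply: (inner_del_other hb).
    by case: (eqVneq (blk x) i) => [ex|]; [right; rewrite -ex eq_sym|left].
  by rewrite (pb_root char0 (H := inner r i G)) // => a b; apply: (pcl_deriv (hg i)).
have hgood := pull_good hb (outer r (del_edge G e)) hf.
apply: (@eval_op_pb_eq (fun i => root_map (inner r i G)) _ _ _ _
  (fun i => crepr (g i (inner r i G) (fun a => v (r i a)))) _ hgood).
move=> phi i c hphi.
(* The indicator, among all vertices of Gamma, of the vertices of block i with root c. *)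
pose kappa x : F := [exists a : 'I_(m i), (r i a == x) && (root_map (inner r i G) a == c)]%:R.
have hkappa a : kappa (r i a) = (root_map (inner r i G) a == c)%:R.
  rewrite /kappa; congr (_%:R); congr nat_of_bool; apply/existsP/idP.
    by move=> [a' /andP[/eqP/(blocks_inj hb) ->]].
  by move=> h; exists a; rewrite eqxx.
have kappa_other x : blk x != i -> kappa x = 0.
  move=> hx; rewrite /kappa; case: existsP => // -[a /andP[/eqP e1 _]].
  by rewrite -e1 (blocksK hb) eqxx in hx.
have hsum psi0 : \sum_(a | root_map (inner r i G) a == c) opT psi0 (r i a) phi
    = \sum_x kappa x *: opT psi0 x phi.
  rewrite (sum_blocks hb) [RHS](bigD1 i) //= [X in _ + X]big1 ?addr0; last first.
    move=> j nj; rewrite big1 // => a _; rewrite kappa_other ?scale0r //.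
    by rewrite (blocksK hb).
  rewrite big_mkcond; apply: eq_bigr => a _; rewrite hkappa.
  by case: ifP => _; rewrite ?scale1r ?scale0r.
have kappa_inner x y : adjacent G x y -> blk x = blk y -> kappa x = kappa y.
  have [a ha] := blocks_surj hb x; have [b hb'] := blocks_surj hb y.
  move=> hxy exy; have [ex|nx] := eqVneq (blk x) i; last first.
    by rewrite !kappa_other // -exy.
  move: a b ha hb'; rewrite -exy ex => a b ha hb'; rewrite -ha -hb' !hkappa.
  have -> // : root_map (inner r i G) a = root_map (inner r i G) b.
  apply/eqP; rewrite /root_map fingraph.root_connect.
    by apply: connect1; rewrite adjacent_inner ha hb'.
  exact: connect_adjacent_sym.
rewrite (hsum (ext r blk (del_edge G e))) (hsum psi).
have S psi0 := sum_opT d r (@qmul F V d N) psi0 kappa phi.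
refine (etrans (S _) (etrans (congr1 (+%R _) _) (esym (S psi)))).
apply: sum_scaleB_eq.
apply: hphi.2; apply: (locally_const_outer hb) => k l hkl nkl.
have h1 := coboundary_sum hext kappa hkl nkl.
have h2 := coboundary_cycle hC he0 hpsi0 kappa_inner (adjacent_del_edge hkl) nkl.
have aux (x y z : F) : x - y = (x + z) - (y + z).
  by rewrite opprD addrACA subrr addr0.
by rewrite (aux _ _ (kappa k)) [RHS](aux _ _ (kappa l)) h1 h2.
Qed.

(** If C stays in one block, its deletions share the outer graph, and the relation is that of the
    operation in this block. Otherwise C collapses to an oriented cycle [Co] of the outer graph.
    Deleting an edge inside a block leaves [Co] intact and gives zero; the remaining edges
    correspond to those of [Co], and the relation of f at [Co] is applied under one evaluation with
    shared psi and representatives. *)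
Lemma comp_op_cycle G C v : oriented_cycle G C ->
  \sum_(e <- C) comp_op r blk f g (del_edge G e) v = 0.
Proof.
move=> hC; have [C0 [k hCk]] := hC.
pose Co := [seq outer_edge blk e | e <- C & blk e.1 != blk e.2].
have hout := outer_trail hb hCk.
have eCo : outer_walk blk [seq (e, true) | e <- C] = [seq (e, true) | e <- Co].
  by rewrite /outer_walk /Co filter_map -!map_comp.
have [Co0|Con0] := eqVneq Co [::].
  have how : outer_walk blk [seq (e, true) | e <- C] = [::] by rewrite eCo Co0.
  have [a0 ha0] := blocks_surj hb k; set i := blk k in a0 ha0.
  have [w' [b [ew hw' hbk]]] := outer_walk_nil hb (andP hCk).1 how ha0.
  have eb : b = a0 by apply: (blocks_inj hb (i := i)); rewrite hbk ha0.
  pose C' := unzip1 w'.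
  have eC : C = [seq (r i e.1, r i e.2) | e <- C'].
    have := congr1 unzip1 ew; rewrite /unzip1 -!map_comp map_id => ->.
    by [].
  have ew' : w' = [seq (e, true) | e <- C'].
    have /(congr1 (map snd)) := ew; rewrite -!map_comp /C' /unzip1.
    elim: w' {hw' ew C' eC} (C) => [|[e b'] w' IH] [|e' C'] //= [<- h].
    by congr (_ :: _); apply: IH h.
  have hC' : oriented_cycle (inner r i G) C'.
    split; first by move=> e; apply: C0; rewrite eC e.
    exists a0; rewrite -ew'; move: hCk; rewrite ew -ha0 => hCk.
    by apply: (inner_trail hCk); rewrite -{2}eb.
  rewrite eC big_map.
  have eo e : outer r (del_edge G (r i e.1, r i e.2)) = outer r G.
    by apply: (outer_del_inner hb); rewrite !(blocksK hb).
  have [hG|hG] := pselect (acyclic (outer r G)); last first.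
    by rewrite big1 // => e _; rewrite comp_op_nacyclic ?eo.
  have hext := ext_coboundary hb hG.
  pose w j := crepr (g j (inner r j G) (fun a => v (r j a))).
  pose p e := crepr (g i (del_edge (inner r i G) e) (fun a => v (r i a))).
  have hgood := pull_good hb (outer r G) hf.
  pose A (x : vpoly V 'I_(m i)) := eval_op (ext r blk G) (pull r (f (outer r G))) (dfwith w x).
  have AP (c : F) x y : A (c *: x + y) = c *: A x + A y.
    exact: (eval_op_slot_linear _ _ (@qmulC _ _ _ _) _ _ _ _ _ hgood.1).
  rewrite (eq_bigr (fun e => A (p e))); last first.
    move=> e _; rewrite (comp_opE hb hf (psi := ext r blk G) (w := dfwith w (p e))) ?eo //.
      exact: coboundary_del_edge.
    move=> j; case: dfwithP => [|j' nj].
      by rewrite lclass_crepr (inner_del hb) -surjective_pairing.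
    rewrite lclass_crepr (inner_del_other hb) //.
    by left; rewrite (blocksK hb).
  rewrite -(oplin_sum AP); apply: (comp_op_slot_class0 hb _ hext hgood).
  rewrite linear_sum /=; under eq_bigr do rewrite lclass_crepr.
  exact: (pcl_cycle (hg i)).
have hCo : oriented_cycle (outer r G) Co.
  by split; [exact/eqP|exists (blk k); rewrite -eCo].
rewrite (bigID (fun e => blk e.1 != blk e.2)) /= [X in _ + X]big1_seq ?addr0; last first.
  move=> [x y] /andP[/negbNE/eqP /= exy _]; rewrite comp_op_nacyclic //.
  by rewrite (outer_del_inner hb) //; apply: oriented_cycle_nacyclic hCo.
(* The shared psi comes from an edge e0 whose deletion makes the outer graph acyclic; if there is
   none, all terms are zero. *)
have [/hasP[e0 he0 /andP[ne0 /asboolP hG0]]|/hasPn hno] := boolP (has (fun e =>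
    (blk e.1 != blk e.2) && `[< acyclic (outer r (del_edge G e)) >]) C); last first.
  rewrite big1_seq // => e /andP[ne he]; rewrite comp_op_nacyclic //.
  by move: (hno _ he); rewrite ne => /asboolP.
have hpsi := ext_coboundary hb hG0.
set w := fun i => vsubst (pb_var F (root_map (inner r i G)))
                 (crepr (g i (inner r i G) (fun a => v (r i a)))).
pose B x := eval_op (ext r blk (del_edge G e0)) x w.
have BP (c : F) x y : B (c *: x + y) = c *: B x + B y.
  exact: (eval_op_linear _ _ (@qmulC _ _ _ _)).
rewrite big_seq_cond (eq_bigr (fun e => B (pull r (f (outer r (del_edge G e)))))); last first.
  by move=> e /andP[he ne]; apply: (comp_op_del_crossing _ hC he0 he).
rewrite -big_seq_cond -big_filter -(oplin_sum BP) big_filter.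
rewrite [X in B X](_ : _ = 0) ?(oplin0 BP) //.
have qlin := @qsubst_block_linear F V d _ _ _ _ _ hb.
apply/funext => u; rewrite fct_sumE -big_filter big_seq.
pose E e := qsubst (block_var F r) (f (del_edge (outer r G) (outer_edge blk e)) u).
rewrite (eq_bigr E) => [|e].
  rewrite -big_seq /E -(oplin_sum qlin).
  by have := pcl_cycle hf u hCo; rewrite /Co big_map => ->; apply: (oplin0 qlin).
rewrite mem_filter => /andP[ne he]; rewrite /E -(outer_del_crossing hb) //.
have /forallP/(_ e) := (andP hCk).2; rewrite -surjective_pairing; apply: leq_trans.
by rewrite /unzip1 -map_comp map_id -has_count; apply/hasP; exists e => /=.
Qed.

Lemma comp_op_pcl : is_pcl (comp_op r blk f g).
Proof.
split.
- exact: comp_op_linear.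
- exact: comp_op_acyclic.
- exact: comp_op_cycle.
- exact: comp_op_deriv.
- exact: comp_op_sesqui.
Qed.

End CycleRelation.

(** * Associativity *)

Section BlockPullback.
Variables (F : fieldType) (V : lmodType F) (d : {linear V -> V}).
Variables (n : nat) (m : 'I_n -> nat) (N : nat).
Variables (r : forall i, 'I_(m i) -> 'I_N) (blk : 'I_N -> 'I_n).
Arguments r : clear implicits.
Hypothesis hb : blocks r blk.

Lemma block_var_pb : block_var F r = pb_var F blk.
Proof.
apply/funext => j; rewrite /block_var /pb_var [RHS]big_mkcond (sum_blocks hb) (bigD1 j) //=.
rewrite [X in _ + X]big1 ?addr0.
  by apply: eq_bigr => a _; rewrite (blocksK hb) eqxx.
by move=> i /negPf nij; rewrite big1 // => a _; rewrite (blocksK hb) nij.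
Qed.

Lemma pull_pb (f : ('I_n -> V) -> Vlam d n) u : pull r f u = pb blk (f u).
Proof. by rewrite /pull block_var_pb. Qed.

Lemma pb_mul_block i (x : Vlam d n) :
  pb blk (qmulX i x) = \sum_(a < m i) qmulX (r i a) (pb blk x).
Proof. by have := qsubst_block_mulX hb i x; rewrite block_var_pb. Qed.

Lemma vsubst_block_mulX i (p : vpoly V 'I_n) :
  vsubst (pb_var F blk) (vmulX i p)
  = \sum_(a < m i) vmulX (r i a) (vsubst (pb_var F blk) p).
Proof.
rewrite -block_var_pb (vsubst_mulX (block_varE F r)) /block_seq big_map.
by rewrite big_enum.
Qed.

Variables (f : rawop d n) (g : forall i, rawop d (m i)).
Arguments g : clear implicits.
Hypothesis hf : is_pcl f.

Lemma comp_op_slot0 G v i :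
  g i (inner r i G) (fun a => v (r i a)) = 0 -> comp_op r blk f g G v = 0.
Proof.
move=> hi; have [ho|] := pselect (acyclic (outer r G)); last exact: comp_op_nacyclic.
have hext := ext_coboundary hb ho.
pose w j := crepr (g j (inner r j G) (fun b => v (r j b))).
rewrite (comp_opE hb hf ho hext (w := w)); last by move=> j; rewrite lclass_crepr.
rewrite -(dfwith_id w i); apply: (comp_op_slot_class0 hb _ hext (pull_good hb _ hf)).
by rewrite lclass_crepr.
Qed.

Lemma comp_op_outer0 G v :
  (forall u, f (outer r G) u = 0) -> comp_op r blk f g G v = 0.
Proof.
move=> h; have [ho|] := pselect (acyclic (outer r G)); last exact: comp_op_nacyclic.
rewrite /comp_op asboolT //.
have -> : pull r (f (outer r G)) = 0.
  by apply/funext => u; rewrite /pull h (oplin0 (qsubst_block_linear hb)).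
set w := fun _ => _.
pose B x := eval_op d r (@qmul F V d N) (ext r blk G) x w.
have BP (c : F) x y : B (c *: x + y) = c *: B x + B y.
  exact: (eval_op_linear _ _ (@qmulC _ _ _ _)).
exact: (oplin0 BP).
Qed.

End BlockPullback.

Section ClassEval.
Variables (F : fieldType) (V : lmodType F) (d : {linear V -> V}).
Variables (n : nat) (m : 'I_n -> nat) (N : nat).
Variables (r : forall i, 'I_(m i) -> 'I_N) (blk : 'I_N -> 'I_n).
Arguments r : clear implicits.
Hypothesis hb : blocks r blk.
Variables (G : graph N) (psi : 'I_N -> 'I_n -> bool).
Hypothesis hpsi : coboundary blk G psi.
Local Notation good := (good d r (@qmul F V d N) (outer r G)).
Local Notation opT := (opT d r (@qmul F V d N)).
Local Notation opX := (opX d r (@qmul F V d N)).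
Implicit Type c : forall i, Vlam d (m i).

(** Evaluation at classes instead of polynomials. For nested compositions the argument in a slot is
    itself the value of a composition, for which no representative is distinguished. *)
Definition evc (phi : ('I_n -> V) -> Vlam d N) c : Vlam d N :=
  eval_op d r (@qmul F V d N) psi phi (fun i => crepr (c i)).

Lemma evcE phi w : good phi ->
  eval_op d r (@qmul F V d N) psi phi w = evc phi (fun i => lclass d (w i)).
Proof.
move=> hphi; apply: (eval_op_ext (@qmulC _ _ _ _) hb hpsi hphi) => i.
by rewrite lclass_crepr.
Qed.

Lemma evc_dfwith phi c i (p : vpoly V 'I_(m i)) : good phi ->
  evc phi (dfwith c (lclass d p))
  = eval_op d r (@qmul F V d N) psi phi (dfwith (fun j => crepr (c j)) p).
Proof.
move=> hphi; rewrite evcE // (dfwith_comp (fun j => @lclass F V d (m j))).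
have -> // : (fun j => lclass d (crepr (c j))) = c.
by apply: functional_extensionality_dep => j; rewrite lclass_crepr.
Qed.

Lemma evc_linear (a : F) phi phi' c :
  evc (a *: phi + phi') c = a *: evc phi c + evc phi' c.
Proof. exact: (eval_op_linear _ _ (@qmulC _ _ _ _)). Qed.

Lemma evc_slot_linear phi c i (a : F) (x y : Vlam d (m i)) : good phi ->
  evc phi (dfwith c (a *: x + y))
  = a *: evc phi (dfwith c x) + evc phi (dfwith c y).
Proof.
move=> hphi; rewrite -(lclass_crepr x) -(lclass_crepr y) -linearP !evc_dfwith //.
exact: (eval_op_slot_linear _ _ (@qmulC _ _ _ _) _ _ _ _ _ hphi.1).
Qed.

Lemma evc_mulX phi c i (a : 'I_(m i)) (x : Vlam d (m i)) : good phi ->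
  evc phi (dfwith c (qmulX a x)) = evc (opT psi (r i a) phi) (dfwith c x).
Proof.
move=> hphi; have hT := good_T (@qmulC _ _ _ _) psi (r i a) hphi.
rewrite -(lclass_crepr x) qmulXE !evc_dfwith //.
exact: (eval_op_mulX _ _ (@qmulC _ _ _ _) _ _ _ _ hphi.1).
Qed.

Lemma evc_opT phi c k : good phi ->
  evc (opT psi k phi) c
  = qmulX k (evc phi c) + \sum_j (psi k j)%:R *: evc (opX j phi) c.
Proof.
move=> hphi; pose B x := evc x c.
have BP (a : F) x y : B (a *: x + y) = a *: B x + B y by apply: evc_linear.
rewrite -/(B _) opTE (oplinD BP) (oplin_sum BP); congr (_ + _).
  exact/esym/(eval_op_L _ _ (@qmulC _ _ _ _) _ k _ hphi.1).
by apply: eq_bigr => j _; rewrite (oplinZ BP).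
Qed.

Lemma evc_locally_const phi c (chi : 'I_n -> F) : good phi ->
  locally_const (outer r G) chi ->
  \sum_j chi j *: evc (opX j phi) c = 0.
Proof.
move=> hphi hchi; pose B x := evc x c.
have BP (a : F) x y : B (a *: x + y) = a *: B x + B y by apply: evc_linear.
rewrite (eq_bigr (fun j => B (chi j *: opX j phi))) => [|j _].
  by rewrite -(oplin_sum BP) hphi.2 // (oplin0 BP).
by rewrite (oplinZ BP).
Qed.

End ClassEval.

Section NestedBlocks.
Variables (n : nat) (m : 'I_n -> nat) (M : nat).
Variables (rm : forall i, 'I_(m i) -> 'I_M) (bm : 'I_M -> 'I_n).
Variables (l : 'I_M -> nat) (K : nat).
Variables (rl : forall k, 'I_(l k) -> 'I_K) (bl : 'I_K -> 'I_M).
Arguments rm : clear implicits.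
Arguments rl : clear implicits.
Variables (N : 'I_n -> nat).
Variables (ri : forall i (j : 'I_(m i)), 'I_(l (rm i j)) -> 'I_(N i)).
Arguments ri : clear implicits.
Variables (bi : forall i, 'I_(N i) -> 'I_(m i)).
Arguments bi : clear implicits.
Variables (rN : forall i, 'I_(N i) -> 'I_K) (bN : 'I_K -> 'I_n).
Arguments rN : clear implicits.
Hypotheses (hm : blocks rm bm) (hl : blocks rl bl) (hN : blocks rN bN).
Hypothesis hi : forall i, blocks (ri i) (bi i).
Hypothesis compat : forall i j a, rN i (ri i j a) = rl (rm i j) a.

(** K vertices are grouped by [rl] into M blocks, which [rm] groups into n. Directly, [rN] groups
    the K vertices into n blocks of sizes [N i], and [ri i] subdivides the i-th of them; [compat]
    says that both routes reach the same vertex. *)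
Lemma nested_blk y : bN y = bm (bl y).
Proof.
elim/(blocks_ind hN): y => i c; rewrite (blocksK hN).
elim/(blocks_ind (hi i)): c => j a.
by rewrite compat (blocksK hl) (blocksK hm).
Qed.

Variable G : graph K.

Lemma outer_outer : outer rm (outer rl G) = outer rN G.
Proof.
apply: graphP => i i' nii; rewrite (mult_outerE hm) // (mult_outerE hN) //.
rewrite [RHS](partition_big (fun e => (bl e.1, bl e.2))
  (fun e => (bm e.1 == i) && (bm e.2 == i'))) /=; last first.
  by move=> e; rewrite !nested_blk.
apply: eq_bigr => -[k k'] /= /andP[/eqP hk /eqP hk'].
rewrite (mult_outerE hl); last by apply: contraNneq nii => e; rewrite -hk -hk' e.
apply: eq_bigl => -[x y]; rewrite /= !nested_blk xpair_eqE.
have [->|] := eqVneq (bl x) k; last by rewrite !andbF.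
by have [->|] := eqVneq (bl y) k'; rewrite ?andbF // hk hk' !eqxx.
Qed.

Lemma inner_outer i : inner rm i (outer rl G) = outer (ri i) (inner rN i G).
Proof.
apply: graphP => j j' nj; rewrite mult_inner !mult_outer //; last first.
  by rewrite (inj_eq (@blocks_inj _ _ _ _ _ hm i)).
by apply: eq_bigr => a _; apply: eq_bigr => b _; rewrite mult_inner !compat.
Qed.

Lemma inner_inner i j : inner (ri i) j (inner rN i G) = inner rl (rm i j) G.
Proof. by apply: graphP => a b _; rewrite !mult_inner !compat. Qed.

Section Values.
Variables (F : fieldType) (V : lmodType F) (d : {linear V -> V}).
Local Notation qm k := (@qmul F V d k).

Lemma opX_pb j phi u :
  pb bl (opX d rm (qm M) j phi u) = opX d rN (qm K) j (fun u => pb bl (phi u)) u.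
Proof.
rewrite /opX (oplinD (@pb_linear F V d _ _ bl)).
rewrite (oplin_sum (@pb_linear F V d _ _ bl)); congr (_ + _).
rewrite (sum_blocks (hi j)); apply: eq_bigr => b _.
rewrite [LHS](pb_mul_block hl); apply: eq_bigr => a _.
by rewrite compat.
Qed.

Lemma good_pb phi : good d rm (qm M) (outer rN G) phi ->
  good d rN (qm K) (outer rN G) (fun u => pb bl (phi u)).
Proof.
have plin := @pb_linear F V d _ _ bl.
move=> [h1 h2]; split=> [u i a x y|chi hchi]; first by rewrite h1 plin.
apply/funext => u; rewrite fct_sumE.
transitivity (pb bl ((\sum_j chi j *: opX d rm (qm M) j phi) u)).
  rewrite fct_sumE (oplin_sum plin); apply: eq_bigr => j _.
  rewrite -[RHS]/(pb bl (chi j *: opX d rm (qm M) j phi u)) (oplinZ plin) opX_pb.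
  by [].
by rewrite h2 //; apply: (oplin0 plin).
Qed.

Variables (psiN : 'I_K -> 'I_n -> bool) (psim : 'I_M -> 'I_n -> bool).
Hypothesis hpsiN : coboundary bN G psiN.
Hypothesis hpsim : coboundary bm (outer rl G) psim.

(** Both sides contain the lambda of all vertices in block k, so the difference is a combination of
    the X_j. Its weight is locally constant: the indicator of block k in [coboundary_sum] gives the
    same increment across a crossing edge as the coboundary condition of psim at k. *)
Lemma opT_pb k phi : good d rm (qm M) (outer rN G) phi ->
  (fun u => pb bl (opT d rm (qm M) psim k phi u))
  = \sum_(a < l k) opT d rN (qm K) psiN (rl k a) (fun u => pb bl (phi u)).
Proof.
move=> hphi; set phi' := fun u => pb bl (phi u).
have hphi' : good d rN (qm K) (outer rN G) phi' by apply: good_pb.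
have := sum_opT d rN (qm K) psiN (fun y => (bl y == k)%:R) phi'.
rewrite -(sum_in_block hl k (fun y => opT d rN (qm K) psiN y phi')) => ->.
rewrite -(sum_in_block hl k (fun y => opL (qm K) y phi')).
transitivity (\sum_(a < l k) opL (qm K) (rl k a) phi'
   + \sum_j (psim k j)%:R *: opX d rN (qm K) j phi').
  apply/funext => u; rewrite -[RHS]/((\sum_(a < l k) opL (qm K) (rl k a) phi') u
     + (\sum_j (psim k j)%:R *: opX d rN (qm K) j phi') u).
  rewrite !fct_sumE /opT (oplinD (@pb_linear F V d _ _ bl)).
  rewrite (oplin_sum (@pb_linear F V d _ _ bl)).
  congr (_ + _); first by rewrite [LHS](pb_mul_block hl).
  apply: eq_bigr => j _; rewrite (oplinZ (@pb_linear F V d _ _ bl)) opX_pb.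
  by [].
congr (_ + _); apply: sum_scaleB_eq; apply: hphi'.2.
apply: (locally_const_outer hN) => x y hxy nxy.
have nxy' : bl x != bl y by apply: contraNneq nxy; rewrite !nested_blk => ->.
have hout : adjacent (outer rl G) (bl x) (bl y).
  by apply/(adjacent_outerP hl); exists x, y.
have := coboundary_sum hpsiN (fun y => (bl y == k)%:R : F) hxy nxy.
have := hpsim hout; rewrite -!nested_blk => /(_ nxy k).
move=> /(congr1 (fun x : nat => x%:R : F)); rewrite !natrD.
rewrite ![k == _]eq_sym => e1 e2.
have aux (p q z : F) : p - q = (p + z) - (q + z).
  by rewrite opprD addrACA subrr addr0.
by rewrite (aux _ _ (bl x == k)%:R) [RHS](aux _ _ (bl y == k)%:R) e1 e2.
Qed.

Lemma pb_eval_op phi (y : forall i, vpoly V 'I_(m i)) :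
  good d rm (qm M) (outer rN G) phi ->
  pb bl (eval_op d rm (qm M) psim phi y)
  = eval_op d rN (qm K) psiN (fun u => pb bl (phi u))
      (fun i => vsubst (pb_var F (bi i)) (y i)).
Proof.
elim/vpolys_ind: y phi => [y i|y i p q hp hq|y i p j hp|v] phi hphi;
  have hphi' := good_pb hphi.
- rewrite (dfwith_comp (fun i => vsubst (pb_var F (bi i)))) raddf0.
  rewrite (eval_op_slot0 _ _ (@qmulC _ _ _ _) _ _ _ hphi.1).
  rewrite (eval_op_slot0 _ _ (@qmulC _ _ _ _) _ _ _ hphi'.1).
  by rewrite (oplin0 (@pb_linear F V d _ _ bl)).
- move: (hp _ hphi) (hq _ hphi); rewrite !(dfwith_comp (fun i => vsubst (pb_var F (bi i)))).
  rewrite (eval_op_slotD _ _ (@qmulC _ _ _ _) _ _ _ _ hphi.1).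
  rewrite (oplinD (@pb_linear F V d _ _ bl)) => -> ->.
  by rewrite raddfD /= (eval_op_slotD _ _ (@qmulC _ _ _ _) _ _ _ _ hphi'.1).
- rewrite (eval_op_mulX _ _ (@qmulC _ _ _ _) _ _ _ _ hphi.1).
  rewrite hp; last exact: (good_T (@qmulC _ _ _ _)).
  rewrite !(dfwith_comp (fun i => vsubst (pb_var F (bi i)))) (vsubst_block_mulX (hi i)).
  set y' := (fun j => vsubst (pb_var F (bi j)) (y j)); set p' := vsubst _ p.
  pose A (x : vpoly V 'I_(N i)) :=
    eval_op d rN (qm K) psiN (fun u => pb bl (phi u)) (dfwith y' x).
  have AP (e : F) x z : A (e *: x + z) = e *: A x + A z.
    exact: (eval_op_slot_linear _ _ (@qmulC _ _ _ _) _ _ _ _ _ hphi'.1).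
  pose B x := eval_op d rN (qm K) psiN x (dfwith y' p').
  have BP (e : F) x z : B (e *: x + z) = e *: B x + B z.
    exact: (eval_op_linear _ _ (@qmulC _ _ _ _)).
  rewrite -/(A _) -/(B _) (oplin_sum AP) opT_pb // (oplin_sum BP).
  apply: eq_bigr => a _; rewrite /A (eval_op_mulX _ _ (@qmulC _ _ _ _) _ _ _ _ hphi'.1).
  by rewrite compat.
rewrite (eval_op_const _ _ (@qmulC _ _ _ _) _ _ hphi.1).
rewrite (functional_extensionality_dep (fun i => vsubst_const (pb_var F (bi i)) (v i))).
by rewrite (eval_op_const _ _ (@qmulC _ _ _ _) _ _ hphi'.1).
Qed.

End Values.
End NestedBlocks.

Section Associativity.
Variables (F : fieldType) (V : lmodType F) (d : {linear V -> V}).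
Hypothesis char0 : [pchar F] =i pred0.
Variables (n : nat) (m : 'I_n -> nat) (M : nat).
Variables (rm : forall i, 'I_(m i) -> 'I_M) (bm : 'I_M -> 'I_n).
Variables (l : 'I_M -> nat) (K : nat).
Variables (rl : forall k, 'I_(l k) -> 'I_K) (bl : 'I_K -> 'I_M).
Arguments rm : clear implicits.
Arguments rl : clear implicits.
Variables (N : 'I_n -> nat).
Variables (ri : forall i (j : 'I_(m i)), 'I_(l (rm i j)) -> 'I_(N i)).
Arguments ri : clear implicits.
Variables (bi : forall i, 'I_(N i) -> 'I_(m i)).
Arguments bi : clear implicits.
Variables (rN : forall i, 'I_(N i) -> 'I_K) (bN : 'I_K -> 'I_n).
Arguments rN : clear implicits.
Hypotheses (hm : blocks rm bm) (hl : blocks rl bl) (hN : blocks rN bN).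
Hypothesis hi : forall i, blocks (ri i) (bi i).
Hypothesis compat : forall i j a, rN i (ri i j a) = rl (rm i j) a.
Local Notation qm k := (@qmul F V d k).

Section Nested.
Variable G : graph K.
Variables (psiN : 'I_K -> 'I_n -> bool) (psil : 'I_K -> 'I_M -> bool).
Variable psii : forall i, 'I_(N i) -> 'I_(m i) -> bool.
Arguments psii : clear implicits.
Hypothesis hpsiN : coboundary bN G psiN.
Hypothesis hpsil : coboundary bl G psil.
Hypothesis hpsii : forall i, coboundary (bi i) (inner rN i G) (psii i).

Local Notation ops i := (('I_(m i) -> V) -> Vlam d (N i)).
Local Notation goodN := (good d rN (qm K) (outer rN G)).
Local Notation goodi i :=
  (good d (ri i) (qm (N i)) (outer (ri i) (inner rN i G))).
Implicit Types (phi : ('I_n -> V) -> Vlam d K) (ps : forall i, ops i).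

(** Of its M arguments, those of part i go to the function [ps i], whose values are then fed to phi.
    For the functions coming from f and the g_i this is the pulled back outer function of (f g)
    h. *)
Definition nest phi ps : ('I_M -> V) -> Vlam d K :=
  fun u => evc rN psiN phi (fun i => ps i (fun j => u (rm i j))).

Lemma upd_block (u : 'I_M -> V) i (j : 'I_(m i)) x :
  (fun i' j' => upd u (rm i j) x (rm i' j'))
  = @dfwith _ (fun i => 'I_(m i) -> V) (fun i' j' => u (rm i' j')) i
      (upd (fun j => u (rm i j)) j x).
Proof.
apply: functional_extensionality_dep => i'.
have [e|nii] := eqVneq i i'.
  case: _ / e; rewrite dfwith_in; apply/funext => j'.
  by rewrite /upd (inj_eq (@blocks_inj _ _ _ _ _ hm i)).
rewrite dfwith_out //; apply/funext => j'; rewrite /upd.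
by case: eqP => // /(block_eq hm) e; rewrite e eqxx in nii.
Qed.

Lemma nest_upd phi ps u i (j : 'I_(m i)) x :
  nest phi ps (upd u (rm i j) x)
  = evc rN psiN phi (dfwith (fun i' => ps i' (fun j' => u (rm i' j')))
      (ps i (upd (fun j => u (rm i j)) j x))).
Proof.
rewrite /nest; congr (evc rN psiN phi _).
by rewrite -(dfwith_comp (W := fun i => 'I_(m i) -> V) (fun i' => ps i')) -upd_block.
Qed.

Lemma nest_multilinear phi ps :
  goodN phi -> (forall i, multilinear (ps i)) -> multilinear (nest phi ps).
Proof.
move=> hphi hps u k a x y; elim/(blocks_ind hm): k => i j.
by rewrite !nest_upd hps (evc_slot_linear hN hpsiN).
Qed.

(** The multiplicity with which the outer operator X_i' enters when the lambda of block k act inside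
    a slot of phi. *)
Definition nest_coef k (i' : 'I_n) : F := \sum_(a < l k) (psiN (rl k a) i')%:R.

(** An operator X_j acting inside slot i becomes the X of the middle vertex [rm i j], corrected by
    the outer operators that shift the lambda of its block. *)
Lemma nest_X phi ps u i (j : 'I_(m i)) : goodN phi ->
  let c := fun i' => ps i' (fun j' => u (rm i' j')) in
  evc rN psiN phi (dfwith c (opX d (ri i) (qm (N i)) j (ps i) (fun j => u (rm i j))))
  = opX d rl (qm K) (rm i j) (nest phi ps) u
    + \sum_i' nest_coef (rm i j) i' *: evc rN psiN (opX d rN (qm K) i' phi) c.
Proof.
move=> hphi c; pose A (x : Vlam d (N i)) := evc rN psiN phi (dfwith c x).
have AP (e : F) (x z : Vlam d (N i)) : A (e *: x + z) = e *: A x + A z.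
  exact: (evc_slot_linear hN hpsiN).
rewrite -/(A _) /opX (oplinD AP) (oplin_sum AP) nest_upd -/c -/(A _).
rewrite [RHS]addrAC; congr (_ + _).
rewrite (eq_bigr (fun a => qmulX (rl (rm i j) a) (nest phi ps u)
   + \sum_i' (psiN (rl (rm i j) a) i')%:R *: evc rN psiN (opX d rN (qm K) i' phi) c)).
  rewrite big_split exchange_big /=; congr (_ + _); apply: eq_bigr => i' _.
  by rewrite /nest_coef scaler_suml.
move=> a _; rewrite /A [LHS](evc_mulX hN hpsiN) // compat.
by rewrite -[ps i _]/(c i) (dfwith_id c) (evc_opT _ _ _ hphi).
Qed.

(** The heart of associativity: the two routes give one factor lambda_x the same meaning. On the
    left it is lambda_x, plus operators W inside slot i selected by [psii], plus outer operators Y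
    selected by [psiN]; on the right it is lambda_x plus the operators Z selected by [psil], where W
    is Z plus a combination of the Y. The coefficients of the W and then of the Y are matched up to
    locally constant weights. *)
Lemma nest_T phi ps i (j : 'I_(m i)) (a : 'I_(l (rm i j))) :
  goodN phi -> (forall i, goodi i (ps i)) ->
  nest phi (dfwith ps (opT d (ri i) (qm (N i)) (psii i) (ri i j a) (ps i)))
  = opT d rl (qm K) psil (rl (rm i j) a) (nest phi ps).
Proof.
move=> hphi hps; apply/funext => u.
pose c := fun i' => ps i' (fun j' => u (rm i' j')).
pose x := rl (rm i j) a.
have -> : nest phi (dfwith ps (opT d (ri i) (qm (N i)) (psii i) (ri i j a) (ps i))) u
   = evc rN psiN phi (dfwith c (opT d (ri i) (qm (N i)) (psii i) (ri i j a) (ps i)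
                                 (fun j => u (rm i j)))).
  by rewrite /nest (dfwith_comp (fun i' (p : ops i') => p (fun j' => u (rm i' j')))).
pose A i' x := evc rN psiN phi (dfwith c (x : Vlam d (N i'))).
have AP i' (e : F) y z : A i' (e *: y + z) = e *: A i' y + A i' z.
  exact: (evc_slot_linear hN hpsiN).
pose Y i' := evc rN psiN (opX d rN (qm K) i' phi) c.
pose Z k := opX d rl (qm K) k (nest phi ps) u.
pose W k := Z k + \sum_i' nest_coef k i' *: Y i'.
have WE i' (j' : 'I_(m i')) :
    A i' (opX d (ri i') (qm (N i')) j' (ps i') (fun j => u (rm i' j))) = W (rm i' j').
  exact: nest_X.
rewrite -/(A i _) {1}/opT (oplinD (AP i)) (oplin_sum (AP i)).
under eq_bigr do rewrite (oplinZ (AP i)) WE.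
have -> : A i (qm (N i) (ri i j a) (ps i (fun j => u (rm i j))))
    = qmulX x (nest phi ps u) + \sum_i' (psiN x i')%:R *: Y i'.
  rewrite /A [LHS](evc_mulX hN hpsiN) // compat -/x.
  by rewrite -[ps i _]/(c i) (dfwith_id c) (evc_opT _ _ _ hphi).
rewrite /opT -/x -addrA; congr (_ + _).
(* W sums to zero against functions that are constant along the inner edges,
   and Y against those that are constant along the outer ones *)
have W0 chi : (forall i', locally_const (outer (ri i') (inner rN i' G))
                                        (fun j' => chi (rm i' j'))) ->
    \sum_k chi k *: W k = 0.
  move=> hchi; rewrite (sum_blocks hm) big1 // => i' _.
  under eq_bigr do rewrite -WE -(oplinZ (AP i')).
  rewrite -(oplin_sum (AP i')).
  have /(congr1 (fun p : ops i' => p (fun j => u (rm i' j)))) := (hps i').2 _ (hchi i').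
  rewrite fct_sumE /= => E.
  rewrite [X in A i' X]E.
  exact: (oplin0 (AP i')).
have Y0 chi : locally_const (outer rN G) chi -> \sum_i' chi i' *: Y i' = 0.
  exact: (evc_locally_const _ _ hphi).
(* The coefficients given by [psii], extended by zero from part i to all M vertices. They differ
   from those of [psil x] by a weight constant along the edges inside each part, because both solve
   the coboundary condition there. *)
pose theta k : F := \sum_(j' < m i) (psii i (ri i j a) j')%:R * (rm i j' == k)%:R.
have thetaE j' : theta (rm i j') = (psii i (ri i j a) j')%:R.
  rewrite /theta (bigD1 j') //= eqxx mulr1 big1 ?addr0 // => j2 nj2.
  by rewrite (inj_eq (@blocks_inj _ _ _ _ _ hm i)) (negPf nj2) mulr0.
have theta0 k : bm k != i -> theta k = 0.
  move=> nk; rewrite /theta big1 // => j' _; case: eqP => [e|]; last by rewrite mulr0.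
  by rewrite -e (blocksK hm) eqxx in nk.
have -> : \sum_j' (psii i (ri i j a) j')%:R *: W (rm i j') = \sum_k theta k *: W k.
  rewrite [RHS](sum_blocks hm) [RHS](bigD1 i) //= [X in _ = _ + X]big1 ?addr0.
    by apply: eq_bigr => j' _; rewrite thetaE.
  move=> i' ni; rewrite big1 // => j' _; rewrite theta0 ?scale0r //.
  by rewrite (blocksK hm).
have -> : \sum_k theta k *: W k = \sum_k (psil x k)%:R *: W k.
  apply: sum_scaleB_eq; apply: W0 => i' j1 j2.
  move=> /(adjacent_outerP (hi i'))[y1 [y2 [hy e1 e2 n12]]].
  have [b1 hb1] := blocks_surj (hi i') y1; have [b2 hb2] := blocks_surj (hi i') y2.
  move: b1 b2 hb1 hb2; rewrite e1 e2 => b1 b2 hb1 hb2.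
  have hxy : adjacent G (rl (rm i' j1) b1) (rl (rm i' j2) b2).
    by move: hy; rewrite adjacent_inner -hb1 -hb2 !compat.
  have := hpsil hxy; rewrite !(blocksK hl).
  rewrite (inj_eq (@blocks_inj _ _ _ _ _ hm i')) => /(_ n12 x).
  have aux (p q z t : F) : p + z = q + t -> z = t -> p = q.
    by move=> e ez; move: e; rewrite ez => /addIr.
  have aux2 (p q p' q' z t : F) : p + z = q + t -> p' + z = q' + t ->
      p - p' = q - q'.
    move=> h1 h2; have -> : p - p' = (p + z) - (p' + z).
      by rewrite opprD addrACA subrr addr0.
    by rewrite h1 h2 opprD addrACA subrr addr0.
  move=> /(congr1 (fun x : nat => x%:R : F)); rewrite !natrD => h1.
  apply: (aux2 _ _ _ _ (x == rl (rm i' j1) b1)%:R (x == rl (rm i' j2) b2)%:R) => //.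
  have [eii|nii] := eqVneq i' i; last first.
    rewrite !theta0 ?(blocksK hm) // /x.
    have neq j3 b3 : (rl (rm i j) a == rl (rm i' j3) b3) = false.
      apply/eqP => /(congr1 bl); rewrite !(blocksK hl) => /(block_eq hm) e.
      by rewrite e eqxx in nii.
    by rewrite !neq.
  move: j1 j2 b1 b2 e1 e2 hb1 hb2 hxy n12 h1; case: _ / (esym eii) in y1 y2 hy *.
  move=> j1 j2 b1 b2 e1 e2 hb1 hb2 hxy n12 h1.
  rewrite !thetaE; have := hpsii hy; rewrite e1 e2 => /(_ n12 (ri i j a)).
  move=> /(congr1 (fun x : nat => x%:R : F)); rewrite !natrD -hb1 -hb2.
  have E j3 b3 : (x == rl (rm i j3) b3) = (ri i j a == ri i j3 b3).
    by rewrite /x -!compat (inj_eq (@blocks_inj _ _ _ _ _ hN i)).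
  by rewrite !E.
(* The total coefficient of Y i' once the W are expressed through the Z. It is the sum of kappa(y)
   psiN(y, i') for kappa(y) = delta_xy + psil(x, bl y). The coboundary condition of psil makes kappa
   equal at both ends of a crossing edge, so [coboundary_sum] shows c' to be locally constant. *)
pose c' i' : F := (psiN x i')%:R + \sum_k (psil x k)%:R * nest_coef k i'.
have hc : \sum_i' c' i' *: Y i' = 0.
  apply: Y0; apply: (locally_const_outer hN) => y1 y2 hy nN.
  have nl : bl y1 != bl y2.
    by apply: contraNneq nN; rewrite !(nested_blk hm hl hN hi compat) => ->.
  pose kappa y : F := (y == x)%:R + (psil x (bl y))%:R.
  have kE : kappa y1 = kappa y2.
    rewrite /kappa -!natrD; congr (_%:R); rewrite addnC [RHS]addnC.
    by have := hpsil hy nl x; rewrite ![x == _]eq_sym.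
  have c'E i' : c' i' = \sum_y kappa y * (psiN y i')%:R.
    rewrite /kappa; under eq_bigr do rewrite mulrDl.
    rewrite big_split /= (bigD1 x) //= eqxx mul1r big1 ?addr0; last first.
      by move=> y /negPf ->; rewrite mul0r.
    rewrite /c'; congr (_ + _); rewrite [RHS](sum_blocks hl).
    apply: eq_bigr => k _; rewrite /nest_coef mulr_sumr.
    by apply: eq_bigr => b _; rewrite (blocksK hl).
  have := coboundary_sum hpsiN kappa hy nN.
  by rewrite -!c'E kE => /addIr.
have -> : \sum_k (psil x k)%:R *: W k
    = \sum_k (psil x k)%:R *: Z k
      + \sum_i' (\sum_k (psil x k)%:R * nest_coef k i') *: Y i'.
  under eq_bigr do rewrite /W scalerDr scaler_sumr.
  rewrite big_split exchange_big /=; congr (_ + _); apply: eq_bigr => i' _.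
  by rewrite scaler_suml; apply: eq_bigr => k _; rewrite scalerA.
rewrite addrCA -[RHS]addr0; congr (_ + _).
apply: etrans hc; rewrite -big_split; apply: eq_bigr => i' _ /=.
by rewrite /c' scalerDl.
Qed.

Definition nested_values ps (w : forall k, vpoly V 'I_(l k)) i : Vlam d (N i) :=
  eval_op d (ri i) (qm (N i)) (psii i) (ps i) (fun j => w (rm i j)).

Lemma nested_values_dfwith ps w i (j : 'I_(m i)) (p : vpoly V 'I_(l (rm i j))) :
  nested_values ps (dfwith w p)
  = dfwith (nested_values ps w)
      (eval_op d (ri i) (qm (N i)) (psii i) (ps i) (dfwith (fun j => w (rm i j)) p)).
Proof.
apply: functional_extensionality_dep => i'; rewrite /nested_values.
case: dfwithP => [|i2 ni].
  congr (eval_op _ _ _ _ _ _); apply: functional_extensionality_dep => j'.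
  have [e|nj] := eqVneq j j'; first by case: _ / e; rewrite !dfwith_in.
  by rewrite !dfwith_out // (inj_eq (@blocks_inj _ _ _ _ _ hm i)).
congr (eval_op _ _ _ _ _ _); apply: functional_extensionality_dep => j'.
by rewrite dfwith_out //; apply: contraNneq ni => /(block_eq hm) ->.
Qed.

(** A factor in slot [rm i j] is absorbed by [ps i] on one side and by the nested function on the
    other; [nest_T] identifies the results. *)
Lemma eval_nested phi ps (w : forall k, vpoly V 'I_(l k)) :
  goodN phi -> (forall i, goodi i (ps i)) ->
  evc rN psiN phi (nested_values ps w)
  = eval_op d rl (qm K) psil (nest phi ps) w.
Proof.
have psm ps' : (forall i, goodi i (ps' i)) -> forall i, multilinear (ps' i).
  by move=> h i; case: (h i).
elim/vpolys_ind: w ps => [w k|w k p q hp hq|w k p a hp|v] ps hphi hps;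
  have hmult := nest_multilinear hphi (psm _ hps).
- elim/(blocks_ind hm): k => i j; rewrite nested_values_dfwith.
  rewrite (eval_op_slot0 _ _ (@qmulC _ _ _ _) _ _ _ (hps i).1).
  rewrite (eval_op_slot0 _ _ (@qmulC _ _ _ _) _ _ _ hmult).
  pose A x := evc rN psiN phi (dfwith (nested_values ps w) (x : Vlam d (N i))).
  have AP (e : F) y z : A (e *: y + z) = e *: A y + A z.
    exact: (evc_slot_linear hN hpsiN).
  exact: (oplin0 AP).
- elim/(blocks_ind hm): k p q hp hq => i j p q hp hq.
  move: (hp _ hphi hps) (hq _ hphi hps); rewrite !nested_values_dfwith.
  rewrite (eval_op_slotD _ _ (@qmulC _ _ _ _) _ _ _ _ (hps i).1).
  rewrite (eval_op_slotD _ _ (@qmulC _ _ _ _) _ _ _ _ hmult) => <- <-.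
  pose A x := evc rN psiN phi (dfwith (nested_values ps w) (x : Vlam d (N i))).
  have AP (e : F) y z : A (e *: y + z) = e *: A y + A z.
    exact: (evc_slot_linear hN hpsiN).
  exact: (oplinD AP).
- elim/(blocks_ind hm): k p a hp => i j p a hp.
  rewrite (eval_op_mulX _ _ (@qmulC _ _ _ _) _ _ _ _ hmult) -nest_T //.
  have hps' i' : goodi i' (dfwith ps
      (opT d (ri i) (qm (N i)) (psii i) (ri i j a) (ps i)) i').
    have [e|ni] := eqVneq i i'; last by rewrite dfwith_out.
    by case: _ / e; rewrite dfwith_in; apply: (good_T (@qmulC _ _ _ _)).
  rewrite -(hp _ hphi hps') !nested_values_dfwith.
  congr (evc rN psiN phi _).
  apply: functional_extensionality_dep => i'.
  have [e|ni] := eqVneq i i'.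
    case: _ / e; rewrite !dfwith_in.
    by rewrite (eval_op_mulX _ _ (@qmulC _ _ _ _) _ _ _ _ (hps i).1).
  by rewrite !(dfwith_out _ _ ni) /nested_values (dfwith_out _ _ ni).
rewrite (eval_op_const _ _ (@qmulC _ _ _ _) _ _ hmult) /nest.
congr (evc rN psiN phi _); apply: functional_extensionality_dep => i.
exact: (eval_op_const _ _ (@qmulC _ _ _ _) _ _ (hps i).1).
Qed.

End Nested.

Variables (f : rawop d n) (g : forall i, rawop d (m i)) (h : forall k, rawop d (l k)).
Arguments g : clear implicits.
Arguments h : clear implicits.
Hypotheses (hf : is_pcl f) (hg : forall i, is_pcl (g i)) (hh : forall k, is_pcl (h k)).

(** If one of the collapsed graphs has a cycle, both sides vanish; for a cycle within part i, the
    right-hand side does so because g_i vanishes on graphs that are not acyclic. In the remaining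
    case [ext] solves the coboundary condition at every stage, and [eval_nested] applies. *)
Theorem comp_op_assoc :
  comp_op rN bN f (fun i => comp_op (ri i) (bi i) (g i) (fun j => h (rm i j)))
  = comp_op rl bl (comp_op rm bm f g) h.
Proof.
apply/funext => G; apply/funext => v.
have hgh i : is_pcl (comp_op (ri i) (bi i) (g i) (fun j => h (rm i j))).
  exact: (comp_op_pcl char0 (hi i)).
have hfg : is_pcl (comp_op rm bm f g) by apply: (comp_op_pcl char0 hm).
have eoo := outer_outer hm hl hN hi compat G.
have eio i := inner_outer hm compat G i.
have eb : bm \o bl = bN.
  by apply/funext => z; rewrite (nested_blk hm hl hN hi compat).
have [hG|hG] := pselect (acyclic (outer rN G)); last first.
  rewrite comp_op_nacyclic // (comp_op_outer0 hl) // => u.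
  by rewrite comp_op_nacyclic // eoo.
have [[i nGi]|hGi] := pselect (exists i, ~ acyclic (outer (ri i) (inner rN i G))).
  rewrite (comp_op_slot0 hN hf (i := i)); last by rewrite comp_op_nacyclic.
  rewrite (comp_op_outer0 hl) // => u; rewrite (comp_op_slot0 hm hf (i := i)) //.
  by rewrite (pcl_acyclic (hg i)) // eio.
have {}hGi i : acyclic (outer (ri i) (inner rN i G)).
  by apply: contrapT => nG; apply: hGi; exists i.
have hGl : acyclic (outer rl G).
  by apply: (acyclic_blocks hm) => [|i]; rewrite ?eoo ?eio.
have hpsiN := ext_coboundary hN hG; have hpsil := ext_coboundary hl hGl.
have hpsii i := ext_coboundary (hi i) (hGi i).
have hpsim : coboundary bm (outer rl G) (ext rm bm (outer rl G)).
  by apply: (ext_coboundary hm); rewrite eoo.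
pose w k := crepr (h k (inner rl k G) (fun a => v (rl k a))).
have hw k : lclass d (w k) = h k (inner rl k G) (fun a => v (rl k a)).
  by rewrite lclass_crepr.
rewrite [RHS](comp_opE hl hfg hGl hpsil hw).
pose phi := pull rN (f (outer rN G)).
pose ps i := pull (ri i) (g i (outer (ri i) (inner rN i G))).
have hphi : good d rN (qm K) (outer rN G) phi by apply: (pull_good hN).
have hps i : good d (ri i) (qm (N i)) (outer (ri i) (inner rN i G)) (ps i).
  exact: (pull_good (hi i)).
have -> : pull rl (comp_op rm bm f g (outer rl G))
    = nest (ext rN bN G) phi ps.
  apply/funext => u; rewrite (pull_pb hl).
  pose y i := crepr (g i (inner rm i (outer rl G)) (fun j => u (rm i j))).
  have hy i : lclass d (y i) = g i (inner rm i (outer rl G)) (fun j => u (rm i j)).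
    by rewrite lclass_crepr.
  have hG' : acyclic (outer rm (outer rl G)) by rewrite eoo.
  rewrite (comp_opE hm hf hG' hpsim hy) eoo.
  have hgm : good d rm (qm M) (outer rN G) (pull rm (f (outer rN G))).
    exact: (pull_good hm).
  rewrite (pb_eval_op hm hl hN hi compat hpsiN hpsim _ hgm) (evcE hN hpsiN); last first.
    exact: (good_pb hl hi compat).
  rewrite /nest; congr (evc rN (ext rN bN G) _ _).
    by apply/funext => u'; rewrite (pull_pb hm) pb_comp eb /phi (pull_pb hN).
  apply: functional_extensionality_dep => i.
  by rewrite -pbE hy /ps (pull_pb (hi i)) eio.
rewrite -(eval_nested hpsiN hpsil hpsii) //.
rewrite (comp_opE hN hf hG hpsiN (w := fun i =>
    crepr (nested_values (fun i => ext (ri i) (bi i) (inner rN i G)) ps w i))) //.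
move=> i; rewrite lclass_crepr /nested_values.
rewrite (comp_opE (hi i) (hg i) (hGi i) (hpsii i) (w := fun j => w (rm i j))) //.
move=> j; rewrite hw (inner_inner compat).
by congr (h _ _ _); apply/funext => b; rewrite compat.
Qed.

End Associativity.

(** * Permutations and the unit *)

Lemma oplin_sum_cond (F : fieldType) (A B : lmodType F) (T : A -> B)
    (TP : forall (c : F) x y, T (c *: x + y) = c *: T x + T y)
    (I : Type) (s : seq I) (P : pred I) (E : I -> A) :
  T (\sum_(x <- s | P x) E x) = \sum_(x <- s | P x) T (E x).
Proof. by rewrite -big_filter (oplin_sum TP) big_filter. Qed.

Section Relabeling.
Variable n : nat.
Implicit Types (G : graph n) (s : 'S_n).

Definition relabel_edge s (e : 'I_n * 'I_n) := (s e.1, s e.2).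
Definition relabel_step s (t : step n) : step n := (relabel_edge s t.1, t.2).

Lemma relabel_edge_inj s : injective (relabel_edge s).
Proof. by move=> [x y] [x' y'] [/perm_inj -> /perm_inj ->]. Qed.

Lemma mult_relabel_edge s G e : mult (relabel s G) (relabel_edge s e) = mult G e.
Proof. by case: e => x y; rewrite mult_relabel !permK. Qed.

Lemma relabel_trail s G i w j : trail G i w j ->
  trail (relabel s G) (s i) (map (relabel_step s) w) (s j).
Proof.
move=> /andP[hw /forallP hc]; apply/andP; split.
  elim: w i hw {hc} => [|[[x y] b] w IH] i /=; first by move=> /eqP ->.
  move=> /andP[/eqP <- /IH]; rewrite /step_src /step_tgt /=.
  by case: b => /= ->; rewrite eqxx.
apply/forallP => e.
have -> : e = relabel_edge s (s^-1%g e.1, s^-1%g e.2).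
  by rewrite /relabel_edge /= !permKV -surjective_pairing.
rewrite mult_relabel_edge; apply: leq_trans (hc _); rewrite /unzip1 -map_comp.
rewrite (_ : map _ w = map (relabel_edge s) (unzip1 w)); last by rewrite /unzip1 -map_comp.
rewrite count_map; apply/eq_leq/eq_count => e' /=.
exact: (inj_eq (@relabel_edge_inj s)).
Qed.

Lemma acyclic_relabel s G : acyclic (relabel s G) -> acyclic G.
Proof.
move=> h i w /(relabel_trail s)/(acyclic_trail h).
by case: w.
Qed.

Lemma relabel_comp s t G : relabel s (relabel t G) = relabel (t * s)%g G.
Proof. by apply: graphP => i j _; rewrite !mult_relabel invMg !permM. Qed.

Lemma relabel1 G : relabel 1%g G = G.
Proof. by apply: graphP => i j _; rewrite mult_relabel invg1 !perm1. Qed.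

Lemma relabel_acyclic s G : acyclic G -> acyclic (relabel s G).
Proof.
move=> h; apply: (acyclic_relabel (s := s^-1%g)).
by rewrite relabel_comp mulgV relabel1.
Qed.

Lemma relabel_oriented_cycle s G C :
  oriented_cycle G C -> oriented_cycle (relabel s G) (map (relabel_edge s) C).
Proof.
move=> [C0 [i hC]]; split; first by case: (C) C0.
exists (s i); have := relabel_trail s hC.
by rewrite -!map_comp.
Qed.

Lemma relabel_del_edge s G e :
  relabel s (del_edge G e) = del_edge (relabel s G) (relabel_edge s e).
Proof.
apply: graphP => i j _; rewrite mult_del_edge !mult_relabel mult_del_edge.
congr (_ - nat_of_bool _)%N; case: e => x y; rewrite /relabel_edge /= !xpair_eqE.
by rewrite !(can2_eq (permK s) (permKV s)).
Qed.

Lemma adjacent_relabel s G i j : adjacent (relabel s G) (s i) (s j) = adjacent G i j.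
Proof. by rewrite /adjacent !mult_relabel !permK. Qed.

Lemma relabel_component s G i j :
  (s j \in component (relabel s G) (s i)) = (j \in component G i).
Proof.
have aux (u : 'S_n) (H : graph n) x y :
    connect (adjacent H) x y -> connect (adjacent (relabel u H)) (u x) (u y).
  move=> /connectP[p hp ->]; elim: p x hp => [|z p IH] x /=; first by rewrite connect0.
  move=> /andP[hxz /IH]; apply: connect_trans; apply: connect1.
  by rewrite adjacent_relabel.
rewrite !inE; apply/idP/idP => [/(aux s^-1%g)|]; last exact: aux.
by rewrite relabel_comp mulgV relabel1 !permK.
Qed.

Lemma nb_edges_relabel s G : nb_edges (relabel s G) = nb_edges G.
Proof.
rewrite /nb_edges (reindex_inj (@relabel_edge_inj s)).
by apply: eq_bigr => e _; rewrite mult_relabel_edge.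
Qed.

End Relabeling.

Section Action.
Variables (F : fieldType) (V : lmodType F) (d : {linear V -> V}).

(** The action without its sign. The fibre of s over i is s^-1 i, so pullback along s is the
    renaming of variables required by the formula. *)
Definition act_op n (s : 'S_n) (f : rawop d n) : rawop d n :=
  fun G v => pb s (f (relabel s G) (fun i => v (s^-1%g i))).

Lemma pb_var_perm n (s : 'S_n) :
  pb_var F s = (fun i => svar F (s^-1%g i)).
Proof.
apply/funext => i; rewrite /pb_var (big_pred1 (s^-1%g i)) // => y /=.
by rewrite -(can2_eq (permK s) (permKV s)).
Qed.

Lemma pb_perm_mulX n (s : 'S_n) i (x : Vlam d n) :
  pb s (qmulX i x) = qmulX (s^-1%g i) (pb s x).
Proof.
rewrite pb_mulX (big_pred1 (s^-1%g i)) // => y /=.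
by rewrite -(can2_eq (permK s) (permKV s)).
Qed.

Lemma count_pb_seq n N (h : 'I_N -> 'I_n) k c :
  count_mem k (pb_seq h c) = (c == h k) :> nat.
Proof.
rewrite /pb_seq count_uniq_mem; last by rewrite filter_uniq ?enum_uniq.
by rewrite mem_filter mem_enum andbT eq_sym.
Qed.

Lemma pb_derivB n N (h : 'I_N -> 'I_n) y z (x : Vlam d n) :
  qderivB y z (pb h x) = pb h (qderivB (h y) (h z) x).
Proof.
by apply: (qsubst_derivB (pb_varE F h) (pb_seq_sum h)) => k; rewrite count_pb_seq.
Qed.

Lemma upd_perm n (s : 'S_n) (v : 'I_n -> V) i x :
  (fun j => upd v i x (s^-1%g j)) = upd (fun j => v (s^-1%g j)) (s i) x.
Proof.
by apply/funext => j; rewrite /upd -(can2_eq (permKV s) (permK s)).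
Qed.

Lemma act_op_pcl n (s : 'S_n) (f : rawop d n) : is_pcl f -> is_pcl (act_op s f).
Proof.
move=> hf; split=> [G v i a x y|G v nG|G C v hC|G v i j hij|G v i]; rewrite /act_op.
- by rewrite !upd_perm (pcl_linear hf) pb_linear.
- rewrite (pcl_acyclic hf) ?(oplin0 (@pb_linear F V d _ _ s)) //.
  by move=> /acyclic_relabel.
- rewrite -(oplin_sum (@pb_linear F V d _ _ s)).
  under eq_bigr do rewrite relabel_del_edge.
  have := pcl_cycle hf (fun i => v (s^-1%g i)) (relabel_oriented_cycle s hC).
  by rewrite big_map => ->; rewrite (oplin0 (@pb_linear F V d _ _ s)).
- rewrite pb_derivB (pcl_deriv hf) ?(oplin0 (@pb_linear F V d _ _ s)) //.
  by rewrite relabel_component.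
have plin := @pb_linear F V d _ _ s.
have sumE (E : 'I_n -> Vlam d n) :
    \sum_(j in component G i) E (s j) = \sum_(j in component (relabel s G) (s i)) E j.
  rewrite [RHS](reindex_inj (@perm_inj _ s)) /=.
  by apply: eq_bigl => j; rewrite relabel_component.
pose u j := v (s^-1%g j).
pose E j := pb s (f (relabel s G) (upd u j (d (u j)))).
rewrite (eq_bigr (fun j => E (s j))) => [|j _]; last by rewrite upd_perm /E /u permK.
rewrite sumE -(oplin_sum_cond plin) (pcl_sesqui hf) -scaleN1r (oplinZ plin) scaleN1r.
congr (- _); rewrite (oplin_sum_cond plin) -sumE; apply: eq_bigr => j _.
by rewrite pb_perm_mulX permK.
Qed.

Definition unit_op : rawop d 1 := fun G v => lclass d (vconst 'I_1 (v ord0)).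

Lemma unit_op_pcl : is_pcl unit_op.
Proof.
have mult1 (G : graph 1) e : mult G e = 0%N.
  by case: e => i j; rewrite !ord1 mult_loop.
split=> [G v i a x y|G v nG|G C v|G v i j _|G v i]; rewrite /unit_op.
- rewrite !ord1 !upd_same -linearP; congr (lclass d _).
  exact: (@vmonom_linear F V 'I_1 mone a x y).
- case: nG => i w /andP[_ /forallP hw]; case: w hw => // t w /(_ t.1) /=.
  by rewrite eqxx mult1.
- move=> [C0 [i /andP[_ /forallP hw]]]; case: C C0 hw => // e C _ /(_ e) /=.
  by rewrite eqxx mult1.
- by rewrite !ord1 qderivBE subrr linear0.
have -> : component G i = [set ord0].
  by apply/setP => j; rewrite !ord1 set11 component_refl.
rewrite !big_set1 upd_same qmulXE -linearN; apply/eqP/lclassP.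
exists (vconst 'I_1 (v ord0)); rewrite opprK /dlam big_ord1 vmap_const.
by congr (_ + _).
Qed.

(** All slots hold constants, so no factor lambda acts. Since r is an abstract numbering, the cast
    in the unit law can be absorbed into it. *)
Lemma comp_op_unitr n (r : 'I_n -> 'I_1 -> 'I_n) (f : rawop d n) :
  (forall i a, r i a = i) -> is_pcl f ->
  comp_op r id f (fun=> unit_op) = f.
Proof.
move=> rE hf; apply/funext => G; apply/funext => v.
have hb : blocks r id.
  split=> [i a|i a b _|k]; [exact: rE|by rewrite !ord1|by exists ord0].
have eG : outer r G = G.
  by apply: graphP => i j nij; rewrite mult_outer // !big_ord1 !rE.
have [hG|hG] := pselect (acyclic G); last first.
  by rewrite comp_op_nacyclic ?eG // (pcl_acyclic hf).
rewrite (comp_opE hb hf _ (ext_coboundary hb _)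
  (w := fun i => vconst 'I_1 (v (r i ord0)))) ?eG //.
rewrite (eval_op_const _ _ (@qmulC _ _ _ _) _ (fun i => v (r i ord0)) (pull_good hb G hf).1).
by rewrite (pull_pb hb) pb_id; congr (f _ _); apply/funext => i; rewrite rE.
Qed.

Lemma comp_op_unitl k (r : 'I_1 -> 'I_k -> 'I_k) (f : rawop d k) :
  (forall i a, r i a = a) -> is_pcl f ->
  comp_op r (fun=> ord0) unit_op (fun=> f) = f.
Proof.
move=> rE hf; apply/funext => G; apply/funext => v.
have hb : blocks r (fun=> ord0).
  split=> [i a|i a b|a]; [by rewrite (ord1 i)|by rewrite !rE|by exists a; rewrite rE].
have hG : acyclic (outer r G).
  move=> i w /andP[_ /forallP hw]; case: w hw => // t w /(_ t.1) /=.
  by case: (t.1) => x y; rewrite eqxx !ord1 mult_loop.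
have eG : inner r ord0 G = G by apply: graphP => a b _; rewrite mult_inner !rE.
pose w (i : 'I_1) := crepr (f G v).
have hext := ext_coboundary hb hG.
have hgood := pull_good hb (outer r G) unit_op_pcl.
rewrite (comp_opE hb unit_op_pcl hG hext (w := w)); last first.
  move=> i; rewrite lclass_crepr !ord1 eG; congr (f _ _).
  by apply/funext => a; rewrite rE.
rewrite -[RHS]lclass_crepr -[crepr (f G v)]/(w ord0).
elim/vpolys_ind: w => [w i|w i p q hp hq|w i p a hp|u].
- rewrite (eval_op_slot0 _ _ (@qmulC _ _ _ _) _ _ _ hgood.1).
  by move: i => i; rewrite (ord1 i) dfwith_in linear0.
- move: hp hq; rewrite (eval_op_slotD _ _ (@qmulC _ _ _ _) _ _ _ _ hgood.1) => -> ->.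
  by rewrite (ord1 i) !dfwith_in linearD.
- rewrite (eval_op_mulX _ _ (@qmulC _ _ _ _) _ _ _ _ hgood.1).
  (* On a graph with a single vertex every weight is locally constant, so goodness removes the shift
     and only lambda_a is left. *)
  have -> : opT d r (@qmul F V d k) (ext r (fun=> ord0) G) (r i a)
                (pull r (unit_op (outer r G)))
      = opL (@qmul F V d k) a (pull r (unit_op (outer r G))).
    rewrite opTE hgood.2 ?addr0 ?rE // => x y /adjacent_neq.
    by rewrite !ord1.
  rewrite -[LHS](eval_op_L _ _ (@qmulC _ _ _ _) _ _ _ hgood.1) hp.
  by rewrite -[LHS]/(qmulX a _) qmulXE (ord1 i) !dfwith_in.
rewrite (eval_op_const _ _ (@qmulC _ _ _ _) _ _ hgood.1) (pull_pb hb) pbE.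
by rewrite vsubst_const.
Qed.

End Action.

(** * Equivariance of the unsigned composition *)

Section Equivariance.
Variables (F : fieldType) (V : lmodType F) (d : {linear V -> V}).
Variables (n : nat) (m : 'I_n -> nat) (N : nat).
Variables (r : forall i, 'I_(m i) -> 'I_N) (blk : 'I_N -> 'I_n).
Arguments r : clear implicits.
Variables (s : 'S_n) (t : forall i, 'S_(m i)) (beta : 'S_N).
Arguments t : clear implicits.
Local Notation m' := (fun i => m (s^-1%g i)).
Variables (r' : forall i, 'I_(m' i) -> 'I_N) (blk' : 'I_N -> 'I_n).
Arguments r' : clear implicits.
Hypotheses (hb : blocks r blk) (hb' : blocks r' blk').
Hypothesis compat : forall i a, beta (r (s^-1%g i) a) = r' i (t (s^-1%g i) a).
Local Notation qm := (@qmul F V d N).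

Lemma blk_beta k : blk' (beta k) = s (blk k).
Proof.
elim/(blocks_ind hb): k => i a; have ei : i = s^-1%g (s i) by rewrite permK.
rewrite (blocksK hb); move: a; rewrite ei => a.
by rewrite compat (blocksK hb') permKV.
Qed.

Variable G : graph N.

Lemma outer_relabel : outer r' (relabel beta G) = relabel s (outer r G).
Proof.
apply: graphP => i j nij; rewrite mult_relabel !mult_outer //; last first.
  by rewrite (inj_eq (@perm_inj _ _)).
rewrite (reindex_inj (@perm_inj _ (t (s^-1%g i)))); apply: eq_bigr => a _ /=.
rewrite (reindex_inj (@perm_inj _ (t (s^-1%g j)))); apply: eq_bigr => b _ /=.
by rewrite -!compat mult_relabel !permK.
Qed.

Lemma inner_relabel i :
  inner r' i (relabel beta G) = relabel (t (s^-1%g i)) (inner r (s^-1%g i) G).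
Proof.
apply: graphP => a b nab; rewrite mult_relabel !mult_inner mult_relabel.
rewrite -[a in LHS](permKV (t (s^-1%g i))) -[b in LHS](permKV (t (s^-1%g i))).
by rewrite -!compat !permK.
Qed.

Lemma relabel_pullback_psi psi :
  coboundary blk' (relabel beta G) psi ->
  coboundary blk G (fun k j => psi (beta k) (s j)).
Proof.
move=> h k l hkl nkl a; have := h (beta k) (beta l).
rewrite adjacent_relabel !blk_beta (inj_eq (@perm_inj _ s)) => /(_ hkl nkl (beta a)).
by rewrite !(inj_eq (@perm_inj _ beta)).
Qed.

Lemma dfwith_perm (W : 'I_n -> Type) (w : forall i, W i) i (x : W (s^-1%g i)) :
  (fun j => dfwith w x (s^-1%g j))
  = @dfwith _ (fun j => W (s^-1%g j)) (fun j => w (s^-1%g j)) i x.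
Proof.
apply: functional_extensionality_dep => j; have [e|nij] := eqVneq i j.
  by case: _ / e; rewrite !dfwith_in.
by rewrite !dfwith_out // (inj_eq (@perm_inj _ _)).
Qed.

Variable psi : 'I_N -> 'I_n -> bool.
Local Notation psi0 := (fun k j => psi (beta k) (s j)).

(** Transport of phi, by s on its arguments and by beta on the variables of its values. [conj_X] and
    [conj_T] say that the operators are permuted accordingly. *)
Definition conj_fun (phi : ('I_n -> V) -> Vlam d N) : ('I_n -> V) -> Vlam d N :=
  fun u => pb beta (phi (fun i => u (s^-1%g i))).

Lemma conj_multilinear phi : multilinear phi -> multilinear (conj_fun phi).
Proof.
by move=> h u i a x y; rewrite /conj_fun !upd_perm h (@pb_linear F V d _ _ beta).
Qed.

Lemma conj_X phi i u :
  conj_fun (opX d r' qm i phi) u = opX d r qm (s^-1%g i) (conj_fun phi) u.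
Proof.
have plin := @pb_linear F V d _ _ beta.
rewrite /conj_fun /opX (oplinD plin) (oplin_sum plin) upd_perm permKV; congr (_ + _).
rewrite (reindex_inj (@perm_inj _ (t (s^-1%g i)))); apply: eq_bigr => a _ /=.
by rewrite [LHS]pb_perm_mulX -compat permK.
Qed.

Lemma conj_T phi i (a : 'I_(m (s^-1%g i))) :
  conj_fun (opT d r' qm psi (r' i (t (s^-1%g i) a)) phi)
  = opT d r qm psi0 (r (s^-1%g i) a) (conj_fun phi).
Proof.
have plin := @pb_linear F V d _ _ beta.
apply/funext => u; rewrite {1}/conj_fun /opT (oplinD plin) (oplin_sum plin); congr (_ + _).
  by rewrite [LHS]pb_perm_mulX -compat permK.
rewrite [RHS](reindex_inj (@perm_inj _ s^-1%g)); apply: eq_bigr => j _ /=.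
by rewrite (oplinZ plin) -conj_X permKV compat.
Qed.

Lemma eval_op_conj phi (y : forall i, vpoly V 'I_(m i)) : multilinear phi ->
  pb beta (eval_op d r' qm psi phi (fun i => y (s^-1%g i)))
  = eval_op d r qm psi0 (conj_fun phi) (fun i => vsubst (pb_var F (t i)) (y i)).
Proof.
have plin := @pb_linear F V d _ _ beta.
have inv i : exists i', i = s^-1%g i' by exists (s i); rewrite permK.
elim/vpolys_ind: y phi => [y i|y i p q hp hq|y i p a hp|v] phi hphi;
  have hphi' := conj_multilinear hphi.
- have [i' ei] := inv i; rewrite {i}ei; rewrite dfwith_perm.
  rewrite (dfwith_comp (fun i => vsubst (pb_var F (t i)))) raddf0.
  rewrite (eval_op_slot0 _ _ (@qmulC _ _ _ _) _ _ _ hphi).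
  by rewrite (eval_op_slot0 _ _ (@qmulC _ _ _ _) _ _ _ hphi') (oplin0 plin).
- have [i' ei] := inv i; move: p q hp hq; rewrite {i}ei => p q hp hq.
  move: (hp _ hphi) (hq _ hphi); rewrite !dfwith_perm.
  rewrite !(dfwith_comp (fun i => vsubst (pb_var F (t i)))).
  rewrite (eval_op_slotD _ _ (@qmulC _ _ _ _) _ _ _ _ hphi) (oplinD plin) => -> ->.
  by rewrite raddfD /= (eval_op_slotD _ _ (@qmulC _ _ _ _) _ _ _ _ hphi').
- have [i' ei] := inv i; move: p a hp; rewrite {i}ei => p a hp.
  have := hp _ (opT_multilinear d r' qm psi (r' i' a) hphi).
  rewrite !dfwith_perm (eval_op_mulX _ _ (@qmulC _ _ _ _) _ _ _ _ hphi) => ->.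
  rewrite !(dfwith_comp (fun i => vsubst (pb_var F (t i)))) vsubst_pb_mulX.
  rewrite (big_pred1 ((t (s^-1%g i'))^-1%g a)); last first.
    by move=> z /=; rewrite -(can2_eq (permK _) (permKV _)).
  rewrite (eval_op_mulX _ _ (@qmulC _ _ _ _) _ _ _ _ hphi').
  by rewrite -conj_T permKV.
rewrite (eval_op_const _ _ (@qmulC _ _ _ _) _ (fun i => v (s^-1%g i)) hphi).
rewrite (functional_extensionality_dep (fun i => vsubst_const (pb_var F (t i)) (v i))).
by rewrite (eval_op_const _ _ (@qmulC _ _ _ _) _ _ hphi').
Qed.

End Equivariance.

(** Both psi and the representatives on the left are transported from the right-hand side, after
    which [eval_op_conj] compares the two evaluations factor by factor. *)
Theorem comp_op_equivariant (F : fieldType) (V : lmodType F) (d : {linear V -> V})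
    (n : nat) (m : 'I_n -> nat) (N : nat)
    (r : forall i, 'I_(m i) -> 'I_N) (blk : 'I_N -> 'I_n)
    (s : 'S_n) (t : forall i, 'S_(m i)) (beta : 'S_N)
    (r' : forall i, 'I_(m (s^-1%g i)) -> 'I_N) (blk' : 'I_N -> 'I_n)
    (f : rawop d n) (g : forall i, rawop d (m i)) :
  blocks r blk -> blocks r' blk' ->
  (forall i a, beta (r (s^-1%g i) a) = r' i (t (s^-1%g i) a)) ->
  is_pcl f -> (forall i, is_pcl (g i)) ->
  comp_op r blk (act_op s f) (fun i => act_op (t i) (g i))
  = act_op beta (comp_op r' blk' f (fun i => g (s^-1%g i))).
Proof.
move=> hb hb' compat hf hg; apply/funext => G; apply/funext => v.
have eo := outer_relabel (m := m) (r := r) (s := s) (t := t) (beta := beta)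
  (r' := r') compat G.
have ei := inner_relabel (m := m) (r := r) (s := s) (t := t) (beta := beta)
  (r' := r') compat G.
have plin := @pb_linear F V d _ _ beta.
have eb : blk' \o beta = s \o blk.
  apply/funext => k /=.
  exact: (blk_beta (m := m) (r := r) (s := s) (t := t) (r' := r') hb hb' compat).
rewrite [in RHS]/act_op; have [hG|hG] := pselect (acyclic (outer r G)); last first.
  rewrite comp_op_nacyclic // comp_op_nacyclic ?(oplin0 plin) // eo.
  by move=> /acyclic_relabel.
have hG' : acyclic (outer r' (relabel beta G)) by rewrite eo; apply: relabel_acyclic.
have hpsi := ext_coboundary hb' hG'.
have hpsi0 := relabel_pullback_psi (m := m) (r := r) (s := s) (t := t)
  (beta := beta) (r' := r') hb hb' compat hpsi.
have hsf : is_pcl (act_op s f) by apply: act_op_pcl.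
pose y i := crepr (g i (relabel (t i) (inner r i G)) (fun a => v (r i ((t i)^-1%g a)))).
rewrite (comp_opE hb hsf hG hpsi0 (w := fun i => vsubst (pb_var F (t i)) (y i))); last first.
  by move=> i; rewrite -pbE lclass_crepr.
rewrite (comp_opE hb' hf hG' hpsi (w := fun i => y (s^-1%g i))); last first.
  move=> i; rewrite lclass_crepr ei; congr (g _ _ _); apply/funext => a.
  congr v; apply: (@perm_inj _ beta).
  by rewrite permKV compat permKV.
have hgood := pull_good hb' (outer r' (relabel beta G)) hf.
rewrite (eval_op_conj (m := m) (r := r) (s := s) (t := t) (beta := beta)
  (r' := r') compat _ _ hgood.1); congr (eval_op _ _ _ _ _ _).
apply/funext => u; rewrite /conj_fun (pull_pb hb) (pull_pb hb') /act_op !pb_comp eo.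
by rewrite eb.
Qed.

(** * Parity *)

Section Projections.
Variables (F : fieldType) (W : lmodType F) (par : bool -> W -> Prop).
Hypothesis hW : is_superspace par.

Lemma superspaceB b u v : par b u -> par b v -> par b (u - v).
Proof. by move=> hu hv; rewrite -scaleN1r addrC; apply: (superspaceD hW). Qed.

Lemma superspaceZ b (a : F) u : par b u -> par b (a *: u).
Proof.
by move=> hu; rewrite -[a *: u]addr0; apply: (superspaceD hW) => //; apply: superspace0 hW _.
Qed.

Lemma superspaceDr b u v : par b u -> par b v -> par b (u + v).
Proof. by move=> hu hv; rewrite -[u]scale1r; apply: (superspaceD hW). Qed.

Lemma superspace_pair v :
  exists p : W * W, [/\ par false p.1, par true p.2 & v = p.1 + p.2].
Proof. by have [v0 [v1 h]] := superspace_decomp hW v; exists (v0, v1). Qed.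

(** The decomposition picked by [cid] is the only one, by [superspace_direct]; linearity of the
    projections rests on this. *)
Definition sproj (b : bool) (v : W) : W :=
  let p := sval (cid (superspace_pair v)) in if b then p.2 else p.1.

Lemma sproj_par b v : par b (sproj b v).
Proof. by rewrite /sproj; case: cid => -[x y] /= []; case: b. Qed.

Lemma sprojD v : sproj false v + sproj true v = v.
Proof. by rewrite /sproj; case: cid => -[x y] /= []. Qed.

Lemma sproj_unique v0 v1 b :
  par false v0 -> par true v1 -> sproj b (v0 + v1) = if b then v1 else v0.
Proof.
move=> h0 h1; set v := v0 + v1.
have e : sproj false v - v0 = v1 - sproj true v.
  by apply/eqP; rewrite subr_eq addrAC -subr_eq opprK sprojD addrC.
have z : sproj false v - v0 = 0.
  apply: (superspace_direct hW); first exact: superspaceB (sproj_par _ _) h0.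
  by rewrite e; apply: superspaceB h1 (sproj_par _ _).
case: b; last exact: subr0_eq.
by apply/esym/subr0_eq; rewrite -e.
Qed.

Lemma sproj_id b v : par b v -> sproj b v = v.
Proof.
case: b => hv; first by rewrite -{1}[v]add0r sproj_unique //; apply: superspace0 hW _.
by rewrite -{1}[v]addr0 sproj_unique //; apply: superspace0 hW _.
Qed.

Lemma sproj_other b c v : par b v -> b != c -> sproj c v = 0.
Proof.
case: b c => -[] // hv _; first by rewrite -[v]add0r sproj_unique //; apply: superspace0 hW _.
by rewrite -[v]addr0 sproj_unique //; apply: superspace0 hW _.
Qed.

Lemma sproj_linear b : linear (sproj b).
Proof.
move=> a u v; have -> : a *: u + v
    = (a *: sproj false u + sproj false v) + (a *: sproj true u + sproj true v).
  by rewrite addrACA -scalerDr !sprojD.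
by rewrite sproj_unique; [case: b|apply: (superspaceD hW); apply: sproj_par..].
Qed.

HB.instance Definition _ b :=
  GRing.isLinear.Build F W W *:%R (sproj b) (sproj_linear b).

Lemma sproj_comm (T : W -> W) b v :
  (forall u w, T (u + w) = T u + T w) ->
  (forall b u, par b u -> par b (T u)) -> T (sproj b v) = sproj b (T v).
Proof.
move=> TD Tpar; rewrite -[v in RHS]sprojD TD sproj_unique; [|exact/Tpar/sproj_par..].
by case: b.
Qed.

Section Multi.
Variables (M : lmodType F) (n : nat).
Implicit Types (phi : ('I_n -> W) -> M) (v : 'I_n -> W) (q : 'I_n -> bool).

Definition homog q v : Prop := forall i, par (q i) (v i).

Definition vproj q v : 'I_n -> W := fun i => sproj (q i) (v i).

Lemma vproj_id q v : homog q v -> vproj q v = v.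
Proof. by move=> h; apply/funext => i; rewrite /vproj sproj_id. Qed.

Lemma multilinear_homog phi psi : multilinear phi -> multilinear psi ->
  (forall q v, homog q v -> phi v = psi v) -> phi = psi.
Proof.
move=> hphi hpsi h; apply/funext => v.
suff H (s : seq 'I_n) v' : (forall i, i \notin s -> exists b, par b (v' i)) ->
    phi v' = psi v'.
  by apply: (H (enum 'I_n)) => i; rewrite mem_enum.
elim: s v' => [|j s IH] v' hv'.
  have /choice[q hq] i : exists b, par b (v' i) by apply: hv'.
  exact: (h q).
rewrite -(upd_id v' j) -(sprojD (v' j)) -[sproj false _]scale1r hphi hpsi !scale1r.
have E b : phi (upd v' j (sproj b (v' j))) = psi (upd v' j (sproj b (v' j))).
  apply: IH => i; rewrite /upd; case: eqP => [_ _|nij ns].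
    by exists b; apply: sproj_par.
  by apply: hv'; rewrite inE negb_or ns andbT; apply/eqP.
by rewrite !E.
Qed.

Lemma vproj_other phi q q' v : multilinear phi -> homog q v ->
  ~ q =1 q' -> phi (vproj q' v) = 0.
Proof.
move=> hphi hv nq; have [i hi] : exists i, q i != q' i.
  apply: contrapT => /forallNP h; apply: nq => i.
  by apply/eqP/negPn/negP/h.
by apply: (multilinear0 (i := i) hphi); rewrite /vproj (sproj_other (hv i)).
Qed.

Lemma vproj_upd q v i x : vproj q (upd v i x) = upd (vproj q v) i (sproj (q i) x).
Proof. by apply/funext => j; rewrite /vproj /upd; case: eqP => [->|]. Qed.

End Multi.
End Projections.

Section SuperPcl.
Variables (F : fieldType) (V : lmodType F) (par : bool -> V -> Prop).
Variable d : {linear V -> V}.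
Hypothesis superV : is_superspace par.
Hypothesis d_even : forall b v, par b v -> par b (d v).
Local Notation pi := (sproj superV).

Lemma d_sproj b v : d (pi b v) = pi b (d v).
Proof. by apply: sproj_comm => [u w|c u]; [exact: raddfD|exact: d_even]. Qed.

Definition vpar (I : choiceType) b (p : vpoly V I) : Prop := forall k, par b p@_k.

Lemma vpar_vmap I b (p : vpoly V I) : vpar b (vmap (pi b) p).
Proof.
elim/vpoly_ind: p => [|p q hp hq|c v] k.
- by rewrite raddf0 mcoeff0; apply: superspace0 superV _.
- by rewrite raddfD mcoeffD; apply: superspaceDr.
rewrite vmapU vcoeffU; case: (_ == _); first exact: sproj_par.
by rewrite mulr0n; apply: superspace0 superV _.
Qed.

Lemma vmap_id_vpar I b (p : vpoly V I) : vpar b p -> vmap (pi b) p = p.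
Proof.
move=> hp; apply: etrans (esym (vpolyE p)); rewrite /vmap /vext.
by apply: eq_bigr => k _; rewrite sproj_id.
Qed.

Lemma vmap_other_vpar I b c (p : vpoly V I) : vpar b p -> b != c -> vmap (pi c) p = 0.
Proof.
move=> hp nbc; rewrite /vmap /vext big1 // => k _.
by rewrite (sproj_other _ (hp k)) // raddf0.
Qed.

Lemma vmap_projD I (p : vpoly V I) : vmap (pi false) p + vmap (pi true) p = p.
Proof.
apply: etrans (esym (vpolyE p)); rewrite /vmap /vext -big_split.
by apply: eq_bigr => k _; rewrite /= -raddfD /= sprojD.
Qed.

Lemma dlam_vmap n b (p : vpoly V 'I_n) :
  dlam d (vmap (pi b) p) = vmap (pi b) (dlam d p).
Proof.
have vl := @vmap_linear F V 'I_n (pi b).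
rewrite /dlam (oplinD vl) [X in _ = _ + X](oplin_sum vl).
congr (_ + _); last by apply: eq_bigr => i _; rewrite vmulX_map.
elim/vpoly_ind: p => [|p q hp hq|c v]; first by rewrite !raddf0.
  by rewrite !raddfD /= hp hq.
by rewrite !vmapU d_sproj.
Qed.

Definition wproj n b (w : Vlam d n) : Vlam d n := lclass d (vmap (pi b) (crepr w)).

(** As d is even, the projection of coefficients commutes with [dlam] and descends to the
    quotient. *)
Lemma wprojE n b (p : vpoly V 'I_n) : wproj b (lclass d p) = lclass d (vmap (pi b) p).
Proof.
have [q hq] := lclassK d p; apply/eqP/lclassP; exists (vmap (pi b) q).
by rewrite hq raddfD /= addrC addKr dlam_vmap.
Qed.

Lemma wproj_linear n b : linear (@wproj n b).
Proof.
move=> c x y; rewrite -(lclass_crepr x) -(lclass_crepr y) -linearP !wprojE.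
by rewrite (@vmap_linear F V 'I_n (pi b)) linearP.
Qed.

Lemma wproj_par n b (w : Vlam d n) : Vlam_par par b (wproj b w).
Proof. by exists (vmap (pi b) (crepr w)); split=> // k; apply: vpar_vmap. Qed.

Lemma wproj_id n b (w : Vlam d n) : Vlam_par par b w -> wproj b w = w.
Proof. by move=> [p [<- hp]]; rewrite wprojE vmap_id_vpar. Qed.

Lemma wproj_other n b c (w : Vlam d n) : Vlam_par par b w -> b != c -> wproj c w = 0.
Proof.
by move=> [p [<- hp]] nbc; rewrite wprojE (vmap_other_vpar hp nbc) linear0.
Qed.

Lemma wprojD n (w : Vlam d n) : wproj false w + wproj true w = w.
Proof.
by rewrite -{3}(lclass_crepr w) -(vmap_projD (crepr w)) linearD.
Qed.

Lemma Vlam_superspace n : is_superspace (@Vlam_par F V d par n).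
Proof.
split=> [b|b a u v [p [<- hp]] [q [<- hq]]|w|w h0 h1].
- exists 0; rewrite linear0; split=> // k.
  by rewrite mcoeff0; apply: superspace0 superV _.
- exists (a *: p + q); rewrite linearP; split=> // k.
  by rewrite mcoeffD mcoeff_vscale; apply: (superspaceD superV).
- by exists (wproj false w), (wproj true w); rewrite wprojD; split=> //; apply: wproj_par.
by rewrite -(wproj_id h0) (wproj_other h1).
Qed.

Lemma wproj_mulX n b i (w : Vlam d n) : wproj b (qmulX i w) = qmulX i (wproj b w).
Proof. by rewrite -(lclass_crepr w) qmulXE !wprojE qmulXE vmulX_map. Qed.

Lemma wproj_derivB n b i j (w : Vlam d n) :
  wproj b (qderivB i j w) = qderivB i j (wproj b w).
Proof.
rewrite -(lclass_crepr w) qderivBE !wprojE qderivBE !vderiv_map.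
by rewrite (oplinB (@vmap_linear F V 'I_n (pi b))).
Qed.

Lemma qmulX_par n b i (w : Vlam d n) : Vlam_par par b w -> Vlam_par par b (qmulX i w).
Proof. by move=> h; rewrite -(wproj_id h) -wproj_mulX; apply: wproj_par. Qed.

Lemma pb_par n N (h : 'I_N -> 'I_n) b (w : Vlam d n) :
  Vlam_par par b w -> Vlam_par par b (pb h w).
Proof.
move=> [p [<- hp]]; rewrite pbE -(vmap_id_vpar hp) -vsubst_map.
exists (vmap (pi b) (vsubst (pb_var F h) p)); split=> // k.
exact: vpar_vmap.
Qed.

Lemma wproj_pcl n b (f : rawop d n) :
  is_pcl f -> is_pcl (fun G v => wproj b (f G v)).
Proof.
have wlin k := @wproj_linear k b.
move=> hf; split=> [G v i a x y|G v nG|G C v hC|G v i j hij|G v i].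
- by rewrite (pcl_linear hf) wlin.
- by rewrite (pcl_acyclic hf) // (oplin0 (wlin n)).
- by rewrite -(oplin_sum (wlin n)) (pcl_cycle hf) // (oplin0 (wlin n)).
- by rewrite -wproj_derivB (pcl_deriv hf) // (oplin0 (wlin n)).
rewrite -(oplin_sum_cond (wlin n)) (pcl_sesqui hf) -scaleN1r (oplinZ (wlin n)) scaleN1r.
congr (- _); rewrite (oplin_sum_cond (wlin n)); apply: eq_bigr => j _.
by rewrite wproj_mulX.
Qed.

Section Twist.
Variables (n : nat) (c : {ffun 'I_n -> bool} -> F).

(** Multiplies the values at arguments of parities q by the scalar [c q], extended multilinearly.
    The Koszul signs enter the structure through this operation; it respects sesquilinearity because
    d preserves parities. *)
Definition twist (f : rawop d n) : rawop d n :=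
  fun G v => \sum_(q : {ffun 'I_n -> bool}) c q *: f G (vproj superV q v).

Lemma twist_pcl f : is_pcl f -> is_pcl (twist f).
Proof.
move=> hf; split=> [G v i a x y|G v nG|G C v hC|G v i j hij|G v i]; rewrite /twist.
- rewrite scaler_sumr -big_split; apply: eq_bigr => q _ /=.
  rewrite !vproj_upd (sproj_linear superV) (pcl_linear hf).
  by rewrite scalerDr !scalerA mulrC.
- by rewrite big1 // => q _; rewrite (pcl_acyclic hf) // scaler0.
- rewrite exchange_big big1 // => q _.
  by rewrite -scaler_sumr (pcl_cycle hf) // scaler0.
- rewrite (oplin_sum (@qderivB_linear F V d n i j)) big1 // => q _.
  rewrite (oplinZ (@qderivB_linear F V d n i j)) (pcl_deriv hf) //.
  by rewrite scaler0.
rewrite exchange_big -sumrN.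
under [in RHS]eq_bigr do rewrite (oplin_sum (@qmulX_linear F V d n _)) -sumrN.
rewrite [RHS]exchange_big; apply: eq_bigr => q _ /=.
rewrite -scaler_sumr.
under [in LHS]eq_bigr do rewrite vproj_upd -d_sproj -/(vproj superV q v _).
rewrite (pcl_sesqui hf) scalerN scaler_sumr -sumrN; apply: eq_bigr => j _.
by rewrite (oplinZ (@qmulX_linear F V d n _)).
Qed.

Lemma twist_homog f G q v : is_pcl f -> homog par q v ->
  twist f G v = c [ffun i => q i] *: f G v.
Proof.
move=> hf hv; have hm := pcl_multilinear G hf.
rewrite /twist (bigD1 [ffun i => q i]) //= big1 ?addr0.
  by rewrite vproj_id // => i; rewrite ffunE.
move=> q' nq; rewrite (vproj_other _ hm hv) ?scaler0 // => e.
by case/eqP: nq; apply/ffunP => i; rewrite ffunE e.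
Qed.

End Twist.
End SuperPcl.

(** * Parities and scalars in unsigned compositions *)

Section HomogeneousComposition.
Variables (F : fieldType) (V : lmodType F) (par : bool -> V -> Prop).
Variable d : {linear V -> V}.
Hypothesis superV : is_superspace par.
Hypothesis d_even : forall b v, par b v -> par b (d v).
Variables (n : nat) (m : 'I_n -> nat) (N : nat).
Variables (r : forall i, 'I_(m i) -> 'I_N) (blk : 'I_N -> 'I_n).
Arguments r : clear implicits.
Hypothesis hb : blocks r blk.
Local Notation qm := (@qmul F V d N).
Implicit Type G : graph N.

Lemma vpar_vsubst (I : finType) (J : choiceType) (th : I -> spoly F J) b
    (p : vpoly V I) : vpar par b p -> vpar par b (vsubst th p).
Proof. by move=> hp; rewrite -(vmap_id_vpar superV hp) -vsubst_map; apply: vpar_vmap. Qed.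

(** With arguments homogeneous of parities e, an evaluation calls phi only at tuples of parities e,
    since d is even. K is taken to be a parity component of the target in one application and {0} in
    another. *)
Lemma eval_op_closed psi (phi : ('I_n -> V) -> Vlam d N) (K : Vlam d N -> Prop)
    (e : 'I_n -> bool) (w : forall i, vpoly V 'I_(m i)) :
  K 0 -> (forall x y, K x -> K y -> K (x + y)) ->
  (forall k x, K x -> K (qmulX k x)) ->
  (forall u, homog par e u -> K (phi u)) ->
  (forall i, vpar par (e i) (w i)) -> K (eval_op d r qm psi phi w).
Proof.
move=> K0 KD KX hphi hw.
apply: (teval_closed (R := fun i => par (e i))
  (C := fun phi => forall u, homog par e u -> K (phi u))) => //.
- move=> [k|j] {}phi {}hphi u hu /=; first exact/KX/hphi.
  rewrite /opX; apply: (KD _ _).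
    by apply: big_ind => [|x y|a _]; [exact: K0|exact: KD|exact/KX/hphi].
  apply: hphi => i; rewrite /upd; case: eqP => [->|_]; last exact: hu.
  exact/d_even/hu.
- by move=> phi' v hphi' hv; exact: hphi' hv.
by move=> i b; exact: (vpar_vsubst _ (hw i) b).
Qed.

Variables (f f' : rawop d n) (g g' : forall i, rawop d (m i)).
Arguments g : clear implicits.
Arguments g' : clear implicits.
Hypotheses (hf : is_pcl f) (hf' : is_pcl f').

Lemma homog_reps (e : 'I_n -> bool) (x : forall i, Vlam d (m i)) :
  (forall i, Vlam_par par (e i) (x i)) ->
  exists w : forall i, vpoly V 'I_(m i),
    (forall i, lclass d (w i) = x i) /\ (forall i, vpar par (e i) (w i)).
Proof.
move=> hx; exists (fun i => vmap (sproj superV (e i)) (crepr (x i))).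
split=> i; last exact: vpar_vmap.
by rewrite -(wprojE superV d_even) lclass_crepr wproj_id.
Qed.

Lemma comp_op_par b (e : 'I_n -> bool) G v :
  (forall H u, homog par e u -> Vlam_par par (b (+) parity_sum e) (f H u)) ->
  (forall i, Vlam_par par (e i) (g i (inner r i G) (fun a => v (r i a)))) ->
  Vlam_par par (b (+) parity_sum e) (comp_op r blk f g G v).
Proof.
have VN := @Vlam_superspace F V par d superV d_even N.
move=> hfp hgp; have [hG|hG] := pselect (acyclic (outer r G)); last first.
  by rewrite comp_op_nacyclic //; apply: superspace0 VN _.
have [w [hw hwp]] := homog_reps hgp.
rewrite (comp_opE hb hf hG (ext_coboundary hb hG) hw).
apply: (@eval_op_closed _ _ _ e) => //.
- exact: superspace0 VN _.
- by move=> x y; apply: superspaceDr.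
- by move=> k x; apply: qmulX_par.
by move=> u hu; rewrite (pull_pb hb); apply/pb_par/hfp.
Qed.

(** The sign attached to f depends on the parities of its arguments, so it is a common factor only
    at tuples of fixed parities. Homogeneous representatives reduce to that case, and
    [eval_op_closed] with K = {0} is applied to the difference of the two sides. *)
Lemma comp_op_outer_scale (c : F) (e : 'I_n -> bool) G v :
  (forall u, homog par e u -> f (outer r G) u = c *: f' (outer r G) u) ->
  (forall i, Vlam_par par (e i) (g i (inner r i G) (fun a => v (r i a)))) ->
  comp_op r blk f g G v = c *: comp_op r blk f' g G v.
Proof.
move=> hff hgp; have [hG|hG] := pselect (acyclic (outer r G)); last first.
  by rewrite !comp_op_nacyclic // scaler0.
have [w [hw hwp]] := homog_reps hgp; have hext := ext_coboundary hb hG.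
rewrite (comp_opE hb hf hG hext hw) (comp_opE hb hf' hG hext hw).
apply: subr0_eq; rewrite addrC -scaleNr.
pose B x := eval_op d r qm (ext r blk G) x w.
have BP (a : F) x y : B (a *: x + y) = a *: B x + B y.
  exact: (eval_op_linear _ _ (@qmulC _ _ _ _)).
rewrite -/(B _) -/(B (pull r (f' _))) -BP.
apply: (@eval_op_closed _ _ (fun x => x = 0) e) => //.
- by move=> x y -> ->; rewrite addr0.
- by move=> k x ->; rewrite (oplin0 (@qmulX_linear F V d N k)).
move=> u hu.
rewrite -[LHS]/(- c *: pull r (f' (outer r G)) u + pull r (f (outer r G)) u).
rewrite !(pull_pb hb) hff // (oplinZ (@pb_linear F V d _ _ blk)).
by rewrite scaleNr addNr.
Qed.

Lemma comp_op_inner_scale (c : 'I_n -> F) G v :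
  (forall i, g i (inner r i G) (fun a => v (r i a))
             = c i *: g' i (inner r i G) (fun a => v (r i a))) ->
  comp_op r blk f g G v = (\prod_i c i) *: comp_op r blk f g' G v.
Proof.
move=> hgg; have [hG|hG] := pselect (acyclic (outer r G)); last first.
  by rewrite !comp_op_nacyclic // scaler0.
have hext := ext_coboundary hb hG; have hgood := pull_good hb (outer r G) hf.
pose w i := crepr (g' i (inner r i G) (fun a => v (r i a))).
have hw i : lclass d (w i) = g' i (inner r i G) (fun a => v (r i a)).
  by rewrite lclass_crepr.
rewrite (comp_opE hb hf hG hext (w := fun i => c i *: w i)); last first.
  by move=> i; rewrite linearZ /= hw hgg.
rewrite (comp_opE hb hf hG hext hw).
pose ev := eval_op d r qm (ext r blk G) (pull r (f (outer r G))).
(* Only the slots listed in s have been scaled. *)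
pose wk (s : seq 'I_n) i := if i \in s then c i *: w i else w i.
suff H s : uniq s -> ev (wk s) = (\prod_(i <- s) c i) *: ev w.
  have := H _ (enum_uniq 'I_n); rewrite big_enum /= => <-.
  congr ev; apply: functional_extensionality_dep => i.
  by rewrite /wk mem_enum.
elim: s => [_|j s IH /= /andP[js us]].
  by rewrite big_nil scale1r; congr ev; apply: functional_extensionality_dep.
rewrite big_cons -scalerA -IH //.
have -> : wk (j :: s) = dfwith (wk s) (c j *: w j).
  apply: functional_extensionality_dep => i; have [e|nij] := eqVneq j i.
    by case: _ / e; rewrite dfwith_in /wk inE eqxx.
  by rewrite dfwith_out // /wk inE eq_sym (negPf nij).
have {2}-> : wk s = dfwith (wk s) (w j).
  apply: functional_extensionality_dep => i; have [e|nij] := eqVneq j i.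
    by case: _ / e; rewrite dfwith_in /wk (negPf js).
  by rewrite dfwith_out.
pose A (x : vpoly V 'I_(m j)) := ev (dfwith (wk s) x).
have AP (a : F) x y : A (a *: x + y) = a *: A x + A y.
  exact: (eval_op_slot_linear _ _ (@qmulC _ _ _ _) _ _ _ _ _ hgood.1).
exact: (oplinZ AP).
Qed.

Lemma comp_op_linear_l (a : F) G v :
  comp_op r blk (a *: f + f') g G v
  = a *: comp_op r blk f g G v + comp_op r blk f' g G v.
Proof.
have [hG|hG] := pselect (acyclic (outer r G)); last first.
  by rewrite !comp_op_nacyclic // scaler0 addr0.
rewrite /comp_op !asboolT //.
rewrite -(eval_op_linear _ _ (@qmulC F V d N)).
by congr (eval_op _ _ _ _ _ _); apply/funext => u; rewrite /pull (qsubst_block_linear hb).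
Qed.

End HomogeneousComposition.

Lemma comp_op_linear_r (F : fieldType) (V : lmodType F) (d : {linear V -> V})
    (n : nat) (m : 'I_n -> nat) (N : nat)
    (r : forall i, 'I_(m i) -> 'I_N) (blk : 'I_N -> 'I_n)
    (f : rawop d n) (g : forall i, rawop d (m i)) i (a : F) (x y : rawop d (m i)) G v :
  blocks r blk -> is_pcl f ->
  comp_op r blk f (dfwith g (a *: x + y)) G v
  = a *: comp_op r blk f (dfwith g x) G v + comp_op r blk f (dfwith g y) G v.
Proof.
move=> hb hf; have [hG|hG] := pselect (acyclic (outer r G)); last first.
  by rewrite !comp_op_nacyclic // scaler0 addr0.
have hext := ext_coboundary hb hG; have hgood := pull_good hb (outer r G) hf.
pose val j (z : rawop d (m j)) := z (inner r j G) (fun b => v (r j b)).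
have E z : comp_op r blk f (dfwith g z) G v
    = evc r (ext r blk G) (pull r (f (outer r G))) (dfwith (fun j => val j (g j)) (val i z)).
  by rewrite /comp_op asboolT // -(dfwith_comp val).
by rewrite !E -(evc_slot_linear hb hext).
Qed.

(** * Koszul signs *)

Section TagnatOrder.
Variables (n : nat) (m : 'I_n -> nat).
Local Notation N := (\sum_(i < n) m i)%N.

Lemma Rank_blocks : blocks (fun i (a : 'I_(m i)) => tagnat.Rank i a) tagnat.sig1.
Proof.
split=> [i a|i a b /(congr1 val)/eqP|k]; first exact: tagnat.Rank1K.
  by rewrite /= tagnat.eq_Rank eqxx => /eqP/val_inj.
by exists (tagnat.sig2 k); rewrite tagnat.sig2K.
Qed.

Lemma Rank_lt i (a : 'I_(m i)) j (b : 'I_(m j)) : i != j ->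
  (tagnat.Rank i a < tagnat.Rank j b)%N = (i < j)%N.
Proof.
have aux i1 (a1 : 'I_(m i1)) i2 (b2 : 'I_(m i2)) : (i1 < i2)%N ->
    (tagnat.Rank i1 a1 < tagnat.Rank i2 b2)%N.
  move=> h; rewrite !tagnat.RankEsum; apply: leq_trans (leq_addr _ _).
  rewrite [X in (_ < X)%N](bigD1 i1) //= [X in (_ < X)%N]addnC -addnS.
  apply: leq_add (ltn_ord a1).
  rewrite big_mkcond [X in (_ <= X)%N]big_mkcond; apply: leq_sum => k _.
  case: ifP => // hk; rewrite (ltn_trans hk h) /=.
  by rewrite -val_eqE neq_ltn hk.
rewrite -val_eqE neq_ltn => /orP[h|h]; first by rewrite h aux.
by rewrite ltnNge (ltnW (aux _ _ _ _ h)) ltnNge (ltnW h).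
Qed.

Lemma Rank_lt_same i (a b : 'I_(m i)) :
  (tagnat.Rank i a < tagnat.Rank i b)%N = (a < b)%N.
Proof. by rewrite !tagnat.RankEsum ltn_add2l. Qed.

End TagnatOrder.

(** The two iterated numberings live in different ordinals but both count what precedes: whole outer
    blocks, then earlier inner blocks, then elements. This supplies the compatibility condition for
    associativity. *)
Lemma Rank_Rank n (m : 'I_n -> nat) (l : 'I_(\sum_(i < n) m i) -> nat) i
    (j : 'I_(m i)) (a : 'I_(l (tagnat.Rank i j))) :
  (@tagnat.Rank n (fun i => \sum_(j < m i) l (tagnat.Rank i j))%N i
     (@tagnat.Rank _ (fun j => l (tagnat.Rank i j)) j a)
   = tagnat.Rank (tagnat.Rank i j) a :> nat)%N.
Proof.
rewrite tagnat.RankEsum [X in (_ + X)%N = _]tagnat.RankEsum [RHS]tagnat.RankEsum.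
rewrite addnA; congr (_ + _)%N.
rewrite [RHS]big_mkcond (sum_blocks (Rank_blocks m)).
rewrite [RHS](bigID (fun i' : 'I_n => (i' < i)%N)).
congr (_ + _)%N.
  apply: eq_bigr => i' hi'; apply: eq_bigr => j' _.
  by rewrite Rank_lt ?hi' // -val_eqE neq_ltn hi'.
rewrite (bigD1 i) ?ltnn //= [X in (_ + X)%N]big1 ?addn0 => [|i' /andP[h1 h2]].
  by rewrite big_mkcond; apply: eq_bigr => j' _; rewrite Rank_lt_same.
by rewrite big1 // => j' _; rewrite Rank_lt // (negPf h1).
Qed.

Section Signs.

Lemma odd_sum (I : Type) (s : seq I) (P : pred I) (E : I -> nat) :
  odd (\sum_(i <- s | P i) E i) = \big[addb/false]_(i <- s | P i) odd (E i).
Proof. exact: (big_morph odd oddD). Qed.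

Lemma parity_sumE (I : finType) (p : I -> bool) :
  parity_sum p = \big[addb/false]_i p i.
Proof. by rewrite /parity_sum odd_sum; apply: eq_bigr => i _; rewrite oddb. Qed.

Lemma parity_sum_blocks n (m : 'I_n -> nat) N (r : forall i, 'I_(m i) -> 'I_N) blk
    (q : 'I_N -> bool) : blocks r blk ->
  parity_sum q = parity_sum (fun i => parity_sum (fun a => q (r i a))).
Proof.
move=> hb; rewrite !parity_sumE (sum_blocks hb).
by apply: eq_bigr => i _; rewrite parity_sumE.
Qed.

Lemma parity_sum_addb (I : finType) (p q : I -> bool) :
  parity_sum (fun i => p i (+) q i) = parity_sum p (+) parity_sum q.
Proof. by rewrite !parity_sumE big_split. Qed.

Lemma eq_parity_sum (I : finType) (p q : I -> bool) :
  p =1 q -> parity_sum p = parity_sum q.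
Proof. by move=> h; rewrite !parity_sumE; apply: eq_bigr => i _. Qed.

Lemma andb_big (I : finType) (p : I -> bool) b :
  b && \big[addb/false]_i p i = \big[addb/false]_i (b && p i).
Proof. by case: b; rewrite //= big1. Qed.

Lemma andb_big2 (I J : finType) (p : I -> bool) (q : J -> bool) :
  \big[addb/false]_i p i && \big[addb/false]_j q j
  = \big[addb/false]_i \big[addb/false]_j (p i && q j).
Proof.
by rewrite andbC andb_big; apply: eq_bigr => i _; rewrite andbC andb_big.
Qed.

Lemma sign_prod (F : fieldType) (I : finType) (b : I -> bool) :
  \prod_i (-1) ^+ b i = (-1) ^+ parity_sum b :> F.
Proof.
rewrite parity_sumE; apply/esym.
by apply: (big_morph (fun b : bool => (-1) ^+ b : F) (@signr_addb F)).
Qed.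

(** Koszul exponents in F_2, with [addb] as sum and [andb] as product. [kblocks] is bilinear, and
    the arguments of a block enter it only through their total parity. *)
Definition kblocks n (p q : 'I_n -> bool) : bool :=
  \big[addb/false]_(j < n) \big[addb/false]_(i < n) [&& (i < j)%N, p j & q i].

Definition kperm n (s : 'S_n) (p : 'I_n -> bool) : bool :=
  \big[addb/false]_(i < n) \big[addb/false]_(j < n) [&& (i < j)%N, (s j < s i)%N, p i & p j].

Lemma koszul_blocksE n (m : 'I_n -> nat) p q :
  @koszul_blocks n m p q
  = kblocks p (fun i => parity_sum (fun a => q (tagnat.Rank i a))).
Proof.
rewrite /koszul_blocks odd_sum; apply: eq_bigr => j _.
rewrite odd_sum big_mkcond; apply: eq_bigr => i _.
rewrite odd_sum parity_sumE; case: (i < j)%N => //=; rewrite andb_big.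
by apply: eq_bigr => a _; rewrite oddM !oddb.
Qed.

Lemma koszul_permE n (s : 'S_n) p : koszul_perm s p = kperm s p.
Proof.
rewrite /koszul_perm odd_sum; apply: eq_bigr => i _.
rewrite odd_sum big_mkcond; apply: eq_bigr => j _.
by case: (i < j)%N => //=; case: (s j < s i)%N; rewrite //= oddM !oddb.
Qed.

Lemma kblocks_addl n (p p' q : 'I_n -> bool) :
  kblocks (fun i => p i (+) p' i) q = kblocks p q (+) kblocks p' q.
Proof.
rewrite /kblocks -big_split; apply: eq_bigr => j _; rewrite -big_split.
by apply: eq_bigr => i _ /=; case: (_ < _)%N; rewrite //= andb_addl.
Qed.

Lemma kblocks_addr n (p q q' : 'I_n -> bool) :
  kblocks p (fun i => q i (+) q' i) = kblocks p q (+) kblocks p q'.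
Proof.
rewrite /kblocks -big_split; apply: eq_bigr => j _; rewrite -big_split.
by apply: eq_bigr => i _ /=; case: (_ < _)%N; rewrite //= andb_addr.
Qed.

Lemma eq_kblocks n (p p' q q' : 'I_n -> bool) :
  p =1 p' -> q =1 q' -> kblocks p q = kblocks p' q'.
Proof.
by move=> hp hq; apply: eq_bigr => j _; apply: eq_bigr => i _; rewrite hp hq.
Qed.

Lemma eq_kperm n (s : 'S_n) p p' : p =1 p' -> kperm s p = kperm s p'.
Proof. by move=> hp; apply: eq_bigr => i _; apply: eq_bigr => j _; rewrite !hp. Qed.

(** The numbering is lexicographic: pairs from distinct blocks are ordered as their blocks, pairs
    from the same block as their positions. *)
Lemma sum_lt_blocks n (m : 'I_n -> nat) (N := (\sum_(i < n) m i)%N)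
    (E : 'I_N -> 'I_N -> bool) :
  \big[addb/false]_(k < N) \big[addb/false]_(l < N) ((l < k)%N && E k l)
  = (\big[addb/false]_(j < n) \big[addb/false]_(i < n)
       ((i < j)%N && \big[addb/false]_(b < m j) \big[addb/false]_(a < m i)
         E (tagnat.Rank j b) (tagnat.Rank i a)))
    (+) \big[addb/false]_(i < n) \big[addb/false]_(b < m i) \big[addb/false]_(a < m i)
         ((a < b)%N && E (tagnat.Rank i b) (tagnat.Rank i a)).
Proof.
rewrite (sum_blocks (Rank_blocks m)) -big_split; apply: eq_bigr => j _ /=.
rewrite (eq_bigr (fun b => \big[addb/false]_(i < n) \big[addb/false]_(a < m i)
   ((tagnat.Rank i a < tagnat.Rank j b)%N
      && E (tagnat.Rank j b) (tagnat.Rank i a)))); last first.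
  by move=> b _; rewrite (sum_blocks (Rank_blocks m)).
rewrite exchange_big (bigD1 j) //= [in RHS](bigD1 j) //= ltnn /= addbC.
congr addb.
  apply: eq_bigr => i nij; rewrite andb_big; apply: eq_bigr => b _.
  by rewrite andb_big; apply: eq_bigr => a _; rewrite Rank_lt.
by apply: eq_bigr => b _; apply: eq_bigr => a _; rewrite Rank_lt_same.
Qed.

Lemma kblocks_nested n (m : 'I_n -> nat) (q R : 'I_(\sum_(i < n) m i)%N -> bool) :
  kblocks q R
  = kblocks (fun i => parity_sum (fun a => q (tagnat.Rank i a)))
            (fun i => parity_sum (fun a => R (tagnat.Rank i a)))
    (+) parity_sum (fun i => kblocks (fun a => q (tagnat.Rank i a))
                                     (fun a => R (tagnat.Rank i a))).
Proof.
rewrite [LHS](sum_lt_blocks (fun k l => q k && R l)); congr addb; last first.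
  by rewrite parity_sumE.
apply: eq_bigr => j _; apply: eq_bigr => i _; congr andb; rewrite !parity_sumE.
rewrite andbC andb_big; apply: eq_bigr => b _.
by rewrite andbC andb_big.
Qed.

(** A symmetric function summed over unordered pairs does not see a permutation. Doubling gives a
    sum over ordered pairs of distinct indices, which can be reindexed; it would lose everything
    modulo 2, so it is carried out in [nat] and the parity is taken at the end. *)
Lemma sum_lt_perm n (t : 'S_n) (h : 'I_n -> 'I_n -> bool) :
  (forall i j, h i j = h j i) ->
  \big[addb/false]_(i < n) \big[addb/false]_(j < n) ((i < j)%N && h (t i) (t j))
  = \big[addb/false]_(i < n) \big[addb/false]_(j < n) ((i < j)%N && h i j).
Proof.
move=> hsym.
pose S (h : 'I_n -> 'I_n -> bool) := (\sum_(i < n) \sum_(j < n) ((i < j) && h i j))%N.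
have SE h' :
    \big[addb/false]_(i < n) \big[addb/false]_(j < n) ((i < j)%N && h' i j)
    = odd (S h').
  rewrite odd_sum; apply: eq_bigr => i _; rewrite odd_sum.
  by apply: eq_bigr => j _; rewrite oddb.
rewrite !SE; congr odd.
have dbl h' : (forall i j, h' i j = h' j i) ->
    ((S h').*2 = \sum_i \sum_j ((i != j) && h' i j))%N.
  move=> hs; rewrite -addnn {2}/S exchange_big -big_split.
  apply: eq_bigr => i _; rewrite -big_split; apply: eq_bigr => j _ /=.
  by rewrite -val_eqE (hs j i); case: ltngtP; rewrite /= ?addn0.
apply: double_inj; rewrite !dbl //.
rewrite [RHS](reindex_inj (@perm_inj _ t)); apply: eq_bigr => i _.
rewrite [RHS](reindex_inj (@perm_inj _ t)); apply: eq_bigr => j _.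
by rewrite (inj_eq (@perm_inj _ t)).
Qed.

(** A pair is inverted by the composite exactly when it is inverted by one of the two steps but not
    by both. The function h records the inversions of s symmetrically, so that [sum_lt_perm] brings
    them back to the original positions. *)
Lemma kperm_comp n (s t : 'S_n) p :
  kperm (t * s)%g p = kperm t p (+) kperm s (fun i => p (t^-1%g i)).
Proof.
pose h (i j : 'I_n) := (((i < j) != (s i < s j)) && (p (t^-1%g i) && p (t^-1%g j)))%N.
have hsym i j : h i j = h j i.
  rewrite /h [p _ && _]andbC; have [->//|nij] := eqVneq i j.
  have nsij : s i != s j by rewrite (inj_eq (@perm_inj _ s)).
  move: nij nsij; rewrite -!val_eqE.
  by case: (ltngtP i j) => // _ _; case: (ltngtP (s i) (s j)).
have -> : kperm s (fun i => p (t^-1%g i))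
    = \big[addb/false]_(i < n) \big[addb/false]_(j < n) ((i < j)%N && h i j).
  apply: eq_bigr => i _; apply: eq_bigr => j _; rewrite /h.
  case: (ltngtP i j) => //= hij; congr andb.
  have nsij : s i != s j by rewrite (inj_eq (@perm_inj _ s)) -val_eqE neq_ltn hij.
  by move: nsij; rewrite -val_eqE; case: (ltngtP (s i) (s j)).
rewrite -(sum_lt_perm t hsym) /kperm -big_split; apply: eq_bigr => i _ /=.
rewrite -big_split; apply: eq_bigr => j _ /=; rewrite /h !permK !permM.
case: (ltngtP i j) => //= hij; rewrite -andb_addl; congr andb.
have ntij : t i != t j by rewrite (inj_eq (@perm_inj _ t)) -val_eqE neq_ltn hij.
have nsij : s (t i) != s (t j) by rewrite !(inj_eq (@perm_inj _ _)) -val_eqE neq_ltn hij.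
move: ntij nsij; rewrite -!val_eqE.
by case: (ltngtP (t i) (t j)) => // _ _; case: (ltngtP (s (t i)) (s (t j))).
Qed.

Lemma kperm1 n (p : 'I_n -> bool) : kperm 1%g p = false.
Proof.
rewrite /kperm big1 // => i _; rewrite big1 // => j _; rewrite !perm1.
by case: ltngtP.
Qed.

(** Expanding the quadratic exponent of p + Q leaves the mixed terms X, that is, p_j Q_i for every
    inverted pair. Added to the terms with i < j they yield the terms with s i < s j, which is the
    exponent after the permutation. *)
Lemma kperm_equivariant n (s : 'S_n) (p Q : 'I_n -> bool) :
  kblocks p Q (+) kperm s (fun i => p i (+) Q i)
  = kperm s p (+) kperm s Q
    (+) kblocks (fun i => p (s^-1%g i)) (fun i => Q (s^-1%g i)).
Proof.
have -> : kblocks (fun i => p (s^-1%g i)) (fun i => Q (s^-1%g i))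
    = \big[addb/false]_(j < n) \big[addb/false]_(i < n) [&& (s i < s j)%N, p j & Q i].
  rewrite /kblocks (reindex_inj (@perm_inj _ s)); apply: eq_bigr => j _ /=.
  rewrite (reindex_inj (@perm_inj _ s)); apply: eq_bigr => i _ /=.
  by rewrite !permK.
pose X := \big[addb/false]_(j < n) \big[addb/false]_(i < n)
   ([&& (i < j)%N, (s j < s i)%N, p j & Q i] (+) [&& (j < i)%N, (s i < s j)%N, p j & Q i]).
have -> : kperm s (fun i => p i (+) Q i) = kperm s p (+) kperm s Q (+) X.
  rewrite /X; under [in RHS]eq_bigr do rewrite big_split.
  rewrite big_split /= [X in _ = _ (+) (X (+) _)]exchange_big /kperm -!big_split.
  apply: eq_bigr => i _ /=; rewrite -!big_split; apply: eq_bigr => j _ /=.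
  by case: (i < j)%N; case: (s j < s i)%N; case: (p i); case: (p j); case: (Q i); case: (Q j).
rewrite addbCA; congr addb; rewrite /X /kblocks -big_split; apply: eq_bigr => j _ /=.
rewrite -big_split; apply: eq_bigr => i _ /=.
have [->|nij] := eqVneq i j; first by rewrite !ltnn.
have nsij : s i != s j by rewrite (inj_eq (@perm_inj _ s)).
move: nij nsij; rewrite -!val_eqE.
case: (ltngtP i j) => // _ _; case: (ltngtP (s i) (s j)) => // _ _;
  by case: (p j); case: (Q i).
Qed.

(** The inversions of beta are those of s between distinct blocks and those of t i within block
    i. *)
Lemma kperm_blocks n (m : 'I_n -> nat) (N := (\sum_(i < n) m i)%N)
    (s : 'S_n) (t : forall i, 'S_(m i)) (beta : 'S_N) (q : 'I_N -> bool) :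
  (forall i (a : 'I_(m i)) j (b : 'I_(m j)), i != j ->
     (beta (tagnat.Rank i a) < beta (tagnat.Rank j b))%N = (s i < s j)%N) ->
  (forall i (a b : 'I_(m i)),
     (beta (tagnat.Rank i a) < beta (tagnat.Rank i b))%N = (t i a < t i b)%N) ->
  kperm beta q
  = kperm s (fun i => parity_sum (fun a => q (tagnat.Rank i a)))
    (+) parity_sum (fun i => kperm (t i) (fun a => q (tagnat.Rank i a))).
Proof.
move=> h1 h2; have swap k (u : 'S_k) p : kperm u p
    = \big[addb/false]_(j < k) \big[addb/false]_(i < k)
        ((i < j)%N && ((u j < u i)%N && (p j && p i))).
  rewrite /kperm exchange_big; apply: eq_bigr => j _; apply: eq_bigr => i _ /=.
  by rewrite [p j && _]andbC.
rewrite swap (sum_lt_blocks (fun k l => (beta k < beta l)%N && (q k && q l))).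
congr addb.
  rewrite swap; apply: eq_bigr => j _; apply: eq_bigr => i _.
  have [->|nij] := eqVneq j i; first by rewrite ltnn.
  congr andb; rewrite !parity_sumE andb_big2 andb_big; apply: eq_bigr => b _.
  by rewrite andb_big; apply: eq_bigr => a _; rewrite h1.
rewrite parity_sumE; apply: eq_bigr => i _; rewrite swap.
by apply: eq_bigr => b _; apply: eq_bigr => a _; rewrite h2.
Qed.

End Signs.

(** * The superoperad structure *)

Section PclOperations.
Variables (F : fieldType) (V : lmodType F) (par : bool -> V -> Prop).
Variable d : {linear V -> V}.
Hypothesis char0 : [pchar F] =i pred0.
Hypothesis superV : is_superspace par.
Hypothesis d_even : forall b v, par b v -> par b (d v).
Local Notation P := (Pcl d).
Local Notation ppar := (Pcl_par (d := d) par).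
Local Notation homog := (homog par).

Lemma pclP n (f : P n) : is_pcl (pcl_val f).
Proof. exact/asboolP/(pcl_valP f). Qed.

Definition mk_pcl n (f : rawop d n) (hf : is_pcl f) : P n := Pcl_of (asboolT hf).

Lemma pcl_eq n (f g : P n) : pcl_val f = pcl_val g -> f = g.
Proof. exact: val_inj. Qed.

Lemma valE n (f : P n) : val f = pcl_val f.
Proof. by []. Qed.

Lemma pcl_valD n (f g : P n) : pcl_val (f + g) = pcl_val f + pcl_val g.
Proof. by rewrite -!valE -raddfD. Qed.

Lemma pcl_val0 n : pcl_val (0 : P n) = 0.
Proof. by rewrite -!valE raddf0. Qed.

Lemma pcl_valZ n (a : F) (f : P n) : pcl_val (a *: f) = a *: pcl_val f.
Proof. by rewrite -!valE -linearZ. Qed.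

Lemma pcl_val_sum n (I : Type) (s : seq I) (Q : pred I) (f : I -> P n) G v :
  pcl_val (\sum_(i <- s | Q i) f i) G v = \sum_(i <- s | Q i) pcl_val (f i) G v.
Proof.
rewrite (big_morph (fun f : P n => pcl_val f G v) (id1 := 0) (op1 := +%R)).
- by [].
- by move=> x y; rewrite pcl_valD.
by rewrite pcl_val0.
Qed.

Lemma pcl_homog_eq n (f g : P n) :
  (forall G q v, homog q v -> pcl_val f G v = pcl_val g G v) -> f = g.
Proof.
move=> h; apply: pcl_eq; apply/funext => G.
apply: (multilinear_homog superV) => [||q v]; last exact: h.
  exact/pcl_multilinear/pclP.
exact/pcl_multilinear/pclP.
Qed.

Definition twist_pclP n c (f : P n) : P n := mk_pcl (twist_pcl superV d_even c (pclP f)).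

Lemma pcl_superspace n : is_superspace (@Pcl_par F V d par n).
Proof.
have VN := Vlam_superspace superV d_even n.
split=> [b G v q hq|b a f g hf hg G v q hq|f|f h0 h1].
- by rewrite pcl_val0; apply: superspace0 VN _.
- rewrite pcl_valD pcl_valZ.
  by apply: (superspaceD VN); [apply: hf|apply: hg].
(* The component of parity b takes, at arguments of parities q, the part of the value of parity b +
   |q|: [c b e] selects the q for which this parity is e, and the values there are projected to
   parity e. *)
- pose c b e (q : {ffun 'I_n -> bool}) : F := (e == b (+) parity_sum q)%:R.
  pose fb b : P n :=
    mk_pcl (wproj_pcl superV d_even false (twist_pcl superV d_even (c b false) (pclP f)))
    + mk_pcl (wproj_pcl superV d_even true (twist_pcl superV d_even (c b true) (pclP f))).
  have fbE b G v q : homog q v ->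
      pcl_val (fb b) G v = wproj superV (b (+) parity_sum q) (pcl_val f G v).
    move=> hq; rewrite /fb pcl_valD.
    rewrite -[LHS]/(wproj superV false (twist superV (c b false) (pcl_val f) G v)
      + wproj superV true (twist superV (c b true) (pcl_val f) G v)).
    rewrite !(twist_homog superV _ _ (pclP f) hq) /c.
    have -> : parity_sum [ffun i => q i] = parity_sum q.
      by apply: eq_parity_sum => i; rewrite ffunE.
    have wlin := wproj_linear superV d_even (n := n).
    by case: (b (+) _); rewrite scale1r scale0r (oplin0 (wlin _)) ?addr0 ?add0r.
  exists (fb false), (fb true); split.
  - by move=> G v q hq; rewrite (fbE _ _ _ _ hq); apply: wproj_par.
  - by move=> G v q hq; rewrite (fbE _ _ _ _ hq); apply: wproj_par.
  apply: pcl_homog_eq => G q v hq; rewrite pcl_valD.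
  rewrite -[RHS]/(pcl_val (fb false) G v + pcl_val (fb true) G v) !(fbE _ _ _ _ hq).
  by case: (parity_sum q); rewrite /= -[LHS](wprojD superV) // addrC.
apply: pcl_homog_eq => G q v hq; rewrite pcl_val0.
apply: (superspace_direct VN); have := (h0 G v q hq); have := (h1 G v q hq).
  by case: (parity_sum q).
by case: (parity_sum q).
Qed.

Section Composition.
Variables (n : nat) (m : 'I_n -> nat).
Local Notation N := (\sum_(i < n) m i)%N.
Local Notation Rk := (fun i (a : 'I_(m i)) => tagnat.Rank i a).
Local Notation hR := (Rank_blocks m).

Definition compP (f : P n) (g : forall i, P (m i)) : P N :=
  mk_pcl (comp_op_pcl char0 hR (pclP f) (fun i => pclP (g i))).

(* The sign depends on the parities of the g_i, hence the sum over their
   homogeneous components. *)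
Definition socompP (f : P n) (g : forall i, P (m i)) : P N :=
  \sum_(p : {ffun 'I_n -> bool})
    twist_pclP (fun q => (-1) ^+ koszul_blocks p q)
      (compP f (fun i => sproj (pcl_superspace (m i)) (p i) (g i))).

Lemma twist_pclP_linear k c : linear (@twist_pclP k c).
Proof.
move=> a f g; apply: pcl_homog_eq => G q v hq; rewrite pcl_valD pcl_valZ.
have E (h : P k) : pcl_val (twist_pclP c h) G v = c [ffun i => q i] *: pcl_val h G v.
  exact: (twist_homog superV c G (pclP h) hq).
rewrite -[RHS]/(a *: pcl_val (twist_pclP c f) G v + pcl_val (twist_pclP c g) G v).
rewrite !E pcl_valD pcl_valZ.
rewrite -[X in c _ *: X]/(a *: pcl_val f G v + pcl_val g G v).
by rewrite scalerDr !scalerA mulrC.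
Qed.

Lemma compP_linear_l (a : F) f f' g : compP (a *: f + f') g = a *: compP f g + compP f' g.
Proof.
apply: pcl_eq; rewrite pcl_valD pcl_valZ; apply/funext => G; apply/funext => v.
rewrite -[RHS]/(a *: comp_op Rk tagnat.sig1 (pcl_val f) (fun i => pcl_val (g i)) G v
  + comp_op Rk tagnat.sig1 (pcl_val f') (fun i => pcl_val (g i)) G v).
rewrite -(comp_op_linear_l hR) -[LHS]/(comp_op Rk tagnat.sig1 _ _ G v).
by rewrite pcl_valD pcl_valZ.
Qed.

Lemma compP_linear_r f (g : forall i, P (m i)) i (a : F) (x y : P (m i)) :
  compP f (dfwith g (a *: x + y)) = a *: compP f (dfwith g x) + compP f (dfwith g y).
Proof.
apply: pcl_eq; rewrite pcl_valD pcl_valZ; apply/funext => G; apply/funext => v.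
have E z : pcl_val (compP f (dfwith g z)) G v
    = comp_op Rk tagnat.sig1 (pcl_val f)
        (@dfwith _ (fun i => rawop d (m i)) (fun i => pcl_val (g i)) i (pcl_val z)) G v.
  by rewrite -(dfwith_comp (fun i (z : P (m i)) => pcl_val z : rawop d (m i))).
rewrite -[RHS]/(a *: pcl_val (compP f (dfwith g x)) G v + pcl_val (compP f (dfwith g y)) G v).
rewrite !E pcl_valD pcl_valZ.
exact: (comp_op_linear_r _ _ _ _ _ _ hR (pclP f)).
Qed.

Lemma socompP_linear_l (a : F) f f' g :
  socompP (a *: f + f') g = a *: socompP f g + socompP f' g.
Proof.
rewrite /socompP scaler_sumr -big_split; apply: eq_bigr => p _ /=.
by rewrite compP_linear_l twist_pclP_linear.
Qed.

Lemma socompP_linear_r f (g : forall i, P (m i)) i (a : F) (x y : P (m i)) :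
  socompP f (dfwith g (a *: x + y))
  = a *: socompP f (dfwith g x) + socompP f (dfwith g y).
Proof.
rewrite /socompP scaler_sumr -big_split; apply: eq_bigr => p _ /=.
rewrite !(dfwith_comp (fun j => sproj (pcl_superspace (m j)) (p j))).
by rewrite sproj_linear compP_linear_r twist_pclP_linear.
Qed.

Lemma socompP_homog f (g : forall i, P (m i)) p G q v :
  (forall i, ppar (p i) (g i)) -> homog q v ->
  pcl_val (socompP f g) G v
  = (-1) ^+ kblocks p (fun i => parity_sum (fun a => q (tagnat.Rank i a)))
      *: comp_op Rk tagnat.sig1 (pcl_val f) (fun i => pcl_val (g i)) G v.
Proof.
move=> hp hq; rewrite /socompP pcl_val_sum (bigD1 [ffun i => p i]) //= [X in _ + X]big1 ?addr0.
  rewrite -[LHS]/(twist superV _ (pcl_val (compP f _)) G v).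
  rewrite (twist_homog superV _ G (pclP _) hq) koszul_blocksE; congr (_ *: _).
    congr (_ ^+ nat_of_bool _); apply: eq_kblocks => i; first by rewrite ffunE.
    by apply: eq_parity_sum => a; rewrite ffunE.
  rewrite -[LHS]/(comp_op Rk tagnat.sig1 _ _ G v); congr (comp_op _ _ _ _ _ _).
  by apply: functional_extensionality_dep => i; rewrite ffunE sproj_id.
move=> p' np; have [i hi] : exists i, p i != p' i.
  apply: contrapT => /forallNP h; case/eqP: np; apply/ffunP => i; rewrite ffunE.
  by apply/esym/eqP/negPn/negP/h.
rewrite -[LHS]/(twist superV _ (pcl_val (compP f _)) G v).
rewrite (twist_homog superV _ G (pclP _) hq).
rewrite -[X in _ *: X]/(comp_op Rk tagnat.sig1 _ _ G v).
rewrite (comp_op_slot0 hR (pclP f) (i := i)) ?scaler0 //.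
by rewrite (sproj_other _ (hp i) hi) pcl_val0.
Qed.

Lemma homog_block (q : 'I_N -> bool) (v : 'I_N -> V) i :
  homog q v -> homog (fun a => q (tagnat.Rank i a)) (fun a => v (tagnat.Rank i a)).
Proof. by move=> h a; apply: h. Qed.

Lemma compP_par f (g : forall i, P (m i)) p e G q v :
  ppar p f -> (forall i, ppar (e i) (g i)) -> homog q v ->
  Vlam_par par ((p (+) parity_sum e) (+) parity_sum q)
    (comp_op Rk tagnat.sig1 (pcl_val f) (fun i => pcl_val (g i)) G v).
Proof.
move=> hf hg hq; pose e' i := e i (+) parity_sum (fun a => q (tagnat.Rank i a)).
rewrite (parity_sum_blocks _ hR) -addbA -parity_sum_addb -/e'.
apply: (comp_op_par superV d_even hR (pclP f)) => [H u hu|i].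
  exact: hf.
by apply: hg; apply: homog_block.
Qed.

Lemma socompP_par f (g : forall i, P (m i)) p e :
  ppar p f -> (forall i, ppar (e i) (g i)) ->
  ppar (p (+) parity_sum e) (socompP f g).
Proof.
move=> hf hg G v q hq; rewrite (socompP_homog _ _ hg hq).
apply: (superspaceZ (Vlam_superspace superV d_even N)).
exact: compP_par.
Qed.

End Composition.

Section Action.
Variable n : nat.

Definition soactP (s : 'S_n) (f : P n) : P n :=
  twist_pclP (fun q => (-1) ^+ koszul_perm s q) (mk_pcl (act_op_pcl s (pclP f))).

Lemma soactP_homog s f G q v : homog q v ->
  pcl_val (soactP s f) G v = (-1) ^+ kperm s q *: act_op s (pcl_val f) G v.
Proof.
move=> hq; rewrite -[LHS]/(twist superV _ (act_op s (pcl_val f)) G v).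
rewrite (twist_homog superV _ G (act_op_pcl s (pclP f)) hq) koszul_permE.
congr (_ ^+ nat_of_bool _ *: _); apply: eq_kperm => i.
by rewrite ffunE.
Qed.

Lemma soactP_linear s (a : F) f f' :
  soactP s (a *: f + f') = a *: soactP s f + soactP s f'.
Proof.
apply: pcl_homog_eq => G q v hq; rewrite pcl_valD pcl_valZ.
rewrite -[RHS]/(a *: pcl_val (soactP s f) G v + pcl_val (soactP s f') G v).
rewrite !(soactP_homog _ _ _ hq) /act_op pcl_valD pcl_valZ.
rewrite -[X in pb s X]/(a *: pcl_val f (relabel s G) _ + pcl_val f' (relabel s G) _).
by rewrite (@pb_linear F V d) scalerDr !scalerA mulrC.
Qed.

Lemma homog_perm (s : 'S_n) q v : homog q v ->
  homog (fun i => q (s^-1%g i)) (fun i => v (s^-1%g i)).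
Proof. by move=> h i; apply: h. Qed.

Lemma parity_sum_perm (s : 'S_n) q : parity_sum (fun i => q (s^-1%g i)) = parity_sum q.
Proof. by rewrite !parity_sumE [RHS](reindex_inj (@perm_inj _ s^-1%g)). Qed.

Lemma act_op_par s b (f : P n) G q v : ppar b f -> homog q v ->
  Vlam_par par (b (+) parity_sum q) (act_op s (pcl_val f) G v).
Proof.
move=> hf hq; rewrite -(parity_sum_perm s); refine (pb_par superV (d := d) _ _).
by apply: hf; apply: homog_perm.
Qed.

Lemma soactP_par s b f : ppar b f -> ppar b (soactP s f).
Proof.
move=> hf G v q hq; rewrite (soactP_homog _ _ _ hq).
apply: (superspaceZ (Vlam_superspace superV d_even n)).
exact: act_op_par.
Qed.

Lemma soactP_1 f : soactP 1%g f = f.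
Proof.
apply: pcl_homog_eq => G q v hq; rewrite (soactP_homog _ _ _ hq) kperm1 scale1r.
rewrite /act_op relabel1.
have -> : (fun i => v ((1 : 'S_n)^-1%g i)) = v.
  by apply/funext => i; rewrite invg1 perm1.
refine (etrans (congr1 (fun h => pb h (pcl_val f G v)) _) (pb_id _)).
by apply/funext => i; rewrite perm1.
Qed.

Lemma soactP_comp s t f : soactP t (soactP s f) = soactP (t * s)%g f.
Proof.
apply: pcl_homog_eq => G q v hq; rewrite !(soactP_homog _ _ _ hq) {1}/act_op.
rewrite (soactP_homog _ _ _ (homog_perm t hq)) (oplinZ (@pb_linear F V d _ _ t)).
rewrite scalerA -signr_addb -kperm_comp; congr (_ *: _).
rewrite /act_op pb_comp relabel_comp.
have -> : (fun i => v (t^-1%g (s^-1%g i))) = (fun i => v ((t * s)^-1%g i)).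
  by apply/funext => i; rewrite invMg permM.
refine (congr1 (fun h => pb h _) _).
by apply/funext => i; rewrite /= permM.
Qed.

End Action.

Definition sounitP : P 1 := mk_pcl (unit_op_pcl d).

Lemma sounitP_par : ppar false sounitP.
Proof.
move=> G v q hq; exists (vconst 'I_1 (v ord0)); split=> // k.
rewrite vcoeffU parity_sumE big_ord1 /=; case: eqP => _; first exact: hq.
by rewrite mulr0n; apply: superspace0 superV _.
Qed.

End PclOperations.

Lemma blocks_cast n (m : 'I_n -> nat) N (r : forall i, 'I_(m i) -> 'I_N)
    (blk : 'I_N -> 'I_n) K (e : N = K) :
  blocks r blk ->
  blocks (fun i a => cast_ord e (r i a)) (fun k => blk (cast_ord (esym e) k)).
Proof.
case: K / e => hb; split=> [i a|i a b|k].
- by rewrite cast_ordK (blocksK hb).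
- by move/cast_ord_inj/(blocks_inj hb).
have [a ha] := blocks_surj hb (cast_ord (esym (erefl N)) k).
by exists a; rewrite ha; apply: val_inj.
Qed.

Lemma block_perm_Rank n (m : 'I_n -> nat) (s : 'S_n) (t : forall i, 'S_(m i)) i
    (a : 'I_(m i)) :
  block_perm s t (tagnat.Rank i a)
  = cast_ord (dim_perm m s)
      (tagnat.Rank (s i) (cast_ord (block_perm_dim m s i) (t i a))).
Proof.
by rewrite permE /block_perm_fun /tagnat.sig1 /tagnat.sig2 !tagnat.rankK.
Qed.

Lemma eq_Rank_nat n (m : 'I_n -> nat) i j (a : 'I_(m i)) (b : 'I_(m j)) :
  i = j -> a = b :> nat -> tagnat.Rank i a = tagnat.Rank j b :> nat.
Proof. by move=> e; case: _ / e b => b /val_inj ->. Qed.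

Section PclLaws.
Variables (F : fieldType) (V : lmodType F) (par : bool -> V -> Prop).
Variable d : {linear V -> V}.
Hypothesis char0 : [pchar F] =i pred0.
Hypothesis superV : is_superspace par.
Hypothesis d_even : forall b v, par b v -> par b (d v).
Local Notation P := (Pcl d).
Local Notation ppar := (Pcl_par (d := d) par).
Local Notation homog := (homog par).
Local Notation socomp := (socompP char0 superV d_even).

(** The cast is absorbed by the numbering of the blocks, which is arbitrary in [comp_op]. *)
Lemma ecast_socompP n (m : 'I_n -> nat) K (e : (\sum_(i < n) m i)%N = K)
    (f : P n) (g : forall i, P (m i)) p G q v :
  (forall i, ppar (p i) (g i)) -> homog q v ->
  pcl_val (ecast N (P N) e (socomp f g)) G v
  = (-1) ^+ kblocks p
        (fun i => parity_sum (fun a => q (cast_ord e (tagnat.Rank i a))))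
      *: comp_op (fun i (a : 'I_(m i)) => cast_ord e (tagnat.Rank i a))
           (fun k => tagnat.sig1 (cast_ord (esym e) k))
           (pcl_val f) (fun i => pcl_val (g i)) G v.
Proof.
case: K / e in G q v *; move=> hp hq /=; rewrite (socompP_homog char0 superV d_even f G hp hq).
have -> : (fun i (a : 'I_(m i)) => cast_ord (erefl _) (tagnat.Rank i a))
    = (fun i (a : 'I_(m i)) => tagnat.Rank i a).
  by do 2!apply: functional_extensionality_dep => ?; rewrite cast_ord_id.
have -> : (fun k => tagnat.sig1 (cast_ord (esym (erefl _)) k)) = (@tagnat.sig1 n m).
  by apply/funext => k; congr tagnat.sig1; apply: val_inj.
congr (_ ^+ nat_of_bool _ *: _); apply: eq_kblocks => // i.
by apply: eq_parity_sum => a; rewrite cast_ord_id.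
Qed.

(** Inner signs are pulled out by multilinearity and the sign of f g by [comp_op_outer_scale];
    [comp_op_assoc] then leaves an identity between exponents. *)
Lemma socompP_assoc n (m : 'I_n -> nat) (l : 'I_(\sum_(i < n) m i) -> nat)
    (f : P n) (g : forall i, P (m i)) (h : forall k, P (l k)) p q :
  (forall i, ppar (p i) (g i)) -> (forall k, ppar (q k) (h k)) ->
  (-1) ^+ koszul_blocks p q *:
    ecast N (P N) (dim_assoc l)
      (socomp f (fun i => socomp (g i) (fun j => h (tagnat.Rank i j))))
  = socomp (socomp f g) h.
Proof.
move=> hp hq; apply: (pcl_homog_eq superV) => G Q v hQ.
pose e := dim_assoc l; pose N i := (\sum_(j < m i) l (tagnat.Rank i j))%N.
pose rN i (a : 'I_(N i)) := cast_ord e (tagnat.Rank i a).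
pose bN k := tagnat.sig1 (cast_ord (esym e) k).
have hN : blocks rN bN by apply/blocks_cast/Rank_blocks.
have compat i j a : rN i (tagnat.Rank j a) = tagnat.Rank (tagnat.Rank i j) a.
  by apply: val_inj; apply: Rank_Rank.
rewrite pcl_valZ -[LHS]/(_ *: pcl_val (ecast N (P N) e _) G v).
have hq' i j : ppar (q (tagnat.Rank i j)) (h (tagnat.Rank i j)) by apply: hq.
have hgh i : ppar (p i (+) parity_sum (fun j => q (tagnat.Rank i j)))
    (socomp (g i) (fun j => h (tagnat.Rank i j))).
  exact: (socompP_par char0 superV d_even (hp i) (hq' i)).
pose gh i := comp_op (fun j (a : 'I_(l (tagnat.Rank i j))) => tagnat.Rank j a)
  tagnat.sig1 (pcl_val (g i)) (fun j => pcl_val (h (tagnat.Rank i j))).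
have -> : pcl_val (ecast N (P N) e
      (socomp f (fun i => socomp (g i) (fun j => h (tagnat.Rank i j))))) G v
    = (-1) ^+ kblocks (fun i => p i (+) parity_sum (fun j => q (tagnat.Rank i j)))
        (fun i => parity_sum (fun a => Q (rN i a)))
      *: comp_op rN bN (pcl_val f)
        (fun i => pcl_val (socomp (g i) (fun j => h (tagnat.Rank i j)))) G v.
  exact: (ecast_socompP e f G hgh hQ).
pose c i := kblocks (fun j => q (tagnat.Rank i j))
  (fun j => parity_sum (fun a => Q (rN i (tagnat.Rank j a)))).
have inner_sign i (H : graph (N i)) :
    pcl_val (socomp (g i) (fun j => h (tagnat.Rank i j))) H (fun a => v (rN i a))
    = (-1) ^+ c i *: gh i H (fun a => v (rN i a)).
  have hQi : homog (fun a => Q (rN i a)) (fun a => v (rN i a)) by move=> a; apply: hQ.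
  by rewrite (socompP_homog char0 superV d_even (g i) H (hq' i) hQi).
rewrite (comp_op_inner_scale (g' := gh) hN (pclP f) (fun i => inner_sign i _)).
have -> : comp_op rN bN (pcl_val f) gh
    = comp_op (fun k (a : 'I_(l k)) => tagnat.Rank k a) tagnat.sig1
        (comp_op (fun i (a : 'I_(m i)) => tagnat.Rank i a) tagnat.sig1
           (pcl_val f) (fun i => pcl_val (g i))) (fun k => pcl_val (h k)).
  exact: (comp_op_assoc char0 (Rank_blocks m) (Rank_blocks l) hN
    (fun i => Rank_blocks _) compat (pclP f) (fun i => pclP (g i)) (fun k => pclP (h k))).
rewrite sign_prod (socompP_homog char0 superV d_even _ G hq hQ).
pose Q2 k := q k (+) parity_sum (fun a => Q (tagnat.Rank k a)).
have outer_sign (H : graph (\sum_(i < n) m i)) u : homog Q2 u ->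
    pcl_val (socomp f g) H u
    = (-1) ^+ kblocks p (fun i => parity_sum (fun j => Q2 (tagnat.Rank i j)))
      *: comp_op (fun i (a : 'I_(m i)) => tagnat.Rank i a) tagnat.sig1
           (pcl_val f) (fun i => pcl_val (g i)) H u.
  by move=> hu; rewrite (socompP_homog char0 superV d_even f H hp hu).
rewrite (comp_op_outer_scale superV d_even (Rank_blocks l) (pclP _)
  (comp_op_pcl char0 (Rank_blocks m) (pclP f) (fun i => pclP (g i)))
  (outer_sign _)); last first.
  by move=> k; apply: hq => a; apply: hQ.
rewrite !scalerA -!signr_addb; congr (_ ^+ nat_of_bool _ *: _).
(* Total parities: q2 of the h in part i, Q3 of the vectors given to one h, R2 of the vectors
   belonging to part i. Bilinearity and [kblocks_nested] reduce both exponents to the same four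
   terms. *)
pose q2 i := parity_sum (fun j => q (tagnat.Rank i j)).
pose Q3 k := parity_sum (fun a => Q (tagnat.Rank k a)).
pose R2 i := parity_sum (fun j => Q3 (tagnat.Rank i j)).
have QE i : parity_sum (fun a => Q (rN i a)) = R2 i.
  rewrite (parity_sum_blocks _ (Rank_blocks _)); apply: eq_parity_sum => j.
  by apply: eq_parity_sum => a; rewrite compat.
have -> : kblocks (fun i => p i (+) q2 i) (fun i => parity_sum (fun a => Q (rN i a)))
    = kblocks p R2 (+) kblocks q2 R2.
  by rewrite -kblocks_addl; apply: eq_kblocks.
have -> : parity_sum c = parity_sum (fun i =>
    kblocks (fun j => q (tagnat.Rank i j)) (fun j => Q3 (tagnat.Rank i j))).
  apply: eq_parity_sum => i; apply: eq_kblocks => // j.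
  by apply: eq_parity_sum => a; rewrite compat.
have -> : kblocks p (fun i => parity_sum (fun j => Q2 (tagnat.Rank i j)))
    = kblocks p q2 (+) kblocks p R2.
  rewrite -kblocks_addr; apply: eq_kblocks => // i.
  by rewrite -parity_sum_addb.
rewrite koszul_blocksE (kblocks_nested q) -/q2 -/R2.
set x := kblocks p q2; set y := kblocks p R2; set z := kblocks q2 R2.
by set w := parity_sum _; case: x y z w => [] [] [] [].
Qed.

Lemma kblocks_even n (q : 'I_n -> bool) : kblocks (fun=> false) q = false.
Proof.
by rewrite /kblocks big1 // => j _; rewrite big1 // => i _; rewrite andbF.
Qed.

Lemma socompP_unitr n (f : P n) :
  ecast N (P N) (dim_unitr n) (socomp f (fun=> sounitP d)) = f.
Proof.
apply: (pcl_homog_eq superV) => G q v hq.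
rewrite (ecast_socompP (dim_unitr n) f G (fun=> sounitP_par d superV) hq).
rewrite kblocks_even scale1r.
have rE i (a : 'I_1) : cast_ord (dim_unitr n) (@tagnat.Rank n (fun=> 1%N) i a) = i.
  apply: val_inj; rewrite [LHS](tagnat.RankEsum (p_ := fun=> 1%N)) (ord1 a) addn0.
  by rewrite -(big_ord_widen n (fun=> 1%N)) 1?ltnW // sum1_card card_ord.
have -> : (fun k => tagnat.sig1 (cast_ord (esym (dim_unitr n)) k)) = id.
  apply/funext => k.
  by rewrite -{1}(rE k ord0) (blocksK (blocks_cast (dim_unitr n) (Rank_blocks (fun=> 1%N)))).
by rewrite (comp_op_unitr (f := pcl_val f) rE (pclP f)).
Qed.

Lemma socompP_unitl_homog n (f : P n) b : ppar b f ->
  ecast N (P N) (dim_unitl n) (socomp (sounitP d) (fun=> f)) = f.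
Proof.
move=> hf; apply: (pcl_homog_eq superV) => G q v hq.
rewrite (ecast_socompP (dim_unitl n) (sounitP d) G (fun=> hf) hq).
have rE i (a : 'I_n) : cast_ord (dim_unitl n) (@tagnat.Rank 1 (fun=> n) i a) = a.
  by apply: val_inj; rewrite [LHS](tagnat.RankEsum (p_ := fun=> n)) (ord1 i) big_pred0.
have -> : (fun k => tagnat.sig1 (cast_ord (esym (dim_unitl n)) k)) = (fun=> ord0).
  by apply/funext => k; rewrite ord1.
rewrite (comp_op_unitl (f := pcl_val f) rE (pclP f)).
by rewrite /kblocks !big_ord1 /= scale1r.
Qed.

(** The explicit form of a composition needs the parities of the inserted operations, so f is first
    split into its homogeneous parts. *)
Lemma socompP_unitl n (f : P n) :
  ecast N (P N) (dim_unitl n) (socomp (sounitP d) (fun=> f)) = f.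
Proof.
have [f0 [f1 [h0 h1 ->]]] := superspace_decomp (pcl_superspace superV d_even n) f.
have cst (x : P n) : (fun=> x) = @dfwith _ (fun i : 'I_1 => P n) (fun=> 0) ord0 x.
  by apply/funext => i; rewrite (ord1 i) dfwith_in.
have -> : socomp (sounitP d) (fun=> f0 + f1)
    = socomp (sounitP d) (fun=> f0) + socomp (sounitP d) (fun=> f1).
  rewrite (cst (f0 + f1)) (cst f0) (cst f1).
  have := socompP_linear_r char0 superV d_even (m := fun _ : 'I_1 => n)
    (sounitP d) (fun=> 0) (i := ord0) 1 f0 f1.
  by rewrite !scale1r => H; exact: H.
have castD N K (e : N = K) (x y : P N) :
    ecast N (P N) e (x + y) = ecast N (P N) e x + ecast N (P N) e y.
  by case: K / e.
by rewrite castD (socompP_unitl_homog h0) (socompP_unitl_homog h1).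
Qed.

Lemma socompP_equivariant n (m : 'I_n -> nat) (s : 'S_n)
    (t : forall i, 'S_(m i)) (f : P n) (g : forall i, P (m i)) p :
  (forall i, ppar (p i) (g i)) ->
  socomp (soactP superV d_even s f) (fun i => soactP superV d_even (t i) (g i))
  = (-1) ^+ koszul_perm s p *:
      soactP superV d_even (block_perm s t)
        (ecast N (P N) (dim_perm m s) (socomp f (fun i => g (s^-1%g i)))).
Proof.
move=> hp; apply: (pcl_homog_eq superV) => G q v hq.
pose beta := block_perm s t; pose e := dim_perm m s.
pose r' i (a : 'I_(m (s^-1%g i))) := cast_ord e (tagnat.Rank i a).
have hR := Rank_blocks m.
have hb' := blocks_cast e (Rank_blocks (fun i => m (s^-1%g i))).
have compat i (a : 'I_(m (s^-1%g i))) :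
    beta (tagnat.Rank (s^-1%g i) a) = r' i (t (s^-1%g i) a).
  by rewrite block_perm_Rank; apply/val_inj/eq_Rank_nat; rewrite ?permKV.
pose q2 i := parity_sum (fun a => q (tagnat.Rank i a)).
have hsg i : ppar (p i) (soactP superV d_even (t i) (g i)) by apply: soactP_par.
rewrite (socompP_homog char0 superV d_even _ G hsg hq) -/q2.
have outer_sign (H : graph n) u : homog (fun i => p i (+) q2 i) u ->
    pcl_val (soactP superV d_even s f) H u
    = (-1) ^+ kperm s (fun i => p i (+) q2 i) *: act_op s (pcl_val f) H u.
  by move=> hu; rewrite (soactP_homog superV d_even s f H hu).
have gpar i : Vlam_par par (p i (+) q2 i)
    (pcl_val (soactP superV d_even (t i) (g i)) (inner (@tagnat.Rank n m) i G)
       (fun a => v (tagnat.Rank i a))).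
  by apply: hsg => a; apply: hq.
rewrite (comp_op_outer_scale superV d_even hR (pclP _)
  (act_op_pcl s (pclP f)) (outer_sign _) gpar).
have inner_sign i (H : graph (m i)) :
    pcl_val (soactP superV d_even (t i) (g i)) H (fun a => v (tagnat.Rank i a))
    = (-1) ^+ kperm (t i) (fun a => q (tagnat.Rank i a))
      *: act_op (t i) (pcl_val (g i)) H (fun a => v (tagnat.Rank i a)).
  have hqi : homog (fun a => q (tagnat.Rank i a)) (fun a => v (tagnat.Rank i a)).
    by move=> a; apply: hq.
  by rewrite (soactP_homog superV d_even (t i) (g i) H hqi).
rewrite (comp_op_inner_scale (g' := fun i => act_op (t i) (pcl_val (g i))) hR
  (act_op_pcl s (pclP f)) (fun i => inner_sign i _)).
rewrite (comp_op_equivariant hR hb' compat (pclP f) (fun i => pclP (g i))).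
rewrite pcl_valZ -[RHS]/(_ *: pcl_val (soactP superV d_even beta _) G v).
rewrite (soactP_homog superV d_even beta _ G hq).
have hqb : homog (fun k => q (beta^-1%g k)) (fun k => v (beta^-1%g k)).
  by move=> k; apply: hq.
have hgs i : ppar (p (s^-1%g i)) (g (s^-1%g i)) by apply: hp.
have -> : act_op beta (pcl_val (ecast N (P N) e (socomp f (fun i => g (s^-1%g i))))) G v
    = (-1) ^+ kblocks (fun i => p (s^-1%g i)) (fun i => q2 (s^-1%g i))
      *: act_op beta (comp_op r' (fun k => tagnat.sig1 (cast_ord (esym e) k))
           (pcl_val f) (fun i => pcl_val (g (s^-1%g i)))) G v.
  rewrite {1}/act_op (ecast_socompP e f _ hgs hqb).
  rewrite (oplinZ (@pb_linear F V d _ _ beta)); congr (_ ^+ nat_of_bool _ *: _).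
  apply: eq_kblocks => // i; rewrite /q2 !parity_sumE.
  rewrite (reindex_inj (@perm_inj _ (t (s^-1%g i)))).
  by apply: eq_bigr => a _; rewrite -[cast_ord _ _]compat permK.
rewrite sign_prod !scalerA -!signr_addb; congr (_ ^+ nat_of_bool _ *: _).
(* The exponent of beta splits into that of s on the block parities and those of the t i. The latter
   cancel against the inner actions, and the rest is [kperm_equivariant]. *)
rewrite koszul_permE (@kperm_blocks _ _ s t).
- have := kperm_equivariant s p q2.
  rewrite -/q2; set w := parity_sum _; set x := kblocks p q2.
  set y := kperm s _; set z := kperm s p; set z' := kperm s q2; set x' := kblocks _ _.
  by move=> E; rewrite addbA E; case: z z' w x' {E} => [] [] [] [].
- move=> i a j b nij; rewrite !block_perm_Rank.
  by rewrite -(Rank_lt (m := fun i => m (s^-1%g i)) (cast_ord (block_perm_dim m s i) (t i a))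
    (cast_ord (block_perm_dim m s j) (t j b))) // (inj_eq perm_inj).
move=> i a b; rewrite !block_perm_Rank.
exact: (Rank_lt_same (m := fun i => m (s^-1%g i)) (cast_ord (block_perm_dim m s i) (t i a))
  (cast_ord (block_perm_dim m s i) (t i b))).
Qed.
End PclLaws.

(** * The grading by the number of edges *)

Lemma nb_edges_del n (G : graph n) e : (0 < mult G e)%N ->
  nb_edges (del_edge G e) = (nb_edges G).-1.
Proof.
case: e => k l hkl; rewrite /nb_edges (bigD1 (k, l)) //= [in RHS](bigD1 (k, l)) //=.
rewrite mult_del_edge eqxx subn1 -[RHS]subn1 -addnBAC // subn1; congr (_ + _)%N.
by apply: eq_bigr => -[i j] ne; rewrite mult_del_edge eq_sym (negPf ne) subn0.
Qed.

Lemma oriented_cycle_mult n (G : graph n) C e :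
  oriented_cycle G C -> e \in C -> (0 < mult G e)%N.
Proof.
move=> [_ [i /andP[_ /forallP hC]]] eC; apply: leq_trans (hC e).
rewrite /unzip1 -map_comp (eq_map (g := id)) // map_id.
by rewrite -has_count has_pred1.
Qed.

(** A crude bound, enough to make the decomposition into degrees finite. *)
Lemma nb_edges_acyclic n (G : graph n) : acyclic G -> (nb_edges G <= n * n)%N.
Proof.
move=> hG; rewrite -[X in (_ <= X * X)%N]card_ord -card_prod -sum1_card.
apply: leq_sum => -[i j] _; apply: leq_trans (acyclic_mult i j hG).
exact: leq_addr.
Qed.

Section Grading.
Variables (F : fieldType) (V : lmodType F) (par : bool -> V -> Prop).
Variable d : {linear V -> V}.
Hypothesis char0 : [pchar F] =i pred0.
Hypothesis superV : is_superspace par.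
Hypothesis d_even : forall b v, par b v -> par b (d v).
Local Notation P := (Pcl d).
Local Notation ppar := (Pcl_par (d := d) par).
Local Notation gr := (@Pcl_gr F V d _).

(** All graphs in a cycle relation have the same number of edges, so this rescaling preserves P^cl.
    Indicator functions c give the projections to the degrees. *)
Definition edge_scale n (c : nat -> F) (f : rawop d n) : rawop d n :=
  fun G v => c (nb_edges G) *: f G v.

Lemma edge_scale_pcl n c (f : rawop d n) : is_pcl f -> is_pcl (edge_scale c f).
Proof.
move=> hf; split=> [G v i a x y|G v nG|G C v hC|G v i j hij|G v i]; rewrite /edge_scale.
- by rewrite (pcl_linear hf) scalerDr !scalerA mulrC.
- by rewrite (pcl_acyclic hf) // scaler0.
- transitivity (c (nb_edges G).-1 *: \sum_(e <- C) f (del_edge G e) v).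
    rewrite scaler_sumr !big_seq; apply: eq_bigr => e eC.
    by rewrite nb_edges_del // (oriented_cycle_mult hC eC).
  by rewrite (pcl_cycle hf) // scaler0.
- by rewrite (oplinZ (@qderivB_linear F V d n i j)) (pcl_deriv hf) // scaler0.
rewrite -scaler_sumr (pcl_sesqui hf) scalerN scaler_sumr; congr (- _).
by apply: eq_bigr => j _; rewrite (oplinZ (@qmulX_linear F V d n j)).
Qed.

Definition edge_scaleP n c (f : P n) : P n := mk_pcl (edge_scale_pcl c (pclP f)).

Lemma edge_scaleP_par n c b (f : P n) : ppar b f -> ppar b (edge_scaleP c f).
Proof.
move=> hf G v q hq; apply: (superspaceZ (Vlam_superspace superV d_even n)).
exact: hf.
Qed.

(** Degree r as the kernel of the complementary projection. As operations are determined by their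
    values at homogeneous arguments, the degree can then be tested there, and compatibility with
    parities follows from directness. *)
Lemma grE n r (f : P n) :
  gr r f <-> edge_scaleP (fun k => (k != r)%:R) f = 0.
Proof.
split=> [h|h G v nr].
  apply: pcl_eq; rewrite pcl_val0; apply/funext => G; apply/funext => v.
  rewrite -[LHS]/(_ *: pcl_val f G v); case: eqP => [_|nr]; first by rewrite scale0r.
  by rewrite h // scaler0.
have := congr1 (fun h : P n => pcl_val h G v) h; rewrite pcl_val0.
rewrite -[X in X = _]/(_ *: pcl_val f G v).
by case: eqP nr => // _ _; rewrite scale1r.
Qed.

Lemma gr_homog n r (f : P n) :
  (forall G q v, homog par q v -> nb_edges G <> r -> pcl_val f G v = 0) -> gr r f.
Proof.
move=> h; apply/grE/(pcl_homog_eq superV) => G q v hq; rewrite pcl_val0.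
rewrite -[LHS]/(_ *: pcl_val f G v); case: eqP => [_|nr]; first by rewrite scale0r.
by rewrite (h _ _ _ hq nr) scaler0.
Qed.

Lemma pcl_gr0 n r : gr r (0 : P n).
Proof. by move=> G v _; rewrite pcl_val0. Qed.

Lemma pcl_grD n r (a : F) (f f' : P n) : gr r f -> gr r f' -> gr r (a *: f + f').
Proof.
move=> h h' G v nr; rewrite pcl_valD pcl_valZ.
by rewrite -[LHS]/(a *: pcl_val f G v + pcl_val f' G v) h // h' // scaler0 addr0.
Qed.

Lemma pcl_gr_decomp n (f : P n) : exists N (c : nat -> P n),
  (forall r, gr r (c r)) /\ f = \sum_(r < N) c r.
Proof.
exists (n * n).+1, (fun r => edge_scaleP (fun k => (k == r)%:R) f); split.
  by move=> r G v /eqP/negPf nr; rewrite -[LHS]/(_ *: pcl_val f G v) nr scale0r.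
apply: pcl_eq; apply/funext => G; apply/funext => v; rewrite pcl_val_sum.
have [hG|nG] := pselect (acyclic G); last first.
  by rewrite big1 ?(pcl_acyclic (pclP _) _ nG) // => r _; rewrite (pcl_acyclic (pclP _)).
have hr : (nb_edges G < (n * n).+1)%N by rewrite ltnS nb_edges_acyclic.
rewrite (bigD1 (Ordinal hr)) //= big1 ?addr0.
  by rewrite -[RHS]/(_ *: pcl_val f G v) /= eqxx scale1r.
move=> r; rewrite -val_eqE eq_sym => /negPf nr.
by rewrite -[LHS]/(_ *: pcl_val f G v) nr scale0r.
Qed.

Lemma pcl_gr_direct n N (c : nat -> P n) :
  (forall r, gr r (c r)) -> \sum_(r < N) c r = 0 ->
  forall r, (r < N)%N -> c r = 0.
Proof.
move=> hc h r hr; apply: pcl_eq; rewrite pcl_val0.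
apply/funext => G; apply/funext => v.
have [er|/hc ->] := pselect (nb_edges G = r); last by [].
have := congr1 (fun h : P n => pcl_val h G v) h.
rewrite pcl_val_sum (bigD1 (Ordinal hr)) //= big1 ?addr0 ?pcl_val0 // => i.
by rewrite -val_eqE => /eqP ne; apply: hc; rewrite er => e; apply: ne.
Qed.

Lemma pcl_gr_super n r (f0 f1 : P n) : ppar false f0 -> ppar true f1 ->
  gr r (f0 + f1) -> gr r f0 /\ gr r f1.
Proof.
move=> h0 h1 /grE; pose off (f : P n) := edge_scaleP (fun k => (k != r)%:R) f.
have offD f f' : off (f + f') = off f + off f'.
  apply: pcl_eq; rewrite pcl_valD; apply/funext => G; apply/funext => v.
  rewrite -[LHS]/(_ *: pcl_val (f + f') G v) pcl_valD.
  by rewrite -[LHS]/(_ *: (pcl_val f G v + pcl_val f' G v)) scalerDr.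
rewrite -/(off _) offD => e.
have hS := pcl_superspace superV d_even n.
have e0 : off f0 = 0.
  apply: (superspace_direct hS); first exact: edge_scaleP_par.
  have -> : off f0 = - off f1 by apply/eqP; rewrite -addr_eq0 e.
  rewrite -scaleN1r; apply: (superspaceZ hS); exact: edge_scaleP_par.
by split; apply/grE => //; move: e; rewrite e0 add0r.
Qed.

Lemma pcl_gr_act n r (s : 'S_n) (f : P n) : gr r f -> gr r (soactP superV d_even s f).
Proof.
move=> h; apply: gr_homog => G q v hq nr.
rewrite (soactP_homog superV d_even s f G hq) /act_op h ?nb_edges_relabel //.
by rewrite (oplin0 (@pb_linear F V d _ _ s)) scaler0.
Qed.

Lemma sproj_gr n r b (f : P n) : gr r f ->
  gr r (sproj (pcl_superspace superV d_even n) b f).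
Proof.
move=> h; set hS := pcl_superspace _ _ n.
have [] := @pcl_gr_super n r (sproj hS false f) (sproj hS true f).
- exact: sproj_par.
- exact: sproj_par.
- by rewrite sprojD.
by case: b.
Qed.

(** By [nb_edges_blocks], a wrong total forces a wrong count for the outer graph or for some inner
    graph, and f or that g_i vanishes there. The homogeneous parts of the g_i keep their degrees, so
    the sum defining the composition is treated term by term. *)
Lemma pcl_gr_comp n (m : 'I_n -> nat) r (q : 'I_n -> nat) (f : P n)
    (g : forall i, P (m i)) :
  gr r f -> (forall i, gr (q i) (g i)) ->
  gr (r + \sum_(i < n) q i)%N (socompP char0 superV d_even f g).
Proof.
move=> hf hg; apply: gr_homog => G e v he nr; rewrite pcl_val_sum; apply: big1 => p _.
set g' := fun i => sproj _ (p i) (g i).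
have hg' i : gr (q i) (g' i) by apply: sproj_gr.
rewrite -[LHS]/(twist superV _ (pcl_val (compP char0 f g')) G v).
rewrite (twist_homog superV _ G (pclP _) he).
rewrite -[X in _ *: X]/(comp_op (fun i (a : 'I_(m i)) => tagnat.Rank i a)
  tagnat.sig1 (pcl_val f) (fun i => pcl_val (g' i)) G v).
have hR := Rank_blocks m.
rewrite (nb_edges_blocks hR) in nr.
have [er|ner] := pselect (nb_edges (outer (fun i (a : 'I_(m i)) => tagnat.Rank i a) G) = r);
    last first.
  by rewrite (comp_op_outer0 hR) ?scaler0 // => u; apply: hf.
have [i hi] : exists i, nb_edges (inner (fun i (a : 'I_(m i)) => tagnat.Rank i a) i G) <> q i.
  apply: contrapT => /forallNP h; apply: nr; rewrite er; congr (_ + _)%N.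
  by apply: eq_bigr => i _; apply: contrapT (h i).
rewrite (comp_op_slot0 hR (pclP f) (i := i)) ?scaler0 //.
exact: hg'.
Qed.

End Grading.

(** * Assembly of the graded superoperad *)

Section Main.
Variables (F : fieldType) (V : lmodType F) (par : bool -> V -> Prop).
Variable d : {linear V -> V}.
Hypothesis char0 : [pchar F] =i pred0.
Hypothesis superV : is_superspace par.
Hypothesis d_even : forall b v, par b v -> par b (d v).
Local Notation ppar := (Pcl_par (d := d) par).

Definition pcl_superoperad : superoperad ppar :=
  Superoperad (pcl_superspace superV d_even)
    (socompP_linear_l char0 superV d_even) (socompP_linear_r char0 superV d_even)
    (socompP_par char0 superV d_even)
    (soactP_linear superV d_even) (soactP_par superV d_even)
    (soactP_1 superV d_even) (soactP_comp superV d_even)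
    (socompP_assoc char0 superV d_even) (sounitP_par d superV)
    (socompP_unitr char0 superV d_even) (socompP_unitl char0 superV d_even)
    (socompP_equivariant char0 superV d_even).

Lemma pcl_superoperad_action : has_Pcl_action pcl_superoperad.
Proof.
move=> n s f G v q hq; rewrite -[LHS]/(pcl_val (soactP superV d_even s f) G v).
rewrite (soactP_homog superV d_even s f G hq) koszul_permE /act_op.
by rewrite /pb pb_var_perm.
Qed.

Lemma pcl_superoperad_unit : has_Pcl_unit pcl_superoperad.
Proof. by []. Qed.

(** The abstract evaluation, taken at the standard numbering and at [ext], unfolds to the
    composition formula itself. *)
Lemma comp_value_eval_op n (m : 'I_n -> nat) (f : Pcl d n)
    (G : graph (\sum_(i < n) m i)%N) (w : forall i, vpoly V 'I_(m i)) :
  comp_value f G w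
  = eval_op d (fun i (a : 'I_(m i)) => tagnat.Rank i a) (@qmul F V d _)
      (ext (fun i (a : 'I_(m i)) => tagnat.Rank i a) tagnat.sig1 G)
      (pull (fun i (a : 'I_(m i)) => tagnat.Rank i a)
         (pcl_val f (outer_graph G))) w.
Proof. by rewrite /comp_value /eval_op /tensor_eval /teval /teval_on. Qed.

Lemma pcl_superoperad_comp : has_Pcl_comp pcl_superoperad.
Proof.
move=> n m f g p hp G v q hq.
rewrite -[pcl_val _]/(pcl_val (socompP char0 superV d_even f g)).
rewrite (socompP_homog char0 superV d_even f G hp hq) koszul_blocksE.
split=> [nG|hG w hw]; first by rewrite comp_op_nacyclic ?scaler0.
by rewrite comp_value_eval_op (comp_opE (Rank_blocks m) (pclP f) hG
  (ext_coboundary (Rank_blocks m) hG) hw).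
Qed.

Lemma pcl_superoperad_graded : is_graded pcl_superoperad (Pcl_gr (d := d)).
Proof.
split.
- exact: pcl_gr0.
- exact: pcl_grD.
- exact: pcl_gr_decomp.
- exact: pcl_gr_direct.
- exact: (pcl_gr_super superV d_even).
- exact: (pcl_gr_act superV d_even).
exact: (pcl_gr_comp char0 superV d_even).
Qed.

End Main.

Theorem theorem10p6 (F : fieldType) (char0 : [pchar F] =i pred0)
    (V : lmodType F) (par : bool -> V -> Prop) (d : {linear V -> V})
    (superV : is_superspace par)
    (d_even : forall b v, par b v -> par b (d v)) :
  exists O : superoperad (Pcl_par (d := d) par),
    [/\ has_Pcl_comp O, has_Pcl_action O, has_Pcl_unit O
      & is_graded O (Pcl_gr (d := d))].
Proof.
exists (pcl_superoperad char0 superV d_even); split.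
- exact: pcl_superoperad_comp.
- exact: pcl_superoperad_action.
- exact: pcl_superoperad_unit.
exact: pcl_superoperad_graded.
Qed.
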